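(* Let $X$ be a random vector in $\mathbb{R}^d$ with mean zero and identity covariance matrix, and let $Z_n=(X_1+\dots+X_n)/\sqrt n$, where $(X_k)_{k\ge1}$ are independent copies of $X$. Assume that for some $n=n_0$, $Z_n$ has a density $p_n$ with $T_\infty(p_n\|\varphi)<\infty$. If $$\sup_{|t|\ge t_0}\Big[e^{-|t|^2/2}\,\mathbb{E}\,e^{\langle t,X\rangle}\Big]<1\quad\text{for all } t_0>0,$$ then $T_\infty(p_n\|\varphi)\to 0$ as $n\to\infty$.
   Context: $\varphi(x)=(2\pi)^{-d/2}e^{-|x|^2/2}$ is the standard normal density on $\mathbb{R}^d$. For a probability density $p$ on $\mathbb{R}^d$, $T_\infty(p\|\varphi)=\operatorname{ess\,sup}_{x\in\mathbb{R}^d}\frac{p(x)-\varphi(x)}{\varphi(x)}$. $p_n$ denotes the density of $Z_n$ (it exists for all $n\ge n_0$ once it exists for $n=n_0$). *)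

(* Defs.v *)
From HB Require Import structures.
From mathcomp Require Import all_boot all_order all_algebra finmap.
From mathcomp Require Import all_classical all_reals all_analysis.
From mathcomp Require Import measurable_realfun ess_sup_inf.

Set Implicit Arguments.
Unset Strict Implicit.
Unset Printing Implicit Defensive.

Import Order.TTheory GRing.Theory Num.Theory.
Import numFieldNormedType.Exports.

Local Open Scope classical_set_scope.
Local Open Scope ring_scope.

(* [d.-tuple] carries the product sigma-algebra, i.e. the Borel sets of R^d. *)
Notation euclidean R d := (d.-tuple (measurableTypeR R)).

Section euclidean.
Context {R : realType} {d : nat}.
Implicit Types x y : euclidean R d.

Definition dotp x y : R := \sum_(i < d) tnth x i * tnth y i.

Definition enorm x : R := Num.sqrt (dotp x x).

Definition std_normal_density x : R :=
  (2 * pi) `^ (- (d%:R / 2)) * expR (- (enorm x ^+ 2) / 2).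

End euclidean.

Section lebesgue_measure_euclidean.
Context {R : realType}.

Section step.
Variable n : nat.

Definition tuple_cons (z : measurableTypeR R * euclidean R n) :
  euclidean R n.+1 := [tuple of z.1 :: z.2].

Definition tuple_uncons (t : euclidean R n.+1) :
  measurableTypeR R * euclidean R n := (thead t, [tuple of behead t]).

Lemma tuple_consK : cancel tuple_cons tuple_uncons.
Proof.
move=> [x t]; rewrite /tuple_uncons /tuple_cons /=; congr pair.
exact/val_inj.
Qed.

Lemma measurable_tuple_cons : measurable_fun setT tuple_cons.
Proof. exact: measurable_cons. Qed.

Lemma measurable_tuple_uncons : measurable_fun setT tuple_uncons.
Proof.
apply: measurable_fun_pair; last exact: measurable_behead.
exact: measurable_tnth.
Qed.

HB.instance Definition _ :=
  isMeasurableFun.Build _ _ _ _ tuple_cons measurable_tuple_cons.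

Variable mu : {sigma_finite_measure set (euclidean R n) -> \bar R}.

Definition lebesgue_cons : set (euclidean R n.+1) -> \bar R :=
  pushforward (@lebesgue_measure R \x mu)%E tuple_cons.

Let lebesgue_cons0 : lebesgue_cons set0 = 0%E.
Proof. exact: measure0. Qed.

Let lebesgue_cons_ge0 A : (0 <= lebesgue_cons A)%E.
Proof. exact: measure_ge0. Qed.

Let lebesgue_cons_sigma_additive : semi_sigma_additive lebesgue_cons.
Proof. exact: measure_semi_sigma_additive. Qed.

HB.instance Definition _ := isMeasure.Build _ _ _ lebesgue_cons
  lebesgue_cons0 lebesgue_cons_ge0 lebesgue_cons_sigma_additive.

Let lebesgue_cons_sigma_finite : sigma_finite setT lebesgue_cons.
Proof.
have /sigma_finiteP[F [FT ndF Foo]] := sigma_finiteT (@lebesgue_measure R).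
have /sigma_finiteP[G [GT ndG Goo]] := sigma_finiteT mu.
exists (fun k => tuple_uncons @^-1` (F k `*` G k)).
  rewrite -preimage_bigcup [X in _ @^-1` X](_ : _ = setT)//.
  rewrite -setXTT FT GT predeqE => -[x y]; split.
    by move=> [k _ [/= ? ?]]; split; exists k.
  move=> [/= [k _ Fkx] [l _ Gly]]; exists (maxn k l) => //; split.
    by move: x Fkx; exact/subsetPset/ndF/leq_maxl.
  by move: y Gly; exact/subsetPset/ndG/leq_maxr.
move=> k; have [mF Fk_oo] := Foo k; have [mG Gk_oo] := Goo k; split.
  rewrite -[X in measurable X]setTI; apply: measurable_tuple_uncons => //.
  exact: measurableX.
rewrite /lebesgue_cons /pushforward -comp_preimage.
rewrite (_ : tuple_uncons \o tuple_cons = id); last first.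
  by apply/funext => z; exact: tuple_consK.
by rewrite product_measure1E// lte_mul_pinfty// ge0_fin_numE.
Qed.

HB.instance Definition _ :=
  Measure_isSigmaFinite.Build _ _ _ lebesgue_cons lebesgue_cons_sigma_finite.

End step.

(* Lebesgue measure on R^d as the d-fold product of the one on R, the
   zero-dimensional factor being the point mass. *)
Fixpoint lebesgue_measure_euclidean (d : nat) :
    {sigma_finite_measure set (euclidean R d) -> \bar R} :=
  match d with
  | 0 => @dirac _ (euclidean R 0) [tuple] R
  | n.+1 => lebesgue_cons (lebesgue_measure_euclidean n)
  end.

Lemma lebesgue_measure_euclidean_box d (A : 'I_d -> set (measurableTypeR R)) :
  (forall i, measurable (A i)) ->
  lebesgue_measure_euclidean d [set x | forall i, A i (tnth x i)] =
  (\prod_(i < d) (@lebesgue_measure R) (A i))%E.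
Proof.
elim: d A => [|n IH] A mA.
  rewrite big_ord0 /= diracE mem_set//= => -[]//.
rewrite big_ord_recl -IH//= /lebesgue_cons /pushforward.
rewrite -product_measure1E//; last first.
  rewrite (_ : [set _ | _] = \bigcap_(i in [set: 'I_n])
      ((@tnth _ _)^~ i @^-1` A (lift ord0 i))); last first.
    by apply/seteqP; split => x /= h i => [_|]; exact: h.
  apply: fin_bigcap_measurable => // i _.
  by rewrite -[X in measurable X]setTI; exact: measurable_tnth.
congr (_ _); apply/seteqP; split => -[x t] /=.
  move=> h; split => [|i]; first exact: (h ord0).
  by have := h (lift ord0 i); rewrite tnthS.
move=> [h0 h] i; case: (unliftP ord0 i) => [j|] ->//.
by rewrite tnthS; exact: h.
Qed.

End lebesgue_measure_euclidean.

Section random_vectors.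
Context d0 {T : measurableType d0} {R : realType} (P : probability T R).
Context {d : nat}.

Definition coord (X : T -> euclidean R d) (i : 'I_d) : T -> R :=
  fun w => tnth (X w) i.

(* A Lebesgue integral whose positive and negative parts are both infinite is
   -oo, so prescribing finite values here entails integrability of the
   coordinates and of their squares. *)
Definition mean_zero (X : {RV P >-> euclidean R d}) :=
  forall i, 'E_P[coord X i]%E = 0%E.

Definition identity_covariance (X : {RV P >-> euclidean R d}) :=
  forall i j, covariance P (coord X i) (coord X j) = ((i == j)%:R)%:E.

Definition same_law (X Y : {RV P >-> euclidean R d}) :=
  forall A, measurable A -> distribution P X A = distribution P Y A.

Definition mutually_independent (X : nat -> {RV P >-> euclidean R d}) :=
  forall (J : {fset nat}) (A : nat -> set (euclidean R d)),
    (forall k, k \in J -> measurable (A k)) ->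
    P (\bigcap_(k in [set` J]) (X k @^-1` A k)) =
    (\prod_(k <- J) P (X k @^-1` A k))%E.

(* The sequence is indexed from 0: [Xs k] stands for X_{k+1}. *)
Definition independent_copies (X : {RV P >-> euclidean R d})
    (Xs : nat -> {RV P >-> euclidean R d}) :=
  mutually_independent Xs /\ forall k, same_law (Xs k) X.

Definition normalized_sum (Xs : nat -> {RV P >-> euclidean R d}) (n : nat) :
    T -> euclidean R d :=
  fun w => [tuple (\sum_(k < n) tnth (Xs k w) i) / Num.sqrt n%:R | i < d].

Lemma measurable_normalized_sum Xs n :
  measurable_fun setT (normalized_sum Xs n).
Proof.
apply/measurable_fun_tnthP => i.
rewrite (_ : _ \o _ = fun w =>
    (\sum_(k < n) tnth (Xs k w) i) * (Num.sqrt n%:R)^-1); last first.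
  by apply/funext => w /=; rewrite tnth_mktuple.
apply: measurable_funM => //.
apply: measurable_sum => k.
apply: (measurableT_comp (measurable_tnth i)).
exact: (@measurable_funPT _ _ _ _ (Xs k)).
Qed.

HB.instance Definition _ Xs n := isMeasurableFun.Build _ _ _ _
  (normalized_sum Xs n) (measurable_normalized_sum Xs n).

Definition is_density (Z : {RV P >-> euclidean R d}) (p : euclidean R d -> R) :=
  [/\ measurable_fun setT p,
      forall x, 0 <= p x &
      forall A, measurable A ->
        distribution P Z A =
        (\int[lebesgue_measure_euclidean d]_(x in A) (p x)%:E)%E].

End random_vectors.

Arguments mean_zero {d0 T R} P {d} X.
Arguments identity_covariance {d0 T R} P {d} X.
Arguments same_law {d0 T R} P {d} X Y.
Arguments mutually_independent {d0 T R} P {d} X.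
Arguments independent_copies {d0 T R} P {d} X Xs.
Arguments is_density {d0 T R} P {d} Z p.

(* T_oo(p || phi); the essential supremum is taken in the extended reals. *)
Definition Tinfty {R : realType} {d : nat} (p : euclidean R d -> R) : \bar R :=
  ess_sup (lebesgue_measure_euclidean d)
    (fun x => ((p x - std_normal_density x) / std_normal_density x)%:E).

(* Main.v *)
Require Import Defs.
From HB Require Import structures.
From mathcomp Require Import all_boot all_order all_algebra finmap.
From mathcomp Require Import all_classical all_reals all_analysis.
From mathcomp Require Import measurable_realfun ess_sup_inf.
From mathcomp Require Import ring lra.

Set Implicit Arguments.
Unset Strict Implicit.
Unset Printing Implicit Defensive.

Import Order.TTheory GRing.Theory Num.Theory.
Import numFieldNormedType.Exports.

Local Open Scope classical_set_scope.
Local Open Scope ring_scope.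

(** Let [S_n = X_1 + ... + X_n] and [L y = E expR <y, X>]. The conclusion amounts
    to an upper bound on the density of [S_n]: for every eps > 0 and n large,
    almost everywhere
      g_n (s) <= (1 + eps) (2 pi n)^(-d/2) expR (- |s|^2 / (2 n)),
    because the limit cannot be negative: a density and phi have the same
    integral, so that Tinfty is always at least 0 ([Tinfty_ge0]).

    Since Tinfty is finite at n0, the density of [S_n0] may be taken everywhere
    below a Gaussian, and convolving it k times with the law of X gives an
    everywhere defined density [cdens k] of [S_(n0 + k)]. The Gaussian bound is
    inherited by convolutions after exponential tilting ([tilt_cdens_le]):
      expR <y, s> * cdens k s <= C * expR (n0 |y|^2 / 2) * L y ^ k   for all y, s.
    With the optimal tilt y = s / n, and because L y <= del * expR (|y|^2 / 2) for
    some del < 1 when |y| >= t, the points s with |s| >= t n are disposed of: the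
    factor del ^ k beats n^(d/2).

    For |s| <= t n the same tilt is used, but the tilted density is now bounded by
    Fourier inversion ([cdens_le_famp]),
      (2 pi)^d * expR <y, s> * g_n (s) <= \int |F_y|^n,
    where F_y is the Fourier transform of expR <y, .> with respect to the law of
    X. Only moduli and upper bounds are involved, and the inversion is done by
    smoothing with the Cauchy kernel. What remains is the uniform estimate
      \int |F_y|^n <= (1 + eps) (2 pi / n)^(d/2) expR (n |y|^2 / 2),  |y| <= t
    ([local_bound]). It comes from writing L y ^ 2 - |F_y (s)|^2 as a double
    integral of expR <y, x + x'> * (1 - cos <s, x - x'>) over two copies of X.
    Keeping only pairs in a ball of radius K, where the exponential is at least
    expR (- 2 K |y|), and using L y <= expR (|y|^2 / 2), one is left with the
    integral [gap K s] of 1 - cos <s, x - x'>, which does not depend on y. Near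
    s = 0 it is at least (1 - eta) |s|^2 because the covariance is the identity
    ([gap_near0]), so that |F_y|^n is below a Gaussian; away from 0 it is bounded
    below ([gap_far]) because, X having a bounded density after n0 convolutions,
    |F_0|^(2 n0) is integrable by Plancherel's inequality. With the same
    inequality for F_y, the high frequencies are exponentially small.

    Each tilt y has its own exceptional null set, so y ranges over rational
    vectors close to s / n. *)

Lemma eq_imp_le {disp} {T : porderType disp} (x y : T) : x = y -> (x <= y)%O.
Proof. by move->. Qed.

Section almost_everywhere.
Context {disp} {T : measurableType disp} {R : realType}.
Variables (mu : {measure set T -> \bar R}) (A B C : T -> Prop).

Lemma ae_mono : (forall x, A x -> B x) ->
  {ae mu, forall x, A x} -> {ae mu, forall x, B x}.
Proof.
have FF : Filter (nbhs (almost_everywhere mu)) by exact: ae_filter_ringOfSetsType.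
exact: (@filterS _ _ FF).
Qed.

Lemma ae_mono2 : (forall x, A x -> B x -> C x) ->
  {ae mu, forall x, A x} -> {ae mu, forall x, B x} -> {ae mu, forall x, C x}.
Proof.
have FF : Filter (nbhs (almost_everywhere mu)) by exact: ae_filter_ringOfSetsType.
exact: (@filterS2 _ _ FF).
Qed.

End almost_everywhere.

(** * Vectors of R^d *)

Section vectors.
Context {R : realType} {d : nat}.
Implicit Types x y z : euclidean R d.

Definition vadd x y : euclidean R d := [tuple tnth x i + tnth y i | i < d].
Definition vsub x y : euclidean R d := [tuple tnth x i - tnth y i | i < d].
Definition vscale (a : R) x : euclidean R d := [tuple a * tnth x i | i < d].
Definition vzero : euclidean R d := [tuple 0 | i < d].

Lemma tnth_vadd x y i : tnth (vadd x y) i = tnth x i + tnth y i.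
Proof. exact: tnth_mktuple. Qed.
Lemma tnth_vsub x y i : tnth (vsub x y) i = tnth x i - tnth y i.
Proof. exact: tnth_mktuple. Qed.
Lemma tnth_vscale a x i : tnth (vscale a x) i = a * tnth x i.
Proof. exact: tnth_mktuple. Qed.
Lemma tnth_vzero i : tnth vzero i = 0.
Proof. exact: tnth_mktuple. Qed.

Lemma vecP x y : (forall i, tnth x i = tnth y i) -> x = y.
Proof. exact: eq_from_tnth. Qed.

Lemma dotpC x y : dotp x y = dotp y x.
Proof. by rewrite /dotp; apply: eq_bigr => i _; rewrite mulrC. Qed.
Lemma dotpDl x y z : dotp (vadd x y) z = dotp x z + dotp y z.
Proof.
by rewrite /dotp -big_split; apply: eq_bigr => i _; rewrite tnth_vadd mulrDl.
Qed.
Lemma dotpDr x y z : dotp x (vadd y z) = dotp x y + dotp x z.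
Proof. by rewrite dotpC dotpDl !(dotpC x). Qed.
Lemma dotpBl x y z : dotp (vsub x y) z = dotp x z - dotp y z.
Proof.
by rewrite /dotp -sumrB; apply: eq_bigr => i _; rewrite tnth_vsub mulrBl.
Qed.
Lemma dotpBr x y z : dotp x (vsub y z) = dotp x y - dotp x z.
Proof. by rewrite dotpC dotpBl !(dotpC x). Qed.
Lemma dotpZl a x y : dotp (vscale a x) y = a * dotp x y.
Proof.
by rewrite /dotp mulr_sumr; apply: eq_bigr => i _; rewrite tnth_vscale mulrA.
Qed.
Lemma dotpZr a x y : dotp x (vscale a y) = a * dotp x y.
Proof. by rewrite dotpC dotpZl dotpC. Qed.
Lemma dotp0l x : dotp vzero x = 0.
Proof. by rewrite /dotp big1// => i _; rewrite tnth_vzero mul0r. Qed.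
Lemma dotp0r x : dotp x vzero = 0.
Proof. by rewrite dotpC dotp0l. Qed.

Lemma dotp_ge0 x : 0 <= dotp x x.
Proof. by apply: sumr_ge0 => i _; rewrite -expr2 sqr_ge0. Qed.
Lemma enorm_ge0 x : 0 <= enorm x.
Proof. exact: sqrtr_ge0. Qed.
Lemma enorm_sqr x : enorm x ^+ 2 = dotp x x.
Proof. by rewrite sqr_sqrtr// dotp_ge0. Qed.
Lemma enorm0 : enorm vzero = 0.
Proof. by rewrite /enorm dotp0l sqrtr0. Qed.
Lemma enormZ a x : enorm (vscale a x) = `|a| * enorm x.
Proof.
by rewrite /enorm dotpZl dotpZr mulrA -expr2 sqrtrM ?sqr_ge0// sqrtr_sqr.
Qed.

Lemma cauchy_schwarz x y : `|dotp x y| <= enorm x * enorm y.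
Proof.
suff: dotp x y ^+ 2 <= dotp x x * dotp y y.
  by move/ler_wsqrtr; rewrite sqrtr_sqr sqrtrM// dotp_ge0.
set a := dotp x x; set b := dotp x y; set c := dotp y y.
have h (s t : R) : 0 <= a * s ^+ 2 - s * t * b *+ 2 + c * t ^+ 2.
  have := dotp_ge0 (vsub (vscale s x) (vscale t y)).
  rewrite dotpBl !dotpBr !dotpZl !dotpZr (dotpC y x) -/a -/b -/c.
  by rewrite (_ : _ - _ = a * s ^+ 2 - s * t * b *+ 2 + c * t ^+ 2)//; ring.
have a0 : 0 <= a by exact: dotp_ge0.
have c0 : 0 <= c by exact: dotp_ge0.
have [c00|cN0] := eqVneq c 0.
  have [b0|bN0] := eqVneq b 0; first by rewrite b0 expr0n mulr_ge0.
  have := h b ((a * b ^+ 2 + 1) / (2 * b ^+ 2)).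
  rewrite c00 mul0r addr0.
  rewrite (_ : _ - _ = - 1); first by rewrite ler0N1.
  by field; rewrite bN0.
have := h c b.
rewrite (_ : _ - _ + _ = c * (a * c - b ^+ 2)); last by ring.
by rewrite pmulr_rge0 ?subr_ge0// lt_neqAle eq_sym cN0.
Qed.

Lemma enormD_le x y : enorm (vadd x y) <= enorm x + enorm y.
Proof.
rewrite -(@ler_pXn2r _ 2)// ?nnegrE ?addr_ge0 ?enorm_ge0//.
rewrite sqrrD !enorm_sqr dotpDl !dotpDr (dotpC y x).
have := le_trans (ler_norm _) (cauchy_schwarz x y).
by lra.
Qed.

Lemma enormB_le x y : enorm (vsub x y) <= enorm x + enorm y.
Proof.
have -> : vsub x y = vadd x (vscale (-1) y).
  by apply: vecP => i; rewrite tnth_vsub tnth_vadd tnth_vscale mulN1r.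
by rewrite (le_trans (enormD_le _ _))// enormZ normrN1 mul1r.
Qed.

Lemma tnth_le_enorm x i : `|tnth x i| <= enorm x.
Proof.
rewrite -sqrtr_sqr ler_sqrt ?dotp_ge0// /dotp (bigD1 i)//= -expr2 lerDl.
by apply: sumr_ge0 => j _; rewrite -expr2 sqr_ge0.
Qed.

Lemma enorm_le_coord x (r : R) : 0 <= r -> (forall i, `|tnth x i| <= r) ->
  enorm x <= d%:R * r.
Proof.
move=> r0 xr; rewrite -(@ler_pXn2r _ 2)// ?nnegrE ?enorm_ge0 ?mulr_ge0//.
rewrite enorm_sqr exprMn /dotp.
apply: (@le_trans _ _ (\sum_(i < d) r ^+ 2)).
  by apply: ler_sum => i _; rewrite -expr2 -real_normK ?num_real// ler_pXn2r ?nnegrE.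
rewrite sumr_const card_ord -[leLHS]mulr_natl ler_wpM2r ?sqr_ge0//.
rewrite -natrX ler_nat; case: d => // n; exact: leq_pmull.
Qed.

End vectors.

Section measurable_vectors.
Context {R : realType} {d : nat} {d1} {U : measurableType d1}.
Implicit Types f g : U -> euclidean R d.

Lemma measurable_coord f i : measurable_fun setT f ->
  measurable_fun setT (fun u => tnth (f u) i : R).
Proof. by move=> /measurable_fun_tnthP; apply. Qed.

Lemma measurable_vec (f : 'I_d -> U -> R) :
  (forall i, measurable_fun setT (f i)) ->
  measurable_fun setT (fun u => [tuple f i u | i < d] : euclidean R d).
Proof.
move=> mf; apply/measurable_fun_tnthP => i.
rewrite (_ : _ \o _ = f i); first exact: mf.
by apply/funext => u /=; rewrite tnth_mktuple.
Qed.

Lemma measurable_vadd f g : measurable_fun setT f -> measurable_fun setT g ->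
  measurable_fun setT (fun u => vadd (f u) (g u)).
Proof.
move=> mf mg; apply: measurable_vec => i.
by apply: measurable_funD; exact: measurable_coord.
Qed.

Lemma measurable_vsub f g : measurable_fun setT f -> measurable_fun setT g ->
  measurable_fun setT (fun u => vsub (f u) (g u)).
Proof.
move=> mf mg; apply: measurable_vec => i.
by apply: measurable_funB; exact: measurable_coord.
Qed.

Lemma measurable_vscale (a : R) f : measurable_fun setT f ->
  measurable_fun setT (fun u => vscale a (f u)).
Proof.
move=> mf; apply: measurable_vec => i.
by apply: measurable_funM => //; exact: measurable_coord.
Qed.

Lemma measurable_dotp f g : measurable_fun setT f -> measurable_fun setT g ->
  measurable_fun setT (fun u => dotp (f u) (g u)).
Proof.
move=> mf mg; rewrite /dotp; apply: measurable_sum => i.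
by apply: measurable_funM; exact: measurable_coord.
Qed.

Lemma measurable_enorm f : measurable_fun setT f ->
  measurable_fun setT (fun u => enorm (f u)).
Proof.
move=> mf; apply: (@measurableT_comp _ _ _ _ _ _ (@Num.sqrt R)) => //.
  by apply: continuous_measurable_fun; exact: sqrt_continuous.
exact: measurable_dotp.
Qed.

End measurable_vectors.

Notation leb R d := (@lebesgue_measure_euclidean R d).

(** * Lebesgue measure under affine maps and on products *)

Section lebesgue1.
Context {R : realType}.
Notation mu := (@lebesgue_measure R).

(** Both sides are integrals against measures, and by uniqueness of Lebesgue
    measure it is enough that these agree on half-open intervals. *)
Lemma lebesgue_affine (a b : R) (f : measurableTypeR R -> \bar R) : 0 < a ->
  measurable_fun setT f -> (forall x, 0 <= f x)%E ->
  (\int[mu]_x f x = a%:E * \int[mu]_x f (b + a * x)%R)%E.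
Proof.
move=> a0 mf f0.
pose phi : measurableTypeR R -> measurableTypeR R := fun x => b + a * x.
have mphi : measurable_fun setT phi.
  by apply: measurable_funD => //; exact: measurable_funM.
pose phiM := isMeasurableFun.Build _ _ _ _ phi mphi.
pose phiF : {mfun measurableTypeR R >-> measurableTypeR R} := HB.pack phi phiM.
pose k := NngNum (ltW a0).
have mE A : measurable A -> mu A = mscale k (pushforward mu phiF) A.
  apply: lebesgue_measure_unique => _ [[x y]] _ <-.
  transitivity (a%:E * mu (phi @^-1` `]x, y]))%E; last by [].
  rewrite (_ : phi @^-1` _ = `](x - b) / a, (y - b) / a]%classic); last first.
    apply/seteqP; split => z /=; rewrite !in_itv/= /phi;
      by rewrite ltr_pdivrMr// ler_pdivlMr// ltrBlDl lerBrDl (mulrC z).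
  rewrite !lebesgue_measure_itv/= !lte_fin ltr_pM2r ?invr_gt0// ltrD2r.
  case: ifPn => _; last by rewrite mule0.
  rewrite -!EFinB -EFinM; congr EFin; field.
  by rewrite gt_eqF.
rewrite (eq_measure_integral (mscale k (pushforward mu phiF))); last first.
  by move=> A mA _; exact: mE.
by rewrite ge0_integral_mscale// ge0_integral_pushforward.
Qed.

End lebesgue1.

Section lebesgue_d.
Context {R : realType}.
Notation mu := (@lebesgue_measure R).

(** Inductions on the dimension peel off one coordinate at a time. *)
Lemma ge0_integral_leb_cons n (f : euclidean R n.+1 -> \bar R) :
  measurable_fun setT f -> (forall x, 0 <= f x)%E ->
  (\int[leb R n.+1]_x f x =
   \int[mu]_z \int[leb R n]_t f (tuple_cons (z, t)))%E.
Proof.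
move=> mf f0.
rewrite [LHS](_ : _ = \int[pushforward (mu \x leb R n) (@tuple_cons R n)]_x f x)%E//.
rewrite ge0_integral_pushforward//.
rewrite preimage_setT fubini_tonelli1//; last by move=> x; exact: f0.
exact: measurableT_comp mf (@measurable_tuple_cons R n).
Qed.

Lemma measurable_leb_slice n (f : euclidean R n.+1 -> \bar R) z :
  measurable_fun setT f ->
  measurable_fun setT (fun t : euclidean R n => f (tuple_cons (z, t))).
Proof.
move=> mf; apply: (measurableT_comp mf).
apply: (measurableT_comp (@measurable_tuple_cons R n)).
by apply: measurable_fun_pair.
Qed.

Lemma measurable_leb_inner n (f : euclidean R n.+1 -> \bar R) :
  measurable_fun setT f -> (forall x, 0 <= f x)%E ->
  measurable_fun setT (fun z : measurableTypeR R =>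
   \int[leb R n]_t f (tuple_cons (z, t)))%E.
Proof.
move=> mf f0.
apply: (@measurable_fun_fubini_tonelli_F _ _ _ _ _ (leb R n)
  (fun zt => f (tuple_cons zt))) => //.
exact: measurableT_comp mf (@measurable_tuple_cons R n).
Qed.

Lemma tnth_tuple_cons0 n z (t : euclidean R n) :
  tnth (tuple_cons (z, t)) ord0 = z.
Proof. by []. Qed.

Lemma tnth_tuple_consS n z (t : euclidean R n) i :
  tnth (tuple_cons (z, t)) (lift ord0 i) = tnth t i.
Proof. by rewrite /tuple_cons /= tnthS. Qed.

Lemma leb_affine d (a : R) (b : euclidean R d) (f : euclidean R d -> \bar R) :
  0 < a -> measurable_fun setT f -> (forall x, 0 <= f x)%E ->
  (\int[leb R d]_x f x =
   (a ^+ d)%:E * \int[leb R d]_x f (vadd b (vscale a x)))%E.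
Proof.
move=> a0; elim: d b f => [|n IH] b f mf f0.
  rewrite expr0 mul1e; apply: eq_integral => x _; congr f.
  by apply: vecP => -[].
rewrite ge0_integral_leb_cons// (@lebesgue_affine _ a (thead b))//; last 2 first.
- exact: measurable_leb_inner.
- by move=> z; exact: integral_ge0.
have mg : measurable_fun setT (fun x => f (vadd b (vscale a x))).
  apply: (measurableT_comp mf); apply: measurable_vadd => //.
  exact: measurable_vscale.
rewrite ge0_integral_leb_cons//.
rewrite exprS EFinM -muleA; congr (_ * _)%E.
rewrite -ge0_integralZl//; last 3 first.
- exact: (measurable_leb_inner mg).
- by move=> z _; exact: integral_ge0.
- by rewrite lee_fin exprn_ge0// ltW.
apply: eq_integral => z _.
rewrite (IH [tuple of behead b])//; last first.
  exact: measurable_leb_slice.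
congr (_ * _)%E; apply: eq_integral => t _; congr f.
apply: vecP => i; rewrite tnth_vadd tnth_vscale.
case: (unliftP ord0 i) => [j|] ->; last by rewrite !tnth_tuple_cons0.
rewrite !tnth_tuple_consS tnth_vadd tnth_vscale tnth_behead; congr (tnth b _ + _);
by apply: val_inj; rewrite /= inordK// ltnS.
Qed.

Lemma leb_translate d (b : euclidean R d) (f : euclidean R d -> \bar R) :
  measurable_fun setT f -> (forall x, 0 <= f x)%E ->
  (\int[leb R d]_x f x = \int[leb R d]_x f (vadd x b))%E.
Proof.
move=> mf f0; rewrite (@leb_affine _ 1 b)// expr1n mul1e.
apply: eq_integral => x _; congr f; apply: vecP => i.
by rewrite !tnth_vadd tnth_vscale mul1r addrC.
Qed.

Lemma leb_prod d (f : 'I_d -> measurableTypeR R -> R) :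
  (forall i, measurable_fun setT (f i)) -> (forall i x, 0 <= f i x) ->
  (\int[leb R d]_x (\prod_(i < d) f i (tnth x i))%:E =
   \prod_(i < d) \int[mu]_z (f i z)%:E)%E.
Proof.
elim: d f => [|n IH] f mf f0.
  rewrite big_ord0.
  under eq_integral do rewrite big_ord0.
  rewrite integral_cst// mul1e.
  by simpl; rewrite diracT.
have mprod m (g : 'I_m -> measurableTypeR R -> R) :
    (forall i, measurable_fun setT (g i)) ->
    measurable_fun setT (fun x : euclidean R m => (\prod_(i < m) g i (tnth x i))%:E).
  move=> mg; apply/measurable_EFinP; apply: measurable_prod => i _.
  by apply: measurableT_comp => //; exact: measurable_tnth.
rewrite ge0_integral_leb_cons; [|exact: mprod|]; last first.
  by move=> x; rewrite lee_fin prodr_ge0.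
rewrite big_ord_recl -IH//.
rewrite -ge0_integralZr//; last 3 first.
- exact/measurable_EFinP.
- by move=> x _; rewrite lee_fin.
- by apply: integral_ge0 => x _; rewrite lee_fin prodr_ge0.
apply: eq_integral => z _.
rewrite -ge0_integralZl//; last 3 first.
- exact: (mprod n (fun i => f (lift ord0 i))).
- by move=> x _; rewrite lee_fin prodr_ge0.
- by rewrite lee_fin.
apply: eq_integral => t _; rewrite big_ord_recl tnth_tuple_cons0 EFinM.
by congr (_ * _%:E)%E; apply: eq_bigr => i _; rewrite tnth_tuple_consS.
Qed.

End lebesgue_d.

(** * Exchanging dominated integrals *)

Section fubini.
Context {R : realType} {d1 d2} {T1 : measurableType d1} {T2 : measurableType d2}.
Variables (m1 : {sigma_finite_measure set T1 -> \bar R})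
          (m2 : {sigma_finite_measure set T2 -> \bar R}).

Lemma measurable_slice1 (f : T1 * T2 -> R) x : measurable_fun setT f ->
  measurable_fun setT (fun y => f (x, y)).
Proof.
by move=> mf; apply: (measurableT_comp mf); exact: measurable_fun_pair.
Qed.

Lemma measurable_slice2 (f : T1 * T2 -> R) y : measurable_fun setT f ->
  measurable_fun setT (fun x => f (x, y)).
Proof.
by move=> mf; apply: (measurableT_comp mf); exact: measurable_fun_pair.
Qed.

Section dominated.
Variables (f : T1 * T2 -> R) (g : T1 -> R) (h : T2 -> R).
Hypotheses (mf : measurable_fun setT f)
  (ig : m1.-integrable setT (EFin \o g)) (ih : m2.-integrable setT (EFin \o h))
  (fgh : forall x y, `|f (x, y)| <= g x * h y).

Lemma dom_slice1 x : m2.-integrable setT (EFin \o (fun y => f (x, y))).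
Proof.
apply: (le_integrable _ _ _ (integrableZl measurableT (g x) ih)) => //.
  by apply/measurable_EFinP; exact: measurable_slice1.
move=> y _ /=; rewrite lee_fin.
by rewrite (le_trans (fgh x y))// ler_norm.
Qed.

Lemma dom_slice2 y : m1.-integrable setT (EFin \o (fun x => f (x, y))).
Proof.
apply: (le_integrable _ _ _ (integrableZl measurableT (h y) ig)) => //.
  by apply/measurable_EFinP; exact: measurable_slice2.
move=> x _ /=; rewrite lee_fin.
by rewrite (le_trans (fgh x y))// mulrC ler_norm.
Qed.

(** A bound by a product of integrable functions of one variable each yields
    all the integrability that exchanging the integrals requires. *)
Lemma dom_integrable : (m1 \x m2)%E.-integrable setT (EFin \o f).
Proof.
apply/integrable12ltyP; first exact/measurable_EFinP.
have ihn := integrable_norm ih.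
have ign := integrable_norm ig.
have h1 (x : T1) : (\int[m2]_y `|(f (x, y))%:E| <=
    (`|g x| * \int[m2]_y `|h y|)%:E)%E.
  rewrite EFinM fineK; last exact: integrable_fin_num.
  rewrite -integralZl//.
  apply: ge0_le_integral => //.
  - apply: measurableT_comp => //; apply/measurable_EFinP.
    exact: measurable_slice1.
  - by apply: measurable_funeM; exact: measurable_int ihn.
  - move=> y _ /=; rewrite lee_fin -normrM.
    by rewrite (le_trans (fgh x y))// ler_norm.
apply: (@le_lt_trans _ _ (\int[m1]_x (`|g x| * \int[m2]_y `|h y|)%:E)%E).
  apply: ge0_le_integral => //.
  - by move=> x _; exact: integral_ge0.
  - apply: (@measurable_fun_fubini_tonelli_F _ _ _ _ _ m2
      (fun xy => `|(f xy)%:E|)%E) => //.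
    by apply: measurableT_comp => //; exact/measurable_EFinP.
  - apply/measurable_EFinP; apply: measurable_funM => //.
    by apply/measurable_EFinP; exact: measurable_int ign.
  - by move=> x _; exact: h1.
under eq_integral do rewrite EFinM.
by rewrite integralZr// ltey_eq fin_numM// integrable_fin_num.
Qed.

Lemma integrable_Rinner1 :
  m1.-integrable setT (EFin \o (fun x => \int[m2]_y f (x, y))).
Proof.
have := integrable_fubini_F dom_integrable.
apply: eq_integrable => // x _ /=.
by rewrite /fubini_F /= fineK// integrable_fin_num// dom_slice1.
Qed.

Lemma Rintegral_prod1 :
  \int[(m1 \x m2)%E]_z f z = \int[m1]_x \int[m2]_y f (x, y).
Proof.
rewrite /Rintegral -integral12_prod_meas1 ?dom_integrable//=; congr fine.
apply: eq_integral => x _.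
by rewrite /fubini_F /= fineK// integrable_fin_num// dom_slice1.
Qed.

Lemma Rintegral_Fubini :
  \int[m1]_x \int[m2]_y f (x, y) = \int[m2]_y \int[m1]_x f (x, y).
Proof.
rewrite -Rintegral_prod1 /Rintegral -integral21_prod_meas1 ?dom_integrable//=.
congr fine; apply: eq_integral => y _.
by rewrite /fubini_G /= fineK// integrable_fin_num// dom_slice2.
Qed.

End dominated.
End fubini.

Section fubini2.
Context {R : realType} {d1 d2} {T1 : measurableType d1} {T2 : measurableType d2}.
Variables (m1 : {sigma_finite_measure set T1 -> \bar R})
          (m2 : {sigma_finite_measure set T2 -> \bar R}).

Lemma integrable_Rinner2 (f : T1 * T2 -> R) (g : T1 -> R) (h : T2 -> R) :
  measurable_fun setT f ->
  m1.-integrable setT (EFin \o g) -> m2.-integrable setT (EFin \o h) ->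
  (forall x y, `|f (x, y)| <= g x * h y) ->
  m2.-integrable setT (EFin \o (fun y => \int[m1]_x f (x, y))).
Proof.
move=> mf ig ih fgh.
apply: (@integrable_Rinner1 _ _ _ _ _ m2 m1 (fun yx => f (yx.2, yx.1)) h g) => //.
  by apply: (measurableT_comp mf); exact: measurable_fun_pair.
by move=> y x /=; rewrite mulrC.
Qed.

End fubini2.

(** * The Laplace kernel and its Fourier transform *)

Section laplace1.
Context {R : realType}.
Notation mu := (@lebesgue_measure R).
Implicit Types e u th z : R.

Lemma continuous_expR_lin e : continuous (fun z : R => expR (- (e * z))).
Proof.
move=> z; apply: (@continuous_comp _ _ _ (fun z : R => - (e * z)) expR).
  by apply: cvgN; apply: cvgMl_tmp; exact: cvg_id.
exact: continuous_expR.
Qed.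

Lemma cvg_expR_lin e : 0 < e -> expR (- (e * z)) @[z --> +oo] --> (0 : R).
Proof.
move=> e0; apply: (cvg_comp (fun z => e * z) (fun x => expR (- x))).
  by apply: gt0_cvgMry => //; exact: cvg_id.
exact: cvgr_expR.
Qed.

Lemma continuous_cos_lin u th : continuous (fun z : R => cos (z * u + th)).
Proof.
move=> z; apply: (@continuous_comp _ _ _ (fun z : R => z * u + th) cos).
  by apply: cvgD; [apply: cvgMr_tmp; exact: cvg_id|exact: cvg_cst].
exact: continuous_cos.
Qed.

(** A primitive of expR (- (e * z)) * (1 + c * cos (z * u)): the oscillating
    part is the real part of c * expR (- (e - i u) z) / (i u - e). *)
Let lapF e u c z : R :=
  expR (- (e * z)) * (c * (u * sin (z * u) - e * cos (z * u)) / (e ^+ 2 + u ^+ 2) - e^-1).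

Let is_derive_lapF e u c z : 0 < e ->
  is_derive z 1 (lapF e u c) (expR (- (e * z)) * (1 + c * cos (z * u))).
Proof.
move=> e0.
have D1 : is_derive z 1 (fun z => expR (- (e * z))) (- e * expR (- (e * z))).
  have h : is_derive z 1 (fun z => - (e * z)) (- e).
    have h0 : is_derive z 1 (e \*: (@id R)) (e *: (1 : R)).
      by apply: is_deriveZ.
    have h1 := is_deriveN h0.
    by apply: (is_derive_eq h1); rewrite /GRing.scale/= mulr1.
  by rewrite mulrC; exact: is_derive1_comp.
have L : is_derive z 1 (fun z => z * u) u.
  have : is_derive z 1 (u \*: (@id R)) (u *: (1 : R)) by apply: is_deriveZ.
  rewrite (_ : u \*: id = fun z => z * u); last first.
    by apply/funext => x /=; rewrite mulrC.
  by move=> h; apply: (is_derive_eq h); rewrite /GRing.scale/= mulr1.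
have Ds : is_derive z 1 (fun z => sin (z * u)) (u * cos (z * u)).
  by rewrite mulrC; exact: is_derive1_comp.
have Dc : is_derive z 1 (fun z => cos (z * u)) (u * - sin (z * u)).
  by rewrite mulrC; exact: is_derive1_comp.
have e2 : e ^+ 2 + u ^+ 2 != 0.
  by rewrite gt_eqF// ltr_wpDr ?sqr_ge0// exprn_gt0.
pose k := c / (e ^+ 2 + u ^+ 2).
have D2 : is_derive z 1 ((k * u) \*: (fun z => sin (z * u)) -
    (k * e) \*: (fun z => cos (z * u)) - cst e^-1)
    ((k * u) * (u * cos (z * u)) - (k * e) * (u * - sin (z * u)) - 0).
  by apply: is_deriveB; apply: is_deriveB.
have := is_deriveM D1 D2.
rewrite (_ : (_ : R -> R) * _ = lapF e u c); last first.
  apply/funext => x; rewrite /lapF /=; congr (_ * _).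
  by rewrite !fctE /= /k /GRing.scale /=; field; rewrite e2 gt_eqF.
move=> h; apply: (is_derive_eq h); rewrite /GRing.scale /= !fctE /= /GRing.scale /= /k.
by field; rewrite e2 gt_eqF.
Qed.

Let cvg_lapF e u c : 0 < e -> `|c| <= 1 -> lapF e u c z @[z --> +oo] --> (0 : R).
Proof.
move=> e0 c1; pose K := (`|u| + e) / (e ^+ 2 + u ^+ 2) + e^-1.
have e2 : 0 < e ^+ 2 + u ^+ 2 by rewrite ltr_wpDr ?sqr_ge0// exprn_gt0.
have h0 : (fun z => expR (- (e * z)) * K) @ +oo --> (0 : R).
  by rewrite -(mul0r K); apply: cvgMr_tmp; exact: cvg_expR_lin.
have h1 : (fun z => - (expR (- (e * z)) * K)) @ +oo --> (0 : R).
  by rewrite -oppr0; exact: cvgN.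
apply: (squeeze_cvgr _ h1 h0).
apply: nearW => z; rewrite -ler_norml /lapF normrM gtr0_norm ?expR_gt0//.
rewrite ler_wpM2l ?expR_ge0// (le_trans (ler_normB _ _))// /K.
rewrite (gtr0_norm (_ : 0 < e^-1)) ?invr_gt0// lerD2r.
rewrite !normrM (gtr0_norm (_ : 0 < (e ^+ 2 + u ^+ 2)^-1)) ?invr_gt0//.
rewrite ler_wpM2r ?invr_ge0 ?(ltW e2)//.
rewrite -[leRHS]mul1r ler_pM// (le_trans (ler_normB _ _))// !normrM lerD//.
  by rewrite ler_piMr// ler_norml sin_geN1 sin_le1.
by rewrite gtr0_norm// ler_piMr ?(ltW e0)// ler_norml cos_geN1 cos_le1.
Qed.

Let continuous_lapf e u c :
  continuous (fun z : R => expR (- (e * z)) * (1 + c * cos (z * u))).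
Proof.
move=> z; apply: cvgM; first exact: continuous_expR_lin.
apply: cvgD; first exact: cvg_cst.
apply: cvgMl_tmp; have := @continuous_cos_lin u 0 z.
rewrite /continuous_at addr0.
by rewrite (_ : (fun z => _) = (fun z => cos (z * u)))//;
  apply/funext => x; rewrite addr0.
Qed.

(** The cosine is shifted by 1 so that the integrand is nonnegative, as the
    fundamental theorem of calculus on a half-line requires. *)
Lemma integral0y_laplace e u c : 0 < e -> `|c| <= 1 ->
  (\int[mu]_(z in `[0%R, +oo[) (expR (- (e * z)) * (1 + c * cos (z * u)))%:E =
   (e^-1 + c * (e / (e ^+ 2 + u ^+ 2)))%:E)%E.
Proof.
move=> e0 c1; rewrite (@ge0_continuous_FTC2y _ _ (lapF e u c) _ 0).
- rewrite /lapF !mul0r sin0 cos0 mulr0 oppr0 expR0 mul1r -EFinB.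
  by congr EFin; rewrite !mulr0; ring.
- move=> z z0; rewrite mulr_ge0 ?expR_ge0// -lerBlDl sub0r.
  have : `|c * cos (z * u)| <= 1.
    by rewrite normrM mulr_ile1// ler_norml cos_geN1 cos_le1.
  by rewrite ler_norml => /andP[].
- by apply: continuous_subspaceT; exact: continuous_lapf.
- exact: cvg_lapF.
- by move=> z z0; have [] := is_derive_lapF u c z e0.
- apply: cvg_at_right_filter.
  have [/derivable1_diffP/differentiable_continuous + _] := is_derive_lapF u c 0 e0.
  by [].
- move=> z _; rewrite derive1E.
  by have h := is_derive_lapF u c z e0; rewrite derive_val.
Qed.

Definition expabs e z := expR (- (e * `|z|)).

Lemma expabs_ge0 e z : 0 <= expabs e z. Proof. exact: expR_ge0. Qed.

Lemma expabs_le1 e z : 0 <= e -> expabs e z <= 1.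
Proof. by move=> e0; rewrite -expR0 ler_expR oppr_le0 mulr_ge0. Qed.

Lemma continuous_expabs e : continuous (expabs e).
Proof.
move=> z; apply: (@continuous_comp _ _ _ (fun z : R => `|z|)
  (fun z => expR (- (e * z)))); first exact: norm_continuous.
exact: continuous_expR_lin.
Qed.

Lemma measurable_expabs e : measurable_fun setT (expabs e).
Proof. by apply: continuous_measurable_fun; exact: continuous_expabs. Qed.

(** Folding the line at 0 cancels the part of cos (z * u + th) that is odd in
    z, so that the phase only leaves the factor cos th. *)
Lemma integral_laplace1 e u th : 0 < e ->
  (\int[mu]_z (expabs e z * (1 + cos (z * u + th)))%:E =
   (2 / e + cos th * (2 * e / (e ^+ 2 + u ^+ 2)))%:E)%E.
Proof.
move=> e0; set G := fun z => expabs e z * (1 + cos (z * u + th)).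
have G0 z : 0 <= G z.
  by rewrite mulr_ge0 ?expabs_ge0// -lerBlDl sub0r cos_geN1.
have cG : continuous G.
  move=> z; apply: cvgM; first exact: continuous_expabs.
  by apply: cvgD; [exact: cvg_cst|exact: continuous_cos_lin].
have mG : measurable_fun setT G by exact: continuous_measurable_fun.
have mGN : measurable_fun setT (fun z => G (- z)) by exact: measurableT_comp.
have GN : (\int[mu]_z (G (- z))%:E = \int[mu]_z (G z)%:E)%E.
  rewrite [RHS](eq_measure_integral
    (pushforward mu (-%R : measurableTypeR R -> measurableTypeR R))); last first.
    by move=> A mA _; exact/esym/lebesgue_measureN.
  rewrite ge0_integral_pushforward//; first exact/measurable_EFinP.
  by move=> z _; rewrite lee_fin.
pose H z := G z + G (- z).
have HE z : 0 <= z -> H z = 2 * (expR (- (e * z)) * (1 + cos th * cos (z * u))).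
  move=> z0; rewrite /H /G /expabs normrN ger0_norm// !cosD.
  by rewrite mulNr cosN sinN; ring.
have I1 : (\int[mu]_z (H z)%:E = 2%:E * \int[mu]_z (G z)%:E)%E.
  under eq_integral do rewrite EFinD.
  rewrite ge0_integralD//; [|by move=> z _; rewrite lee_fin|exact/measurable_EFinP|
    by move=> z _; rewrite lee_fin|exact/measurable_EFinP].
  by rewrite GN -mule2n mule_natl.
have I2 : (\int[mu]_z (H z)%:E =
    2%:E * (2 * (e^-1 + cos th * (e / (e ^+ 2 + u ^+ 2))))%:E)%E.
  rewrite ge0_symfun_integralT; last 3 first.
  - by move=> z; rewrite addr_ge0.
  - move=> z; apply: cvgD; first exact: cG.
    apply: (@continuous_comp _ _ _ (-%R) G); last exact: cG.
    exact: opp_continuous.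
  - by move=> z /=; rewrite /H opprK addrC.
  congr (_ * _)%E; rewrite EFinM -integral0y_laplace//; last first.
    by rewrite ler_norml cos_geN1 cos_le1.
  rewrite -ge0_integralZl; [|by []| | |by []]; last 2 first.
  - apply/measurable_EFinP; apply: measurable_funTS.
    by apply: continuous_measurable_fun; exact: continuous_lapf.
  - move=> z; rewrite /= in_itv/= andbT => z0; rewrite lee_fin.
    have := HE z z0; have : 0 <= H z by rewrite addr_ge0.
    by move=> /[swap] ->; rewrite pmulr_rge0.
  rewrite -set_itvcy; apply: eq_integral => z; rewrite inE/= in_itv/= andbT => z0.
  by rewrite HE.
move: I1; rewrite I2 => /esym; have : (0 <= \int[mu]_z (G z)%:E)%E.
  by apply: integral_ge0 => z _; rewrite lee_fin.
case: (\int[mu]_z (G z)%:E)%E => [r| |]//= _.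
  move=> /(congr1 fine)/= /mulfI -> //.
  have e2 : e ^+ 2 + u ^+ 2 != 0 by rewrite gt_eqF// ltr_wpDr ?sqr_ge0// exprn_gt0.
  by congr EFin; field; rewrite e2 gt_eqF.
by rewrite mulry gtr0_sg// mul1e.
Qed.

Lemma integral_expabs e : 0 < e ->
  (\int[mu]_z (expabs e z)%:E = (2 / e)%:E)%E.
Proof.
move=> e0; have := integral_laplace1 0 (pi / 2) e0.
rewrite cos_pihalf mul0r addr0 => <-; apply: eq_integral => z _.
by rewrite mulr0 add0r cos_pihalf addr0 mulr1.
Qed.

Lemma integrable_expabs e : 0 < e ->
  mu.-integrable setT (EFin \o expabs e).
Proof.
move=> e0; apply/integrableP; split.
  by apply/measurable_EFinP; exact: measurable_expabs.
under eq_integral do rewrite /= ger0_norm ?expabs_ge0//.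
by rewrite integral_expabs// ltry.
Qed.

(** The phase th is there for the induction on the dimension in
    Rintegral_lapk, where it stands for the contribution of the other
    coordinates. *)
Lemma Rintegral_laplace e u th : 0 < e ->
  \int[mu]_z (expabs e z * cos (z * u + th)) =
  cos th * (2 * e / (e ^+ 2 + u ^+ 2)).
Proof.
move=> e0; have mc : measurable_fun setT (fun z : R => cos (z * u + th)).
  by apply: continuous_measurable_fun; exact: continuous_cos_lin.
have ie := integrable_expabs e0.
have ic : mu.-integrable setT (EFin \o (fun z => expabs e z * cos (z * u + th))).
  apply: (le_integrable _ _ _ ie) => //.
    by apply/measurable_EFinP; apply: measurable_funM => //; exact: measurable_expabs.
  move=> z _ /=; rewrite lee_fin normrM ler_piMr// ler_norml.
  by rewrite cos_geN1 cos_le1.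
apply: (@addrI _ (\int[mu]_z expabs e z)).
rewrite -RintegralD//.
have := integral_laplace1 u th e0.
under eq_integral do rewrite mulrDr mulr1.
by move/(congr1 fine); rewrite /Rintegral integral_expabs.
Qed.

End laplace1.

Section cauchy1.
Context {R : realType}.
Notation mu := (@lebesgue_measure R).

Lemma integral_cauchy1 (e : R) : 0 < e ->
  (\int[mu]_u (e / (pi * (e ^+ 2 + u ^+ 2)))%:E = 1)%E.
Proof.
move=> e0.
have oneD (x : R) : 0 < 1 + x ^+ 2 by rewrite ltr_wpDr ?sqr_ge0.
have c1 : continuous (fun x : R => (1 + x ^+ 2)^-1).
  by move=> x; exact: continuous_oneDsqrV.
have I1 : (\int[mu]_v ((1 + v ^+ 2)^-1)%:E = pi%:E)%E.
  rewrite ge0_symfun_integralT//.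
  - rewrite -set_itvcy; have := @integral0y_oneDsqr R.
    by rewrite /oneDsqr => ->; rewrite -EFinM; congr EFin; field.
  - by move=> x; rewrite invr_ge0 ltW.
  - by move=> x /=; rewrite sqrrN.
rewrite (@lebesgue_affine _ e 0)//; last 2 first.
- apply/measurable_EFinP; apply: continuous_measurable_fun => x.
  apply: cvgM; first exact: cvg_cst.
  apply: cvgV; first by rewrite gt_eqF// mulr_gt0 ?pi_gt0// ltr_wpDr ?sqr_ge0 ?exprn_gt0.
  apply: cvgMl_tmp; apply: cvgD; first exact: cvg_cst.
  exact: exprn_continuous.
- by move=> x; rewrite lee_fin divr_ge0 ?(ltW e0)// mulr_ge0 ?pi_ge0// addr_ge0 ?sqr_ge0.
rewrite (eq_integral (fun v : measurableTypeR R => ((e * pi)^-1)%:E * ((1 + v ^+ 2)^-1)%:E)%E); last first.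
  move=> v _; rewrite -EFinM add0r; congr EFin.
  have := @pi_gt0 R; move: (@pi R) => p p0; field.
  rewrite (gt_eqF p0) (gt_eqF e0) (gt_eqF (oneD v)) gt_eqF//.
  by rewrite exprMn -{1}[e ^+ 2]mulr1 -mulrDr mulr_gt0 ?exprn_gt0.
rewrite ge0_integralZl//; last 3 first.
- by apply/measurable_EFinP; exact: continuous_measurable_fun.
- by move=> x _; rewrite lee_fin invr_ge0 ltW.
- by rewrite lee_fin invr_ge0 mulr_ge0 ?pi_ge0 ?ltW.
rewrite I1 -!EFinM; congr EFin; have := @pi_gt0 R; move: (@pi R) => p p0.
by field; rewrite !gt_eqF.
Qed.

End cauchy1.

Section kernels.
Context {R : realType}.
Notation mu := (@lebesgue_measure R).

Definition lapk d (e : R) (s : euclidean R d) := \prod_(i < d) expabs e (tnth s i).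
(** The Fourier transform of lapk divided by (2 pi)^d, see Rintegral_lapk; a
    probability density which concentrates at 0 as e tends to 0. *)
Definition cauchyk d (e : R) (u : euclidean R d) :=
  \prod_(i < d) (e / (pi * (e ^+ 2 + tnth u i ^+ 2))).

Lemma lapk_ge0 d e (s : euclidean R d) : 0 <= lapk e s.
Proof. by apply: prodr_ge0 => i _; exact: expabs_ge0. Qed.

Lemma lapk_le1 d e (s : euclidean R d) : 0 <= e -> lapk e s <= 1.
Proof. by move=> e0; apply: prodr_ile1 => i _; rewrite expabs_ge0 expabs_le1. Qed.

Lemma measurable_lapk d e : measurable_fun setT (@lapk d e).
Proof.
apply: measurable_prod => i _.
by apply: (measurableT_comp (measurable_expabs e)); exact: measurable_tnth.
Qed.

Lemma integral_lapk d e : 0 < e ->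
  (\int[leb R d]_s (lapk e s)%:E = ((2 / e) ^+ d)%:E)%E.
Proof.
move=> e0; rewrite (@leb_prod R d (fun _ => expabs e)); last 2 first.
- by move=> i; exact: measurable_expabs.
- by move=> i x; exact: expabs_ge0.
rewrite (eq_bigr (fun=> (2 / e)%:E)); last by move=> i _; rewrite integral_expabs.
by rewrite prodEFin prodr_const card_ord.
Qed.

Lemma integrable_lapk d e : 0 < e -> (leb R d).-integrable setT (EFin \o lapk e).
Proof.
move=> e0; apply/integrableP; split.
  by apply/measurable_EFinP; exact: measurable_lapk.
under eq_integral do rewrite /= ger0_norm ?lapk_ge0//.
by rewrite integral_lapk// ltry.
Qed.

Lemma cauchyk_ge0 d e (u : euclidean R d) : 0 <= e -> 0 <= cauchyk e u.
Proof.
move=> e0; apply: prodr_ge0 => i _.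
by rewrite divr_ge0// mulr_ge0 ?pi_ge0// addr_ge0 ?sqr_ge0.
Qed.

Let measurable_cauchy1 (e : R) : measurable_fun setT
  (fun x : measurableTypeR R => e / (pi * (e ^+ 2 + x ^+ 2))).
Proof.
have [->|e0] := eqVneq e 0.
  by rewrite (_ : (fun _ => _) = cst 0)//; apply/funext => x; rewrite mul0r.
apply: continuous_measurable_fun => x.
apply: cvgM; first exact: cvg_cst.
apply: cvgV.
  by rewrite gt_eqF// mulr_gt0 ?pi_gt0// ltr_wpDr ?sqr_ge0// exprn_even_gt0.
apply: cvgMl_tmp; apply: cvgD; first exact: cvg_cst.
exact: exprn_continuous.
Qed.

Lemma measurable_cauchyk d e : measurable_fun setT (@cauchyk d e).
Proof.
apply: measurable_prod => i _.
apply: (measurableT_comp (measurable_cauchy1 e)); exact: measurable_tnth.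
Qed.

Lemma integral_cauchyk d e : 0 < e ->
  (\int[leb R d]_u (cauchyk e u)%:E = 1)%E.
Proof.
move=> e0; rewrite (@leb_prod R d (fun _ x => e / (pi * (e ^+ 2 + x ^+ 2)))); last 2 first.
- by move=> i; exact: measurable_cauchy1.
- by move=> i x; rewrite divr_ge0 ?(ltW e0)// mulr_ge0 ?pi_ge0// addr_ge0 ?sqr_ge0.
by rewrite big1// => i _; exact: integral_cauchy1.
Qed.

Lemma cauchykE d e (u : euclidean R d) : 0 < e ->
  cauchyk e (vscale e u) = e ^- d * cauchyk 1 u.
Proof.
move=> e0; rewrite -exprVn -[d in X in X * _]card_ord -prodr_const -big_split/=.
apply: eq_bigr => i _; rewrite tnth_vscale.
have := @pi_gt0 R; move: (@pi R) => p p0; field.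
have x0 : 0 < 1 + tnth u i ^+ 2 by rewrite ltr_wpDr ?sqr_ge0.
rewrite (gt_eqF p0) (gt_eqF e0) (gt_eqF x0) gt_eqF//.
by rewrite exprMn -{1}[e ^+ 2]mulr1 -mulrDr mulr_gt0 ?exprn_gt0// ltr_wpDr ?sqr_ge0.
Qed.

Lemma cauchykN d e (u v : euclidean R d) :
  cauchyk e (vsub u v) = cauchyk e (vsub v u).
Proof.
by apply: eq_bigr => i _; rewrite !tnth_vsub -[in RHS]opprB sqrrN.
Qed.

Lemma Rintegral_leb_cons n (f : euclidean R n.+1 -> R) (g : R -> R)
    (h : euclidean R n -> R) :
  measurable_fun setT f -> mu.-integrable setT (EFin \o g) ->
  (leb R n).-integrable setT (EFin \o h) ->
  (forall z t, `|f (tuple_cons (z, t))| <= g z * h t) ->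
  \int[leb R n.+1]_x f x = \int[mu]_z \int[leb R n]_t f (tuple_cons (z, t)).
Proof.
move=> mf ig ih fgh.
have mfc : measurable_fun setT (f \o @tuple_cons R n).
  exact: measurableT_comp mf (@measurable_tuple_cons R n).
rewrite -(@Rintegral_prod1 _ _ _ _ _ mu (leb R n) _ g h mfc ig ih) => [|x y]; last exact: fgh.
have hp := @integral_pushforward _ _ _ _ R (@tuple_cons R n)
   (@measurable_tuple_cons R n) (mu \x leb R n)%E setT (EFin \o f).
rewrite /Rintegral; congr fine.
rewrite [LHS](_ : _ = \int[pushforward (mu \x leb R n) (@tuple_cons R n)]_x (EFin \o f) x)%E//.
rewrite hp//; first exact/measurable_EFinP.
exact: (dom_integrable mfc ig ih).
Qed.

Lemma measurable_cos_dotp d (u : euclidean R d) th :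
  measurable_fun setT (fun s : euclidean R d => cos (dotp s u + th)).
Proof.
apply: (@measurableT_comp _ _ _ _ _ _ (@cos R)).
  by apply: continuous_measurable_fun; exact: continuous_cos.
by apply: measurable_funD => //; exact: measurable_dotp.
Qed.

Lemma Rintegral_lapk d e (u : euclidean R d) th : 0 < e ->
  \int[leb R d]_s (lapk e s * cos (dotp s u + th)) =
  cos th * ((2 * pi) ^+ d * cauchyk e u).
Proof.
move=> e0; elim: d u th => [|n IH] u th.
  rewrite /lapk /dotp /cauchyk big_ord0 expr0 !mulr1.
  under eq_Rintegral do rewrite !big_ord0 add0r mul1r.
  have h : leb R 0 setT = 1%E by simpl; rewrite diracT.
  by rewrite Rintegral_cst// -[RHS]mulr1; congr (_ * _); exact: (congr1 fine h).
have mf : measurable_fun setT (fun s : euclidean R n.+1 => lapk e s * cos (dotp s u + th)).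
  by apply: measurable_funM; [exact: measurable_lapk|exact: measurable_cos_dotp].
rewrite (@Rintegral_leb_cons n _ (expabs e) (lapk e))//; last 3 first.
- exact: integrable_expabs.
- exact: integrable_lapk.
- move=> z t; rewrite normrM ger0_norm ?lapk_ge0//.
  rewrite (@le_trans _ _ (lapk e (tuple_cons (z, t))))//.
    by rewrite ler_piMr ?lapk_ge0// ler_norml cos_geN1 cos_le1.
  rewrite {1}/lapk big_ord_recl tnth_tuple_cons0 ler_wpM2l ?expabs_ge0// /lapk.
  apply: eq_imp_le.
  by apply: eq_bigr => i _; rewrite tnth_tuple_consS.
pose u' : euclidean R n := [tuple of behead u].
have inner z : \int[leb R n]_t (lapk e (tuple_cons (z, t)) *
      cos (dotp (tuple_cons (z, t)) u + th)) =
    expabs e z * cos (z * thead u + th) * ((2 * pi) ^+ n * cauchyk e u').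
  rewrite -mulrA -IH -RintegralZl//; last first.
    apply: (le_integrable _ _ _ (integrable_lapk n e0)) => //.
      apply/measurable_EFinP; apply: measurable_funM; [exact: measurable_lapk|].
      exact: measurable_cos_dotp.
    move=> t _ /=; rewrite lee_fin normrM ler_piMr// ler_norml.
    by rewrite cos_geN1 cos_le1.
  apply: eq_Rintegral => t _; rewrite mulrA; congr (_ * cos _).
    rewrite /lapk big_ord_recl tnth_tuple_cons0; congr (_ * _).
    by apply: eq_bigr => i _; rewrite tnth_tuple_consS.
  rewrite /dotp big_ord_recl tnth_tuple_cons0 addrA; congr (_ + _).
  rewrite addrC; congr (_ + _); apply: eq_bigr => i _.
  rewrite tnth_tuple_consS tnth_behead; congr (_ * tnth u _).
  by apply: val_inj; rewrite /= inordK// ltnS.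
under eq_Rintegral do rewrite inner.
rewrite RintegralZr//; last first.
  apply: (le_integrable _ _ _ (integrable_expabs e0)) => //.
    apply/measurable_EFinP; apply: measurable_funM; first exact: measurable_expabs.
    by apply: continuous_measurable_fun; exact: continuous_cos_lin.
  move=> z _ /=; rewrite lee_fin normrM ler_piMr// ler_norml.
  by rewrite cos_geN1 cos_le1.
rewrite Rintegral_laplace//.
have -> : cauchyk e u = e / (pi * (e ^+ 2 + thead u ^+ 2)) * cauchyk e u'.
  rewrite /cauchyk big_ord_recl; congr (_ * _); apply: eq_bigr => i _.
  rewrite tnth_behead; congr (_ / (_ * (_ + tnth u _ ^+ _))).
  by apply: val_inj; rewrite /= inordK// ltnS.
have e2 : e ^+ 2 + thead u ^+ 2 != 0.
  by rewrite gt_eqF// ltr_wpDr ?sqr_ge0// exprn_gt0.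
rewrite [in RHS]exprS; have := @pi_gt0 R; move: (@pi R) => p p0.
by field; rewrite e2 gt_eqF.
Qed.

End kernels.

(** * Modulus of the Fourier transform, and inversion *)

Section weighted_fourier.
Context {R : realType} {d : nat}.
Notation E := (euclidean R d).

Section def.
Variables (nu : {sigma_finite_measure set E -> \bar R}) (f : E -> R).

(** Real part, imaginary part and modulus of the Fourier transform of the
    measure with density f with respect to nu. Only the modulus matters in the
    end, and the two real integrals make complex-valued integration
    unnecessary. *)
Definition fcos (s : E) := \int[nu]_x (f x * cos (dotp s x)).
Definition fsin (s : E) := \int[nu]_x (f x * sin (dotp s x)).
Definition famp (s : E) := Num.sqrt (fcos s ^+ 2 + fsin s ^+ 2).

Lemma famp_ge0 s : 0 <= famp s. Proof. exact: sqrtr_ge0. Qed.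

Lemma famp_sqr s : famp s ^+ 2 = fcos s ^+ 2 + fsin s ^+ 2.
Proof. by rewrite sqr_sqrtr// addr_ge0 ?sqr_ge0. Qed.

Hypotheses (f0 : forall x, 0 <= f x) (intf : nu.-integrable setT (EFin \o f)).

Let mf : measurable_fun setT f.
Proof. by apply/measurable_EFinP; exact: measurable_int intf. Qed.

Lemma measurable_cos_comp d1 (U : measurableType d1) (g : U -> R) :
  measurable_fun setT g -> measurable_fun setT (fun u => cos (g u)).
Proof.
apply: (@measurableT_comp _ _ _ _ _ _ (@cos R)).
by apply: continuous_measurable_fun; exact: continuous_cos.
Qed.

Lemma measurable_sin_comp d1 (U : measurableType d1) (g : U -> R) :
  measurable_fun setT g -> measurable_fun setT (fun u => sin (g u)).
Proof.
apply: (@measurableT_comp _ _ _ _ _ _ (@sin R)).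
by apply: continuous_measurable_fun; exact: continuous_sin.
Qed.

Lemma norm_mul_cos (a b : R) : 0 <= a -> `|a * cos b| <= a.
Proof.
by move=> a0; rewrite normrM ger0_norm// ler_piMr// ler_norml cos_geN1 cos_le1.
Qed.

Lemma norm_mul_sin (a b : R) : 0 <= a -> `|a * sin b| <= a.
Proof.
by move=> a0; rewrite normrM ger0_norm// ler_piMr// ler_norml sin_geN1 sin_le1.
Qed.

Lemma integrable_dom (g : E -> R) : measurable_fun setT g ->
  (forall x, `|g x| <= f x) -> nu.-integrable setT (EFin \o g).
Proof.
move=> mg gf; apply: (le_integrable _ _ _ intf) => //; first exact/measurable_EFinP.
by move=> x _ /=; rewrite lee_fin (le_trans (gf x))// ler_norm.
Qed.

Lemma integrable_fcos s : nu.-integrable setT (EFin \o (fun x => f x * cos (dotp s x))).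
Proof.
apply: integrable_dom => [|x]; last exact: norm_mul_cos.
by apply: measurable_funM => //; apply: measurable_cos_comp; exact: measurable_dotp.
Qed.

Lemma integrable_fsin s : nu.-integrable setT (EFin \o (fun x => f x * sin (dotp s x))).
Proof.
apply: integrable_dom => [|x]; last exact: norm_mul_sin.
by apply: measurable_funM => //; apply: measurable_sin_comp; exact: measurable_dotp.
Qed.

Lemma Rintegral_cosB s (a : R) :
  \int[nu]_x (f x * cos (a - dotp s x)) = cos a * fcos s + sin a * fsin s.
Proof.
rewrite /fcos /fsin -!RintegralZl//; [|exact: integrable_fsin|exact: integrable_fcos].
rewrite -RintegralD//.
- by apply: eq_Rintegral => x _; rewrite cosB; ring.
- exact: (integrableZl measurableT (cos a) (integrable_fcos s)).
- exact: (integrableZl measurableT (sin a) (integrable_fsin s)).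
Qed.

(** Cauchy--Schwarz against the unit vector (cos a, sin a). *)
Lemma amp_bound (a c s : R) : cos a * c + sin a * s <= Num.sqrt (c ^+ 2 + s ^+ 2).
Proof.
apply: le_trans (ler_norm _) _; rewrite -sqrtr_sqr ler_wsqrtr//.
rewrite -subr_ge0 (_ : _ - _ = (sin a * c - cos a * s) ^+ 2) ?sqr_ge0//.
transitivity ((cos a ^+ 2 + sin a ^+ 2) * (c ^+ 2 + s ^+ 2) - (cos a * c + sin a * s) ^+ 2).
  by rewrite cos2Dsin2 mul1r.
by ring.
Qed.

Lemma amp_bound_norm (a c s : R) :
  `|cos a * c + sin a * s| <= Num.sqrt (c ^+ 2 + s ^+ 2).
Proof.
rewrite ler_norml amp_bound andbT lerNl opprD -!mulrN.
by rewrite (le_trans (amp_bound _ _ _))// !sqrrN.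
Qed.

(** The square of famp s is the integral of f against a combination of cosine
    and sine which amp_bound controls by famp s; divide by famp s. *)
Lemma famp_le s : famp s <= \int[nu]_x f x.
Proof.
have [F0|F0] := eqVneq (famp s) 0; first by rewrite F0 Rintegral_ge0.
have Fgt0 : 0 < famp s by rewrite lt_neqAle eq_sym F0 famp_ge0.
rewrite -(ler_pM2l Fgt0) -expr2 famp_sqr !expr2 /fcos /fsin -/(fcos s) -/(fsin s).
rewrite -!RintegralZl//; [|exact: integrable_fsin|exact: integrable_fcos].
rewrite -RintegralD//; last 2 first.
- exact: (integrableZl measurableT (fcos s) (integrable_fcos s)).
- exact: (integrableZl measurableT (fsin s) (integrable_fsin s)).
apply: le_Rintegral => //.
- apply: (le_integrable _ _ _ (integrableZl measurableT (famp s) intf)) => //.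
    apply/measurable_EFinP; apply: measurable_funD; apply: measurable_funM => //;
      apply: measurable_funM => //; [apply: measurable_cos_comp|apply: measurable_sin_comp]; exact: measurable_dotp.
  move=> x _ /=; rewrite lee_fin.
  rewrite [X in _ <= X]ger0_norm ?mulr_ge0 ?famp_ge0//.
  rewrite (_ : _ + _ = f x * (cos (dotp s x) * fcos s + sin (dotp s x) * fsin s)); last by ring.
  rewrite normrM ger0_norm// mulrC ler_wpM2r//.
  exact: amp_bound_norm.
- exact: (integrableZl measurableT (famp s) intf).
- move=> x _.
  rewrite (_ : _ + _ = f x * (cos (dotp s x) * fcos s + sin (dotp s x) * fsin s)); last by ring.
  by rewrite mulrC ler_wpM2r// amp_bound.
Qed.

Lemma measurable_lapk_pair e : measurable_fun setT (fun sx : E * E => lapk e sx.1).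
Proof. by apply: (measurableT_comp (@measurable_lapk R d e)). Qed.

Let dom_cos (sx : E * E) := lapk 1 sx.1 * (f sx.2 * cos (dotp sx.1 sx.2)).
Let dom_sin (sx : E * E) := lapk 1 sx.1 * (f sx.2 * sin (dotp sx.1 sx.2)).

Let mf2 : measurable_fun setT (fun sx : E * E => f sx.2).
Proof. exact: (measurableT_comp mf). Qed.

Let measurable_weight : measurable_fun setT (fun s : E => (lapk 1 s)^-1 : R).
Proof.
rewrite (_ : (fun s : E => _) = (fun s : E => \prod_(i < d) expabs (-1) (tnth s i))); last first.
  apply/funext => s; rewrite /lapk -prodfV; apply: eq_bigr => i _.
  by rewrite /expabs mulN1r mul1r -expRN.
exact: measurable_lapk.
Qed.

(** Damping by the integrable kernel lapk 1 makes Fubini's theorem applicable,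
    and a positive factor can be divided out afterwards. *)
Lemma measurable_fcos : measurable_fun setT fcos.
Proof.
have h : (leb R d).-integrable setT (EFin \o (fun s => \int[nu]_x dom_cos (s, x))).
  apply: (@integrable_Rinner1 _ _ _ _ _ (leb R d) nu _ (lapk 1) f) => //.
  - apply: measurable_funM; first exact: measurable_lapk_pair.
    apply: measurable_funM; first exact: mf2.
    by apply: measurable_cos_comp; exact: measurable_dotp.
  - exact: integrable_lapk.
  - by move=> s x; rewrite /dom_cos /= normrM ger0_norm ?lapk_ge0// ler_wpM2l ?lapk_ge0// norm_mul_cos.
rewrite (_ : fcos = fun s => (lapk 1 s)^-1 * \int[nu]_x dom_cos (s, x)); last first.
  apply/funext => s; rewrite /dom_cos /= RintegralZl//; last exact: integrable_fcos.
  rewrite mulrA mulVf ?mul1r//; apply/prodf_neq0 => i _.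
  by rewrite gt_eqF// expR_gt0.
apply: measurable_funM; first exact: measurable_weight.
by apply/measurable_EFinP; exact: measurable_int h.
Qed.

Lemma measurable_fsin : measurable_fun setT fsin.
Proof.
have h : (leb R d).-integrable setT (EFin \o (fun s => \int[nu]_x dom_sin (s, x))).
  apply: (@integrable_Rinner1 _ _ _ _ _ (leb R d) nu _ (lapk 1) f) => //.
  - apply: measurable_funM; first exact: measurable_lapk_pair.
    apply: measurable_funM; first exact: mf2.
    by apply: measurable_sin_comp; exact: measurable_dotp.
  - exact: integrable_lapk.
  - by move=> s x; rewrite /dom_sin /= normrM ger0_norm ?lapk_ge0// ler_wpM2l ?lapk_ge0// norm_mul_sin.
rewrite (_ : fsin = fun s => (lapk 1 s)^-1 * \int[nu]_x dom_sin (s, x)); last first.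
  apply/funext => s; rewrite /dom_sin /= RintegralZl//; last exact: integrable_fsin.
  rewrite mulrA mulVf ?mul1r//; apply/prodf_neq0 => i _.
  by rewrite gt_eqF// expR_gt0.
apply: measurable_funM; first exact: measurable_weight.
by apply/measurable_EFinP; exact: measurable_int h.
Qed.

Lemma measurable_famp : measurable_fun setT famp.
Proof.
apply: (@measurableT_comp _ _ _ _ _ _ (@Num.sqrt R)) => //.
  by apply: continuous_measurable_fun; exact: sqrt_continuous.
apply: measurable_funD; apply: measurable_funX;
  [exact: measurable_fcos|exact: measurable_fsin].
Qed.

Lemma measurable_fcomb e (u : E) : measurable_fun setT (fun s =>
  lapk e s * (cos (dotp s u) * fcos s + sin (dotp s u) * fsin s)).
Proof.
apply: measurable_funM; first exact: measurable_lapk.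
apply: measurable_funD; apply: measurable_funM.
- by apply: measurable_cos_comp; exact: measurable_dotp.
- exact: measurable_fcos.
- by apply: measurable_sin_comp; exact: measurable_dotp.
- exact: measurable_fsin.
Qed.

(** Express the Cauchy kernel as the cosine transform of lapk and exchange the
    integrals, which the damping by lapk makes absolutely convergent. *)
Lemma smoothing_identity e (u : E) : 0 < e ->
  (2 * pi) ^+ d * \int[nu]_x (f x * cauchyk e (vsub u x)) =
  \int[leb R d]_s (lapk e s * (cos (dotp s u) * fcos s + sin (dotp s u) * fsin s)).
Proof.
move=> e0.
pose F (sx : E * E) := lapk e sx.1 * (f sx.2 * cos (dotp sx.1 u - dotp sx.1 sx.2)).
have mF : measurable_fun setT F.
  apply: measurable_funM; first exact: measurable_lapk_pair.
  apply: measurable_funM; first exact: mf2.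
  apply: measurable_cos_comp; apply: measurable_funB; exact: measurable_dotp.
have domF s x : `|F (s, x)| <= lapk e s * f x.
  by rewrite /F /= normrM ger0_norm ?lapk_ge0// ler_wpM2l ?lapk_ge0// norm_mul_cos.
transitivity (\int[leb R d]_s \int[nu]_x F (s, x)); last first.
  apply: eq_Rintegral => s _; rewrite /F /= RintegralZl//; last first.
    apply: integrable_dom => [|x]; last exact: norm_mul_cos.
    apply: measurable_funM => //; apply: measurable_cos_comp.
    by apply: measurable_funB => //; exact: measurable_dotp.
  by rewrite Rintegral_cosB.
have il := @integrable_lapk R d e e0.
rewrite (@Rintegral_Fubini _ _ _ _ _ (leb R d) nu F (lapk e) f)//.
have kE x : \int[leb R d]_s F (s, x) =
    (2 * pi) ^+ d * (f x * cauchyk e (vsub u x)).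
  transitivity (f x * \int[leb R d]_s (lapk e s * cos (dotp s (vsub u x) + 0))).
    rewrite -RintegralZl//; last first.
      apply: (le_integrable _ _ _ il) => //.
        apply/measurable_EFinP; apply: measurable_funM; first exact: measurable_lapk.
        exact: measurable_cos_dotp.
      by move=> s _ /=; rewrite lee_fin (le_trans (norm_mul_cos _ _))// ?lapk_ge0// ler_norm.
    apply: eq_Rintegral => s _; rewrite /F /= addr0 dotpBr; ring.
  by rewrite Rintegral_lapk// cos0; ring.
rewrite -RintegralZl//.
  by apply: eq_Rintegral => x _; rewrite kE.
have p0 : (2 * pi) ^+ d != 0 :> R by rewrite expf_neq0// gt_eqF// mulr_gt0 ?pi_gt0.
have := integrableZl measurableT ((2 * pi) ^+ d)^-1
  (@integrable_Rinner2 _ _ _ _ _ (leb R d) nu F (lapk e) f mF il intf domF).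
apply: eq_integrable => // x _.
by rewrite /= kE -EFinM mulKf.
Qed.

(** The damping factor is at most 1, which makes the right-hand side
    independent of e: as e tends to 0 this becomes a bound on a density. *)
Lemma smoothing_le e (u : E) : 0 < e ->
  (((2 * pi) ^+ d * \int[nu]_x (f x * cauchyk e (vsub u x)))%:E <=
  \int[leb R d]_s (famp s)%:E)%E.
Proof.
move=> e0; rewrite smoothing_identity// /Rintegral fineK; last first.
  apply: integrable_fin_num => //.
  apply: (le_integrable _ _ _ (integrableZl measurableT (\int[nu]_x f x) (@integrable_lapk R d e e0))) => //.
    by apply/measurable_EFinP; exact: measurable_fcomb.
  move=> s _ /=; rewrite lee_fin.
  rewrite [leRHS]ger0_norm ?mulr_ge0 ?lapk_ge0 ?Rintegral_ge0//.
  rewrite normrM ger0_norm ?lapk_ge0// mulrC ler_wpM2r ?lapk_ge0//.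
  by rewrite (le_trans _ (famp_le s))// amp_bound_norm.
apply: le_trans (lee_abs _) _; apply: le_trans (le_abse_integral _ _ _) _ => //.
  by apply/measurable_EFinP; exact: measurable_fcomb.
apply: ge0_le_integral => //.
- apply: measurableT_comp => //; apply/measurable_EFinP; exact: measurable_fcomb.
- by apply/measurable_EFinP; exact: measurable_famp.
move=> s _ /=; rewrite lee_fin normrM ger0_norm ?lapk_ge0//.
rewrite -[leRHS]mul1r ler_pM ?lapk_ge0// ?lapk_le1 ?(ltW e0)//.
exact: amp_bound_norm.
Qed.

End def.
End weighted_fourier.

(** * Plancherel inequality for a bounded density *)

Section bounded_density.
Context {R : realType} {d : nat}.
Notation E := (euclidean R d).
Notation L := (leb R d).

Variables (h : E -> R) (M : R).
Hypotheses (h0 : forall x, 0 <= h x) (hM : forall x, h x <= M)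
  (ih : L.-integrable setT (EFin \o h)).

Let mh : measurable_fun setT h.
Proof. by apply/measurable_EFinP; exact: measurable_int ih. Qed.

Let M0 : 0 <= M.
Proof. exact: le_trans (h0 (@vzero R d)) (hM _). Qed.

Lemma integral_cauchyk_center e (u : E) : 0 < e ->
  (\int[L]_x (cauchyk e (vsub u x))%:E = 1)%E.
Proof.
move=> e0; rewrite -(integral_cauchyk d e0).
rewrite [RHS](@leb_translate R d (vscale (-1) u)); last 2 first.
- by apply/measurable_EFinP; exact: measurable_cauchyk.
- by move=> x; rewrite lee_fin cauchyk_ge0// ltW.
apply: eq_integral => x _; rewrite cauchykN; congr (cauchyk _ _)%:E.
by apply: vecP => i; rewrite tnth_vsub tnth_vadd tnth_vscale mulN1r.
Qed.

Lemma measurable_cauchyk_sub e (u : E) :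
  measurable_fun setT (fun x => cauchyk e (vsub u x)).
Proof.
by apply: (measurableT_comp (@measurable_cauchyk R d e)); exact: measurable_vsub.
Qed.

Lemma integral_smooth_le e (u : E) : 0 < e ->
  (\int[L]_x (h x * cauchyk e (vsub u x))%:E <= M%:E)%E.
Proof.
move=> e0; rewrite -[leRHS]mule1 -(integral_cauchyk_center u e0).
have c0 x : 0 <= cauchyk e (vsub u x) by rewrite cauchyk_ge0// ltW.
rewrite -ge0_integralZl//; last 2 first.
- by apply/measurable_EFinP; exact: measurable_cauchyk_sub.
- by move=> x _; rewrite lee_fin.
apply: ge0_le_integral => //.
- by move=> x _; rewrite lee_fin mulr_ge0.
- by apply/measurable_EFinP; apply: measurable_funM => //; exact: measurable_cauchyk_sub.
- by apply: measurable_funeM; apply/measurable_EFinP; exact: measurable_cauchyk_sub.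
- by move=> x _; rewrite -EFinM lee_fin ler_wpM2r.
Qed.

Lemma Rsmooth_le e (u : E) : 0 < e ->
  0 <= \int[L]_x (h x * cauchyk e (vsub u x)) <= M.
Proof.
move=> e0; have H := integral_smooth_le u e0.
have c0 x : 0 <= cauchyk e (vsub u x) by rewrite cauchyk_ge0// ltW.
rewrite Rintegral_ge0 /=; last by move=> x _; rewrite mulr_ge0.
rewrite -lee_fin /Rintegral fineK// ge0_fin_numE ?(le_lt_trans H) ?ltry//.
by apply: integral_ge0 => x _; rewrite lee_fin mulr_ge0.
Qed.

Lemma lapkE e (s : E) : lapk e s = expR (- (e * \sum_(i < d) `|tnth s i|)).
Proof.
by rewrite /lapk /expabs -expR_sum mulr_sumr sumrN.
Qed.

(** Integrate smoothing_identity against h. On one side appear averages of h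
    against a probability density, which are at most M; on the other side
    Fubini's theorem gives the damped integral of famp ^+ 2. *)
Lemma plancherel_lapk e : 0 < e ->
  (\int[L]_s (lapk e s * famp L h s ^+ 2)%:E <=
   ((2 * pi) ^+ d * (M * \int[L]_x h x))%:E)%E.
Proof.
move=> e0; set I := \int[L]_x h x.
have pd : 0 <= (2 * pi) ^+ d :> R by rewrite exprn_ge0// mulr_ge0// pi_ge0.
have I0 : 0 <= I by exact: Rintegral_ge0.
have il := @integrable_lapk R d e e0.
have ilI : L.-integrable setT (EFin \o (fun s => I * lapk e s)).
  exact: (integrableZl measurableT I il).
pose G (s u : E) := cos (dotp s u) * fcos L h s + sin (dotp s u) * fsin L h s.
pose K (su : E * E) := h su.2 * (lapk e su.1 * G su.1 su.2).
have mK : measurable_fun setT K.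
  apply: measurable_funM; first exact: (measurableT_comp mh).
  apply: measurable_funM; first exact: measurable_lapk_pair.
  apply: measurable_funD; apply: measurable_funM.
  - by apply: measurable_cos_comp; exact: measurable_dotp.
  - by apply: (measurableT_comp (measurable_fcos h0 ih)).
  - by apply: measurable_sin_comp; exact: measurable_dotp.
  - by apply: (measurableT_comp (measurable_fsin h0 ih)).
have domK s u : `|K (s, u)| <= (I * lapk e s) * h u.
  rewrite /K /= normrM ger0_norm// mulrC ler_wpM2r// normrM ger0_norm ?lapk_ge0//.
  rewrite mulrC ler_wpM2r ?lapk_ge0//.
  by apply: le_trans (amp_bound_norm _ _ _) _; exact: famp_le.
have fub := @Rintegral_Fubini _ _ _ _ _ L L K _ h mK ilI ih domK.
have inner_s s : \int[L]_u K (s, u) = lapk e s * famp L h s ^+ 2.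
  pose c1 := fcos L h s; pose c2 := fsin L h s.
  pose a u := h u * cos (dotp s u); pose b u := h u * sin (dotp s u).
  have ia : L.-integrable setT (EFin \o a) by exact: integrable_fcos.
  have ib : L.-integrable setT (EFin \o b) by exact: integrable_fsin.
  have iac : L.-integrable setT (EFin \o (fun u => a u * c1)).
    exact: (integrableZr measurableT c1 ia).
  have ibc : L.-integrable setT (EFin \o (fun u => b u * c2)).
    exact: (integrableZr measurableT c2 ib).
  transitivity (\int[L]_u (lapk e s * (a u * c1 + b u * c2))).
    by apply: eq_Rintegral => u _; rewrite /K /G /a /b /c1 /c2 /=; ring.
  rewrite famp_sqr; move: (lapk e s) => l.
  have -> : fcos L h s ^+ 2 = \int[L]_u (a u * c1) by rewrite RintegralZr.
  have -> : fsin L h s ^+ 2 = \int[L]_u (b u * c2) by rewrite RintegralZr.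
  rewrite -(RintegralD measurableT iac ibc).
  have iab : L.-integrable setT (EFin \o (fun u => a u * c1 + b u * c2)).
    exact: (integrableD measurableT iac ibc).
  exact: (RintegralZl _ measurableT iab).
have inner_u u : \int[L]_s K (s, u) =
    h u * ((2 * pi) ^+ d * \int[L]_x (h x * cauchyk e (vsub u x))).
  have iG : L.-integrable setT (EFin \o (fun s => lapk e s * G s u)).
    apply: (le_integrable measurableT _ _ ilI).
      by apply/measurable_EFinP; exact: measurable_fcomb.
    move=> s _; have l0 := lapk_ge0 e s.
    have b1 : `|G s u| <= I.
      by apply: le_trans (amp_bound_norm _ _ _) _; exact: famp_le.
    rewrite /comp lee_fin normrM (ger0_norm l0) (ger0_norm (mulr_ge0 I0 l0)) mulrC.
    exact: ler_wpM2r.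
  rewrite (smoothing_identity h0 ih u e0).
  have E1 := RintegralZl (h u) measurableT iG.
  by transitivity (\int[L]_s (h u * (lapk e s * G s u))).
have iK1 : L.-integrable setT (EFin \o (fun s => lapk e s * famp L h s ^+ 2)).
  have := @integrable_Rinner1 _ _ _ _ _ L L K _ h mK ilI ih domK.
  by apply: (eq_integrable measurableT) => s _; rewrite /comp inner_s.
have iK2 : L.-integrable setT (EFin \o (fun u => h u * ((2 * pi) ^+ d * \int[L]_x (h x * cauchyk e (vsub u x))))).
  have := @integrable_Rinner2 _ _ _ _ _ L L K _ h mK ilI ih domK.
  by apply: (eq_integrable measurableT) => u _; rewrite /comp inner_u.
have fin1 : (\int[L]_s (lapk e s * famp L h s ^+ 2)%:E)%E \is a fin_num.
  exact: integrable_fin_num iK1.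
rewrite -(fineK fin1) lee_fin.
have -> : fine (\int[L]_s (lapk e s * famp L h s ^+ 2)%:E)%E =
    \int[L]_u (h u * ((2 * pi) ^+ d * \int[L]_x (h x * cauchyk e (vsub u x)))).
  transitivity (\int[L]_s \int[L]_u K (s, u)).
    by apply: (@eq_Rintegral _ _ _ L) => s _; rewrite inner_s.
  by rewrite fub; apply: eq_Rintegral => u _; rewrite inner_u.
rewrite mulrA; have ihM := integrableZl measurableT ((2 * pi) ^+ d * M) ih.
have <- : \int[L]_u ((2 * pi) ^+ d * M * h u) = (2 * pi) ^+ d * M * I.
  exact: (RintegralZl _ measurableT ih).
apply: (le_Rintegral measurableT iK2 ihM) => u _.
have /andP[_ hs] := Rsmooth_le u e0.
rewrite mulrC; apply: ler_wpM2r; first exact: h0.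
by apply: ler_wpM2l; first exact: pd.
Qed.

(** Monotone convergence, as the damping in plancherel_lapk is removed. *)
Lemma plancherel_le :
  (\int[L]_s (famp L h s ^+ 2)%:E <=
   ((2 * pi) ^+ d * (M * \int[L]_x h x))%:E)%E.
Proof.
have mF : measurable_fun setT (fun s => famp L h s ^+ 2).
  by apply: measurable_funX; exact: measurable_famp.
pose en n : R := n.+1%:R^-1.
have en0 n : 0 < en n by rewrite invr_gt0.
pose g n s := (lapk (en n) s * famp L h s ^+ 2)%:E.
have mg n : measurable_fun setT (g n).
  by apply/measurable_EFinP; apply: measurable_funM => //; exact: measurable_lapk.
have g0 n s : (0 <= g n s)%E by rewrite lee_fin mulr_ge0 ?lapk_ge0 ?sqr_ge0.
have ndg s : {homo g ^~ s : n m / (n <= m)%N >-> (n <= m)%E}.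
  move=> n m nm; rewrite lee_fin ler_wpM2r ?sqr_ge0// !lapkE ler_expR lerN2.
  by rewrite ler_wpM2r ?sumr_ge0// lef_pV2 ?posrE// ler_nat.
have cvg_en : en @ \oo --> (0 : R) by exact: cvg_harmonic.
have gl s : g ^~ s @ \oo --> (famp L h s ^+ 2)%:E.
  apply: cvg_EFin; first exact: nearW.
  rewrite -[X in _ --> X]mul1r.
  rewrite [X in X @ _](_ : _ = (fun n => expR (- (en n * \sum_(i < d) `|tnth s i|)) * famp L h s ^+ 2)); last first.
    by apply/funext => n; rewrite /g /= lapkE.
  apply: cvgMr_tmp; rewrite -expR0.
  apply: (@cvg_comp _ _ _ (fun n => - (en n * \sum_(i < d) `|tnth s i|)) expR _ (nbhs (0 : R))); last exact: continuous_expR.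
  set S := \sum_(i < d) `|tnth s i|.
  have hz : (fun n => en n * S) @ \oo --> (0 * S : R) by exact: cvgMr_tmp.
  have h2 : (fun n => - (en n * S)) @ \oo --> (- (0 * S) : R) by exact: cvgN.
  by rewrite mul0r oppr0 in h2; exact: h2.
have -> : (\int[L]_s (famp L h s ^+ 2)%:E = \int[L]_s limn (g ^~ s))%E.
  by apply: eq_integral => s _; apply/esym/cvg_lim => //; exact: gl.
rewrite monotone_convergence//.
apply: lime_le; last by apply: nearW => n; exact: plancherel_lapk.
apply: ereal_nondecreasing_is_cvgn => n m nm.
by apply: ge0_le_integral => // s _; exact: ndg.
Qed.

End bounded_density.

(** * From smoothed bounds to almost everywhere bounds *)

Section setwise_convergence.
Context d0 {T : measurableType d0} {R : realType}.
Variables (mu : {measure set T -> \bar R}) (B : set T) (mB : measurable B)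
  (Bfin : (mu B < +oo)%E) (del : nat -> T -> R) (C : R)
  (mdel : forall n, measurable_fun setT (del n))
  (delC : forall n x, `|del n x| <= C).

Let C0 (x : T) : 0 <= C.
Proof. exact: le_trans (normr_ge0 _) (delC 0%N x). Qed.

Let fin_sub A : measurable A -> A `<=` B -> (mu A < +oo)%E.
Proof. by move=> mA AB; apply: le_lt_trans Bfin; rewrite le_measure// inE. Qed.

Let idel n A : measurable A -> A `<=` B -> mu.-integrable A (EFin \o del n).
Proof.
move=> mA AB; apply: measurable_bounded_integrable => //.
- exact: fin_sub.
- exact: measurable_funTS.
- exists C; split; first by rewrite num_real.
  by move=> M CM x _; rewrite /= (le_trans (delC n x))// ltW.
Qed.

(** The sets A with the property form a Dynkin class. For a countable disjoint
    union, the part of it that remains outside finitely many members has small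
    measure in B, and the common bound C on the functions del n makes its
    contribution uniformly small. *)
Lemma setwise_cvg0 (G : set (set T)) :
  @measurable _ T = <<s G>> -> setI_closed G ->
  (fun n => \int[mu]_(x in B) del n x) @ \oo --> (0 : R) ->
  (forall A, G A -> (fun n => \int[mu]_(x in A `&` B) del n x) @ \oo --> (0 : R)) ->
  forall A, measurable A ->
    (fun n => \int[mu]_(x in A `&` B) del n x) @ \oo --> (0 : R).
Proof.
move=> mG GI PB PG A; rewrite mG; move: A.
have split2 A A' n : measurable A -> measurable A' -> [disjoint A & A'] ->
    \int[mu]_(x in (A `|` A') `&` B) del n x =
    \int[mu]_(x in A `&` B) del n x + \int[mu]_(x in A' `&` B) del n x.
  move=> mA mA' AA'; rewrite setIUl Rintegral_setU//.
  - exact: measurableI.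
  - exact: measurableI.
  - by apply: idel; [apply: measurableU; exact: measurableI|move=> x [] []].
  - apply/disj_setPS => x [[Ax _] [A'x _]].
    by move/disj_setPS : AA' => /(_ x); apply.
apply: (dynkin_induction mG GI).
- by rewrite setTI.
- exact: PG.
- move=> S mS PS.
  rewrite (_ : (fun n => _) = (fun n => \int[mu]_(x in B) del n x -
      \int[mu]_(x in S `&` B) del n x)).
    by rewrite -(subr0 0); exact: cvgB.
  apply/funext => n; apply/eqP; rewrite eq_sym subr_eq addrC; apply/eqP.
  rewrite -split2//; [|exact: measurableC|by apply/disj_setPS => x []].
  by rewrite setUv setTI.
move=> F mF tF PF.
pose U m := \big[setU/set0]_(k < m) F k.
have mU m : measurable (U m) by exact: bigsetU_measurable.
have PU m : (fun n => \int[mu]_(x in U m `&` B) del n x) @ \oo --> (0 : R).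
  elim: m => [|m IH].
    rewrite /U big_ord0 (_ : (fun n => _) = cst 0); first exact: cvg_cst.
    by apply/funext => n; rewrite set0I Rintegral_set0.
  rewrite /U big_ord_recr /= -/(U m).
  rewrite (_ : (fun n => _) = (fun n => \int[mu]_(x in U m `&` B) del n x +
    \int[mu]_(x in F m `&` B) del n x)); first by rewrite -(addr0 0); exact: cvgD.
  apply/funext => n; rewrite split2//; apply/disj_setPS => x [].
  rewrite /U -bigcup_mkord => -[k /= km Fkx] Fmx.
  have kmE : k = m by apply: tF => //; exists x.
  by move: km; rewrite kmE ltnn.
set UU := \bigcup_k F k; have mUU : measurable UU by exact: bigcupT_measurable.
have UUU m : U m `<=` UU by rewrite /U -bigcup_mkord => x [k _ Fkx]; exists k.
(* the part of the union not covered by the first m sets, inside B *)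
pose V m := (UU `\` U m) `&` B.
have mV m : measurable (V m) by apply: measurableI => //; exact: measurableD.
have V0 : \bigcap_m V m = set0.
  rewrite -subset0 => x Vx; have [[k _ Fkx] _] : (UU `&` B) x.
    by have [[]] := Vx 0%N I.
  have [[_ nU] _] := Vx k.+1 I; apply: nU.
  by rewrite /U -bigcup_mkord; exists k => /=.
have V_cvg : (mu \o V) m @[m --> \oo] --> 0%E.
  rewrite -(measure0 mu) -V0; apply: nonincreasing_cvg_mu => //.
  - by apply: fin_sub => // x [].
  - by rewrite V0.
  - move=> m n mn; apply/subsetPset => x [[UUx nU] Bx]; split => //; split => // Ux.
    apply: nU; move: Ux; rewrite /U -!bigcup_mkord => -[k /= km Fkx].
    by exists k => //=; exact: leq_trans mn.
apply/cvgrPdist_lt => e e0.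
have [x0|] := pselect (exists x : T, True); last first.
  move=> nT; apply: nearW => n; rewrite (_ : UU `&` B = set0) ?Rintegral_set0 ?subrr ?normr0//.
  by rewrite -subset0 => x _; apply: nT; exists x.
have {x0} C0' : 0 <= C by case: x0 => x _; exact: C0 x.
have [m Vm] : exists m, C * fine (mu (V m)) < e / 2.
  have c0 : 0 < e / 2 / (C + 1) by rewrite !divr_gt0// ltr_wpDl.
  have /fine_cvgP[_ /cvgrPdist_lt/(_ _ c0)] := V_cvg.
  case=> m _ /(_ m (leqnn m)) /=; rewrite sub0r normrN ger0_norm ?fine_ge0// => h.
  exists m; rewrite ltr_pdivlMr in h; last by rewrite ltr_wpDl.
  by apply: le_lt_trans h; rewrite mulrC ler_wpM2l ?fine_ge0// lerDl.
have e2 : 0 < e / 2 by rewrite divr_gt0.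
have /cvgrPdist_lt/(_ _ e2) := PU m.
apply: filterS => n; rewrite !sub0r !normrN => Un.
have -> : UU = U m `|` (UU `\` U m) by rewrite setDUK.
rewrite split2//; [|exact: measurableD|by apply/disj_setPS => x [? []]].
rewrite -/(V m) (le_lt_trans (ler_normD _ _))// (splitr e) ltrD//.
apply: le_lt_trans Vm.
have iV : mu.-integrable (V m) (EFin \o del n) by apply: idel => // x [].
apply: le_trans (le_normr_Rintegral (mV m) iV) _.
rewrite -Rintegral_cst//; apply: le_Rintegral => //.
- exact: integrable_norm.
- apply: measurable_bounded_integrable => //; first by apply: fin_sub => // x [].
  by exists C; split; [rewrite num_real|move=> M CM x _; rewrite /= ger0_norm// ltW].
Qed.

End setwise_convergence.

Section boxes.
Context {R : realType} {d : nat}.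
Notation E := (euclidean R d).
Notation L := (leb R d).

Definition box (I : 'I_d -> interval R) : set E :=
  [set x | forall i, tnth x i \in I i].
Definition boxes : set (set E) := range box.

Lemma measurable_box I : measurable (box I).
Proof.
rewrite (_ : box I = \bigcap_(i in [set: 'I_d])
  ((@tnth _ (measurableTypeR R))^~ i @^-1` [set` I i])).
  apply: fin_bigcap_measurable => // i _.
  by rewrite -[X in measurable X]setTI; apply: measurable_tnth.
by apply/seteqP; split => x /= h i => [_|]; exact: h.
Qed.

Lemma boxes_setI : setI_closed boxes.
Proof.
move=> _ _ [I _ <-] [J _ <-]; exists (fun i => I i `&` J i)%O => //.
apply/seteqP; split => x /= h.
  by split=> i; have := h i; rewrite in_itvI => /andP[].
by move: h => [hI hJ] i; rewrite in_itvI hI hJ.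
Qed.

Lemma boxes_generate : @measurable _ E = <<s boxes>>.
Proof.
apply/seteqP; split; last first.
  apply: smallest_sub; first exact: sigma_algebra_measurable.
  by move=> _ [I _ <-]; exact: measurable_box.
pose E' := g_sigma_algebraType boxes.
have mt i : measurable_fun setT (fun x : E' => tnth x i : measurableTypeR R).
  apply: (@measurability _ _ E' (measurableTypeR R) setT _ (@ocitv R)) => //.
  move=> _ [_ [[a b] _ <-] <-].
  rewrite setTI; apply: sub_sigma_algebra.
  exists (fun j => if j == i then `]a, b] else `]-oo, +oo[) => //.
  apply/seteqP; split => x /=.
    by move/(_ i); rewrite eqxx.
  by move=> xi j; case: eqP => [->|].
have mid : measurable_fun setT (fun x : E' => x : E).
  by apply/measurable_fun_tnthP => i; exact: mt.
move=> A mA; have := mid measurableT A mA.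
by rewrite setTI preimage_id.
Qed.

Definition itv_ends (I : interval R) : set R :=
  let: Interval l r := I in
  (if l is BSide _ a then [set a] else set0) `|`
  (if r is BSide _ a then [set a] else set0).

Lemma near_itv_bound (b : itv_bound R) (x : R) :
  (forall s a, b = BSide s a -> x != a) ->
  \forall y \near x, (b <= BLeft y)%O = (b <= BLeft x)%O /\
                     (BRight y <= b)%O = (BRight x <= b)%O.
Proof.
case: b => [s a /(_ _ _ erefl)|s _]; last by near=> y; case: s.
rewrite neq_lt => /orP[xa|ax].
  have := lt_nbhsl xa; apply: filterS => y ya.
  by case: s; rewrite !bnd_simp ?(lt_geF xa) ?(lt_geF ya) ?xa ?ya
    ?(ltW xa) ?(ltW ya) ?(lt_gtF xa) ?(lt_gtF ya).
have := lt_nbhsr ax; apply: filterS => y ay.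
by case: s; rewrite !bnd_simp ?(lt_geF ax) ?(lt_geF ay) ?ax ?ay
    ?(ltW ax) ?(ltW ay) ?(lt_gtF ax) ?(lt_gtF ay).
Unshelve. all: by end_near. Qed.

Lemma near_itv (I : interval R) (x : R) : ~ itv_ends I x ->
  \forall y \near x, (y \in I) = (x \in I).
Proof.
case: I => l r nx.
have nl : \forall y \near x, (l <= BLeft y)%O = (l <= BLeft x)%O /\ (BRight y <= l)%O = (BRight x <= l)%O.
  by apply: near_itv_bound => s a la; apply/eqP => xa; apply: nx; left; rewrite la.
have nr : \forall y \near x, (r <= BLeft y)%O = (r <= BLeft x)%O /\ (BRight y <= r)%O = (BRight x <= r)%O.
  by apply: near_itv_bound => s a la; apply/eqP => xa; apply: nx; right; rewrite la.
near=> y; rewrite !itv_boundlr.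
have [-> _] : (l <= BLeft y)%O = (l <= BLeft x)%O /\ (BRight y <= l)%O = (BRight x <= l)%O by near: y.
by have [_ ->] : (r <= BLeft y)%O = (r <= BLeft x)%O /\ (BRight y <= r)%O = (BRight x <= r)%O by near: y.
Unshelve. all: by end_near. Qed.

Lemma leb_hyperplane (i : 'I_d) (a : R) : L [set x | tnth x i = a] = 0%E.
Proof.
pose A (j : 'I_d) : set (measurableTypeR R) := if j == i then [set a] else setT.
rewrite (_ : [set _ | _] = [set x | forall j, A j (tnth x j)]).
  rewrite lebesgue_measure_euclidean_box; last by move=> j; rewrite /A; case: ifP.
  by rewrite (bigD1 i)//= /A eqxx lebesgue_measure_set1 mul0e.
apply/seteqP; split => x /=; rewrite /A.
  by move=> xi j; case: eqP => [->|].
by move/(_ i); rewrite eqxx.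
Qed.

Lemma measurable_hyperplane (i : 'I_d) (a : R) :
  measurable [set x : E | tnth x i = a].
Proof.
rewrite (_ : [set _ | _] = (@tnth _ (measurableTypeR R))^~ i @^-1` [set a])//.
by rewrite -[X in measurable X]setTI; apply: measurable_tnth.
Qed.

(** The boundary of a box lies in finitely many hyperplanes. *)
Lemma box_boundary_null (I : 'I_d -> interval R) :
  {ae L, forall x, forall i, ~ itv_ends (I i) (tnth x i)}.
Proof.
suff H i : {ae L, forall x, ~ itv_ends (I i) (tnth x i)}.
  exact: filter_forall H.
have N (b : itv_bound R) : {ae L, forall x, forall s a, b = BSide s a -> tnth x i <> a}.
  case: b => [s a|s]; last by apply: nearW => x.
  exists [set x | tnth x i = a]; split.
  - exact: measurable_hyperplane.
  - exact: leb_hyperplane.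
  - by move=> x /= /existsNP[s' /existsNP[a' /not_implyP[[_ <-]]]]; rewrite notK.
case: (I i) => l r; have nl := N l; have nr := N r.
apply: (ae_mono2 _ nr nl) => x Hr Hl /= [].
  by case: l {nl} Hl => // s a /(_ _ _ erefl).
by case: r {nr} Hr => // s a /(_ _ _ erefl).
Qed.

Definition cube (c : E) (r : R) : set E :=
  box (fun i => `[tnth c i - r, tnth c i + r]).

Lemma measurable_cube c r : measurable (cube c r).
Proof. exact: measurable_box. Qed.

Lemma leb_cube c r : 0 <= r -> L (cube c r) = ((2 * r) ^+ d)%:E.
Proof.
move=> r0; have -> : L (cube c r) = (\prod_(i < d) (@lebesgue_measure R)
    `[(tnth c i - r)%R, (tnth c i + r)%R]%classic)%E.
  by rewrite -lebesgue_measure_euclidean_box.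
rewrite (eq_bigr (fun=> (2 * r)%:E)); last first.
  move=> i _; rewrite lebesgue_measure_itv/= lte_fin.
  case: ifPn => [_|]; first by rewrite -EFinB; congr EFin; ring.
  by rewrite -leNgt => rr; congr EFin; lra.
by rewrite prodEFin prodr_const card_ord.
Qed.

Lemma leb_cube_fin c r : 0 <= r -> (L (cube c r) < +oo)%E.
Proof. by move=> r0; rewrite leb_cube// ltry. Qed.

Lemma mem_cube (c x : E) (r : R) : (forall i, `|tnth x i - tnth c i| <= r) -> cube c r x.
Proof.
move=> h i; rewrite in_itv/=; have := h i; rewrite ler_distl => /andP[-> h2].
by rewrite andTb.
Qed.

End boxes.

Section approximate_identity.
Context {R : realType} {d : nat}.
Notation E := (euclidean R d).
Notation L := (leb R d).

Variables (h : E -> R) (C : R).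
Hypotheses (h0 : forall x, 0 <= h x) (hC : forall x, h x <= C)
  (ih : L.-integrable setT (EFin \o h)).

Let mh : measurable_fun setT h.
Proof. by apply/measurable_EFinP; exact: measurable_int ih. Qed.

Definition smoothed e (u : E) := \int[L]_x (h x * cauchyk e (vsub u x)).

Lemma EFin_smoothed e u : 0 < e ->
  (smoothed e u)%:E = (\int[L]_x (h x * cauchyk e (vsub u x))%:E)%E.
Proof.
move=> e0; rewrite /smoothed /Rintegral fineK// ge0_fin_numE.
  by rewrite (le_lt_trans (integral_smooth_le h0 hC ih u e0))// ltry.
apply: integral_ge0 => x _; rewrite lee_fin mulr_ge0//.
by apply: cauchyk_ge0; exact: ltW.
Qed.

Lemma measurable_indic_affine (D : set E) e (x : E) : measurable D ->
  measurable_fun setT (fun v => \1_D (vadd x (vscale e v)) : R).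
Proof.
move=> mD; apply: (@measurableT_comp _ _ _ _ _ _ (\1_D : E -> R)) => //.
by apply: measurable_vadd => //; exact: measurable_vscale.
Qed.

Lemma measurable_smooth_pair (D : set E) e : measurable D ->
  measurable_fun setT (fun ux : E * E =>
    \1_D ux.1 * (h ux.2 * cauchyk e (vsub ux.1 ux.2)) : R).
Proof.
move=> mD; apply: measurable_funM.
  by apply: (@measurableT_comp _ _ _ _ _ _ (\1_D : E -> R)).
apply: measurable_funM; first exact: (measurableT_comp mh).
by apply: (measurableT_comp (@measurable_cauchyk R d e)); exact: measurable_vsub.
Qed.

Lemma measurable_smoothed e : 0 < e -> measurable_fun setT (smoothed e).
Proof.
move=> e0; apply/measurable_EFinP.
have := @measurable_fun_fubini_tonelli_F _ _ _ _ _ L (fun ux : E * E =>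
  (\1_setT ux.1 * (h ux.2 * cauchyk e (vsub ux.1 ux.2)))%:E).
rewrite (_ : fubini_F _ _ = EFin \o smoothed e).
  apply; first by apply/measurable_EFinP; exact: measurable_smooth_pair.
  move=> x; rewrite lee_fin mulr_ge0// mulr_ge0//.
  by apply: cauchyk_ge0; exact: ltW.
apply/funext => u; rewrite /fubini_F /comp EFin_smoothed//.
by apply: eq_integral => x _; rewrite /= indicT mul1r.
Qed.

Lemma smoothed_bounds e u : 0 < e -> 0 <= smoothed e u <= C.
Proof. exact: Rsmooth_le. Qed.

(** The convolution of the indicator of D with the Cauchy kernel of width e,
    after the change of variables that makes the kernel independent of e. *)
Definition blur (D : set E) e (x : E) : \bar R :=
  (\int[L]_v (\1_D (vadd x (vscale e v)) * cauchyk 1 v)%:E)%E.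

Lemma measurable_blur (D : set E) e : measurable D ->
  measurable_fun setT (blur D e).
Proof.
move=> mD.
apply: (@measurable_fun_fubini_tonelli_F _ _ _ _ _ L (fun xv : E * E =>
  (\1_D (vadd xv.1 (vscale e xv.2)) * cauchyk 1 xv.2)%:E)) => //.
- apply/measurable_EFinP; apply: measurable_funM.
    apply: (@measurableT_comp _ _ _ _ _ _ (\1_D : E -> R)) => //.
    by apply: measurable_vadd => //; exact: measurable_vscale.
  by apply: (measurableT_comp (@measurable_cauchyk R d 1)).
- by move=> x; rewrite lee_fin mulr_ge0// cauchyk_ge0.
Qed.

Lemma blur_le1 (D : set E) e x : measurable D -> (0 <= blur D e x <= 1)%E.
Proof.
move=> mD; apply/andP; split.
  by apply: integral_ge0 => v _; rewrite lee_fin mulr_ge0// cauchyk_ge0.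
rewrite -(@integral_cauchyk R d 1)//; apply: ge0_le_integral => //.
- by move=> v _; rewrite lee_fin mulr_ge0// cauchyk_ge0.
- apply/measurable_EFinP; apply: measurable_funM; last exact: measurable_cauchyk.
  exact: measurable_indic_affine.
- by apply/measurable_EFinP; exact: measurable_cauchyk.
- by move=> v _; rewrite lee_fin ler_piMl ?cauchyk_ge0 // indicE lern1 leq_b1.
Qed.

(** The Cauchy kernel is even, so that the convolution can be moved from h to
    the indicator of D. *)
Lemma integral_smoothed (D : set E) e : measurable D -> 0 < e ->
  (\int[L]_(u in D) (smoothed e u)%:E = \int[L]_x ((h x)%:E * blur D e x))%E.
Proof.
move=> mD e0.
have k0 (u x : E) : 0 <= cauchyk e (vsub u x) by apply: cauchyk_ge0; exact: ltW.
transitivity (\int[L]_u \int[L]_x (\1_D u * (h x * cauchyk e (vsub u x)))%:E)%E.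
  rewrite integral_mkcond; apply: eq_integral => u _; rewrite patchE.
  case: ifPn => uD.
    rewrite EFin_smoothed//; apply: eq_integral => x _.
    by rewrite indicE uD mul1r.
  rewrite (eq_integral (fun=> 0%E)) ?integral0// => x _.
  by rewrite indicE (negbTE uD) mul0r.
rewrite (@fubini_tonelli _ _ _ _ _ L L (fun ux : E * E => (\1_D ux.1 * (h ux.2 * cauchyk e (vsub ux.1 ux.2)))%:E)); last 2 first.
- by apply/measurable_EFinP; exact: measurable_smooth_pair.
- by move=> x; rewrite lee_fin !mulr_ge0.
apply: eq_integral => x _ /=.
have mk : measurable_fun setT (fun u => \1_D u * cauchyk e (vsub u x)).
  apply: measurable_funM => //.
  by apply: (measurableT_comp (@measurable_cauchyk R d e)); exact: measurable_vsub.
transitivity ((h x)%:E * \int[L]_u (\1_D u * cauchyk e (vsub u x))%:E)%E.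
  rewrite -ge0_integralZl; [|by []|exact/measurable_EFinP| |by rewrite lee_fin];
    last by move=> u _; rewrite lee_fin mulr_ge0.
  by apply: eq_integral => u _; rewrite -EFinM mulrCA.
congr (_ * _)%E.
rewrite (@leb_affine _ _ e x)//; last 2 first.
- exact/measurable_EFinP.
- by move=> u; rewrite lee_fin mulr_ge0.
rewrite -ge0_integralZl; [|by []| | |by rewrite lee_fin exprn_ge0// ltW]; last 2 first.
- apply/measurable_EFinP; apply: measurable_funM; first exact: measurable_indic_affine.
  apply: (measurableT_comp (@measurable_cauchyk R d e)); apply: measurable_vsub => //.
  by apply: measurable_vadd => //; exact: measurable_vscale.
- by move=> u _; rewrite lee_fin mulr_ge0.
apply: eq_integral => v _; rewrite -EFinM; congr EFin.
rewrite (_ : vsub _ _ = vscale e v); last first.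
  by apply: vecP => i; rewrite tnth_vsub tnth_vadd addrAC subrr add0r.
rewrite cauchykE// mulrCA; congr (_ * _); rewrite mulrA divff ?mul1r//.
by rewrite expf_neq0// gt_eqF.
Qed.

Let en (n : nat) : R := n.+1%:R^-1.
Let en0 n : 0 < en n. Proof. by rewrite invr_gt0. Qed.

(** Off the boundary of the box its indicator is locally constant, and the
    kernel itself dominates the integrands. *)
Lemma cvg_blur_box (I : 'I_d -> interval R) x :
  (forall i, ~ itv_ends (I i) (tnth x i)) ->
  blur (box I) (en n) x @[n --> \oo] --> (\1_(box I) x)%:E.
Proof.
move=> xI; pose D := box I; have mD : measurable D by exact: measurable_box.
pose F n (v : E) := (\1_D (vadd x (vscale (en n) v)) * cauchyk 1 v)%:E : \bar R.
have cvg_en : en @ \oo --> (0 : R) by exact: cvg_harmonic.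
have loc v : \forall n \near \oo, \1_D (vadd x (vscale (en n) v)) = \1_D x :> R.
  have H i : \forall n \near \oo, (tnth (vadd x (vscale (en n) v)) i \in I i) = (tnth x i \in I i).
    have c : (fun n => tnth x i + en n * tnth v i) @ \oo --> tnth x i.
      have c1 : (fun n => en n * tnth v i) @ \oo --> (0 * tnth v i : R) by exact: cvgMr_tmp.
      have c2 : (fun n => tnth x i + en n * tnth v i) @ \oo --> (tnth x i + 0 * tnth v i : R).
        by apply: cvgD => //; exact: cvg_cst.
      by rewrite mul0r addr0 in c2.
    have [m _ Hm] := c _ (near_itv (xI i)).
    by exists m => // n mn; rewrite /= tnth_vadd tnth_vscale; exact: Hm.
  have [m _ Hm] : \forall n \near \oo, forall i,
      (tnth (vadd x (vscale (en n) v)) i \in I i) = (tnth x i \in I i).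
    exact: filter_forall H.
  exists m => // n mn; have Hn := Hm n mn.
  rewrite !indicE; congr ((nat_of_bool _)%:R); apply/idP/idP; rewrite !inE => h1 i.
    by rewrite -Hn; exact: h1.
  by rewrite Hn; exact: h1.
have i1 : L.-integrable setT (EFin \o @cauchyk R d 1).
  apply/integrableP; split; first by apply/measurable_EFinP; exact: measurable_cauchyk.
  under eq_integral do rewrite /= ger0_norm ?cauchyk_ge0//.
  by rewrite integral_cauchyk// ltry.
have mF n : measurable_fun setT (F n).
  rewrite /F; apply/measurable_EFinP.
  apply: measurable_funM; last exact: measurable_cauchyk.
  exact: measurable_indic_affine.
have mlim : measurable_fun setT (fun v : E => (\1_D x * cauchyk 1 v)%:E : \bar R).
  apply/measurable_EFinP; apply: measurable_funM; last exact: measurable_cauchyk.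
  exact: measurable_cst.
have [||_ _] := @dominated_convergence _ _ _ L setT measurableT F
  (fun v : E => (\1_D x * cauchyk 1 v)%:E) (EFin \o @cauchyk R d 1) mF mlim _ i1.
- apply: aeW => v _; apply: cvg_near_cst; case: (loc v) => m _ Hm; exists m => // n mn.
  by rewrite /F /= (Hm n mn).
- apply: aeW => v n _; rewrite /F /= lee_fin normrM (ger0_norm (cauchyk_ge0 _ _))//.
  by rewrite ler_piMl ?cauchyk_ge0// indicE ger0_norm// lern1 leq_b1.
rewrite (_ : (\int[L]_v (\1_D x * cauchyk 1 v)%:E = (\1_D x)%:E)%E)//.
under eq_integral do rewrite EFinM.
rewrite ge0_integralZl//.
- by rewrite integral_cauchyk// mule1.
- by apply/measurable_EFinP; exact: measurable_cauchyk.
- by move=> v _; rewrite lee_fin cauchyk_ge0.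
Qed.

Lemma cvg_smoothed_box (I : 'I_d -> interval R) :
  (\int[L]_(u in box I) (smoothed (en n) u)%:E)%E @[n --> \oo] -->
  (\int[L]_(u in box I) (h u)%:E)%E.
Proof.
pose D := box I; have mD : measurable D by exact: measurable_box.
rewrite (_ : (fun n => _) = (fun n => \int[L]_x ((h x)%:E * blur D (en n) x))%E); last first.
  by apply/funext => n; rewrite integral_smoothed.
have -> : (\int[L]_(u in box I) (h u)%:E = \int[L]_x ((h x)%:E * (\1_D x)%:E))%E.
  rewrite integral_mkcond; apply: eq_integral => x _.
  by rewrite patchE indicE; case: ifPn => _; rewrite ?mule1 ?mule0.
have mF n : measurable_fun setT (fun x => (h x)%:E * blur D (en n) x)%E.
  by apply: emeasurable_funM; [exact/measurable_EFinP|exact: measurable_blur].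
have mlim : measurable_fun setT (fun x => (h x)%:E * (\1_D x)%:E)%E.
  by apply: emeasurable_funM; exact/measurable_EFinP.
have [||_ _] := @dominated_convergence _ _ _ L setT measurableT
  (fun n x => (h x)%:E * blur D (en n) x)%E
  (fun x => (h x)%:E * (\1_D x)%:E)%E (EFin \o h) mF mlim _ ih; last by [].
- apply: (ae_mono _ (@box_boundary_null R d I)) => x xI _.
  by apply: cvgeZl => //; exact: cvg_blur_box.
- apply: aeW => x n _; have /andP[b0 b1] := blur_le1 (en n) x mD.
  rewrite abseM /= ger0_norm// gee0_abs//.
  by rewrite -[leRHS]mule1 lee_pmul// lee_fin.
Qed.

(** On boxes the integrals of the smoothed functions converge to those of h,
    and setwise_cvg0 extends this to all measurable sets A inside a cube.
    Hence the integral of h over A is at most N times the measure of A, which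
    leaves no room for a set of positive measure on which h exceeds N. *)
Lemma density_le_of_smoothed (N : R) :
  (forall e u, 0 < e -> smoothed e u <= N) -> {ae L, forall x, h x <= N}.
Proof.
move=> hN.
pose B (m : nat) : set E := cube (@vzero R d) m%:R.
have mB m : measurable (B m) by exact: measurable_cube.
have Bfin m : (L (B m) < +oo)%E by exact: leb_cube_fin.
have bB m : @boxes R d (B m) by exists (fun i => `[tnth (@vzero R d) i - m%:R, tnth (@vzero R d) i + m%:R]).
have key m A : measurable A ->
    (\int[L]_(x in A `&` B m) (h x)%:E <= N%:E * L (A `&` B m))%E.
  move=> mA; have mAB : measurable (A `&` B m) by exact: measurableI.
  have ABfin : (L (A `&` B m) < +oo)%E.
    by apply: le_lt_trans (Bfin m); rewrite le_measure ?inE// => x [].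
  pose del n x := smoothed (en n) x - h x.
  have mdel n : measurable_fun setT (del n).
    by apply: measurable_funB => //; exact: measurable_smoothed.
  have delC n x : `|del n x| <= C.
    have /andP[s0 s1] := smoothed_bounds x (en0 n).
    have := h0 x; have := hC x; rewrite ler_norml /del => *; apply/andP; split; lra.
  have isub D n : measurable D -> (L D < +oo)%E ->
      L.-integrable D (EFin \o smoothed (en n)).
    move=> mD Dfin; apply: measurable_bounded_integrable => //.
      by apply: measurable_funTS; exact: measurable_smoothed.
    exists C; split; first by rewrite num_real.
    move=> M CM x _ /=; have /andP[s0 s1] := smoothed_bounds x (en0 n).
    by rewrite ger0_norm// (le_trans s1)// ltW.
  have ihD D : measurable D -> L.-integrable D (EFin \o h).
    by move=> mD; exact: integrableS ih.
  have boxcvg A' : @boxes R d A' ->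
      (fun n => \int[L]_(x in A' `&` B m) del n x) @ \oo --> (0 : R).
    move=> bA'; have : @boxes R d (A' `&` B m).
      by exact: boxes_setI.
    case=> J _ JE; have mJ : measurable (box J) by exact: measurable_box.
    have Jfin : (L (box J) < +oo)%E.
      by apply: le_lt_trans (Bfin m); rewrite le_measure ?inE// JE => x [].
    rewrite -JE (_ : (fun n => _) = (fun n => \int[L]_(x in box J) smoothed (en n) x -
       \int[L]_(x in box J) h x)); last first.
      by apply/funext => n; rewrite /del RintegralB//; [exact: isub|exact: ihD].
    rewrite -(subrr (\int[L]_(x in box J) h x)); apply: cvgB; last exact: cvg_cst.
    apply: fine_cvg.
    rewrite /Rintegral fineK; last by apply: integrable_fin_num => //; exact: ihD.
    exact: cvg_smoothed_box.
  have c0 : (fun n => \int[L]_(x in A `&` B m) del n x) @ \oo --> (0 : R).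
    apply: (setwise_cvg0 (mB m) (Bfin m) mdel delC boxes_generate boxes_setI) => //.
    by have := boxcvg (B m); rewrite setIid; exact.
  have c1 : (fun n => \int[L]_(x in A `&` B m) smoothed (en n) x) @ \oo -->
      \int[L]_(x in A `&` B m) h x.
    rewrite -[X in _ --> X]add0r.
    rewrite (_ : (fun n => _) = (fun n => \int[L]_(x in A `&` B m) del n x +
       \int[L]_(x in A `&` B m) h x)); first by apply: cvgD => //; exact: cvg_cst.
    apply/funext => n; rewrite /del RintegralB//; [|exact: isub|exact: ihD].
    by rewrite subrK.
  have fAB : L (A `&` B m) \is a fin_num by rewrite ge0_fin_numE.
  have c2 : \int[L]_(x in A `&` B m) h x <= N * fine (L (A `&` B m)).
    rewrite -(cvg_lim _ c1)//; apply: limr_le; [exact: cvgP c1|apply: nearW => n].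
    rewrite -Rintegral_cst//; apply: le_Rintegral => //.
    - exact: isub.
    - apply: measurable_bounded_integrable => //.
      by exists `|N|; split => // M NM x _; rewrite /= ltW.
    - by move=> x _; exact: hN.
  rewrite -(fineK fAB) -EFinM -(@fineK _ (\int[L]_(x in A `&` B m) (h x)%:E)%E).
    by rewrite lee_fin.
  by apply: integrable_fin_num => //; exact: ihD.
have null m k : L ([set x | N + k.+1%:R^-1 <= h x] `&` B m) = 0%E.
  set A := [set x | _].
  have mA : measurable A.
    rewrite (_ : A = h @^-1` `[N + k.+1%:R^-1, +oo[).
      by rewrite -[X in measurable X]setTI; exact: mh.
    by apply/seteqP; split => x /=; rewrite in_itv/= andbT.
  have mAB : measurable (A `&` B m) by exact: measurableI.
  have ABfin : L (A `&` B m) \is a fin_num.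
    rewrite ge0_fin_numE//; apply: le_lt_trans (Bfin m).
    by rewrite le_measure ?inE// => x [].
  have h1 : ((N + k.+1%:R^-1)%:E * L (A `&` B m) <=
      \int[L]_(x in A `&` B m) (h x)%:E)%E.
    rewrite -integral_cst//; apply: le_integral => //.
    - apply: (@measurable_bounded_integrable _ _ _ _ (cst (N + k.+1%:R^-1))) => //.
        by rewrite -ge0_fin_numE.
      by exists `|N + k.+1%:R^-1|; split => // M NM x _; rewrite /= ltW.
    - exact: integrableS ih.
    - by move=> x; rewrite inE => -[Ax _]; rewrite lee_fin.
  have := le_trans h1 (key m A mA).
  rewrite -(fineK ABfin) -!EFinM lee_fin mulrDl gerDl pmulr_rle0 ?invr_gt0// => h2.
  by congr EFin; apply/eqP; rewrite eq_le h2 fine_ge0.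
have mset m k : measurable ([set x | N + k.+1%:R^-1 <= h x] `&` B m).
  apply: measurableI => //.
  rewrite (_ : [set _ | _] = h @^-1` `[N + k.+1%:R^-1, +oo[).
    by rewrite -[X in measurable X]setTI; exact: mh.
  by apply/seteqP; split => x /=; rewrite in_itv/= andbT.
have ngl : L.-negligible (\bigcup_m \bigcup_k ([set x | N + k.+1%:R^-1 <= h x] `&` B m)).
  apply: negligible_bigcup => m; apply: negligible_bigcup => k.
  by apply/negligibleP; [exact: mset|exact: null].
apply: (negligibleS _ ngl) => x /= /negP; rewrite -ltNge => Nh.
have [m xm] : exists m : nat, forall i, `|tnth x i| <= m%:R.
  exists (Num.truncn (enorm x)).+1 => i; apply: le_trans (tnth_le_enorm x i) _.
  by rewrite ltW// truncnS_gt.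
exists m => //.
exists (Num.truncn (h x - N)^-1) => //; split.
  rewrite /= -lerBrDl -[leRHS]invrK lef_pV2 ?posrE ?invr_gt0 ?subr_gt0//.
  by rewrite ltW// truncnS_gt.
by apply: mem_cube => i; rewrite tnth_vzero subr0.
Qed.

End approximate_identity.

(** * Sums of independent copies and their tilted Fourier transform *)

Section partial_sums.
Context d0 {T : measurableType d0} {R : realType} (P : probability T R) {d : nat}.
Notation E := (euclidean R d).
Variables (X : {RV P >-> E}) (Xs : nat -> {RV P >-> E}).

Definition psum (n : nat) (w : T) : E :=
  [tuple \sum_(k < n) tnth (Xs k w) i | i < d].

Lemma measurable_psum n : measurable_fun setT (psum n).
Proof.
apply: measurable_vec => i; apply: measurable_sum => k.
by apply: measurable_coord; exact: (@measurable_funPT _ _ _ _ (Xs k)).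
Qed.

HB.instance Definition _ n := isMeasurableFun.Build _ _ _ _
  (psum n) (measurable_psum n).

Lemma psumS n w : psum n.+1 w = vadd (psum n w) (Xs n w).
Proof. by apply: vecP => i; rewrite tnth_vadd !tnth_mktuple big_ord_recr. Qed.

Lemma psum0 w : psum 0 w = vzero.
Proof. by apply: vecP => i; rewrite !tnth_mktuple big_ord0. Qed.

Hypothesis copies : independent_copies P X Xs.

Let mXs k : measurable_fun setT (Xs k).
Proof. exact: (@measurable_funPT _ _ _ _ (Xs k)). Qed.

Let mpre d1 (U : measurableType d1) (f : T -> U) A :
  measurable_fun setT f -> measurable A -> measurable (f @^-1` A).
Proof. by move=> mf mA; rewrite -[X in measurable X]setTI; exact: mf. Qed.

Let mcap (J : {fset nat}) (A : nat -> set E) :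
  (forall k, k \in J -> measurable (A k)) ->
  measurable (\bigcap_(k in [set` J]) (Xs k @^-1` A k)).
Proof.
move=> mA; apply: fin_bigcap_measurable; first exact: finite_fset.
by move=> k kJ; apply: mpre => //; exact: mA.
Qed.

Let pairSX n (w : T) : E * E := (psum n w, Xs n w).

Let mpair n : measurable_fun setT (pairSX n).
Proof. by apply: measurable_fun_pair; [exact: measurable_psum|exact: mXs]. Qed.

Let rect_indep n := forall (B : set E) (J : {fset nat}) (A : nat -> set E),
  measurable B -> (forall k, k \in J -> (n <= k)%N /\ measurable (A k)) ->
  P (psum n @^-1` B `&` \bigcap_(k in [set` J]) (Xs k @^-1` A k)) =
  (P (psum n @^-1` B) * \prod_(k <- J) P (Xs k @^-1` A k))%E.

(** Condition on the event D that concerns the variables after Xs n: by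
    rect_indep the conditional law of the pair agrees with the product measure
    on rectangles, hence on all measurable sets. *)
Let rect_joint n (J : {fset nat}) (A : nat -> set E) (G : set (E * E)) :
  rect_indep n -> measurable G ->
  (forall k, k \in J -> (n < k)%N /\ measurable (A k)) ->
  P (pairSX n @^-1` G `&` \bigcap_(k in [set` J]) (Xs k @^-1` A k)) =
  ((distribution P (psum n) \x distribution P (Xs n)) G *
   \prod_(k <- J) P (Xs k @^-1` A k))%E.
Proof.
move=> IH mG hJ.
set D := \bigcap_(k in _) _; set c := (\prod_(k <- J) _)%E.
have mD : measurable D by apply: mcap => k /hJ[].
have PD : P D = c by rewrite copies.1// => k /hJ[].
have mSX : measurable (pairSX n @^-1` G) by exact: mpre.
have [c0|c0] := eqVneq (P D) 0%E.
  rewrite -PD c0 mule0; apply/eqP; rewrite -measure_le0 -c0 le_measure ?inE//.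
  exact: measurableI.
pose r := fine (P D).
have rE : P D = r%:E by rewrite fineK// fin_num_measure.
have r0 : 0 < r.
  by rewrite lt_neqAle fine_ge0// andbT eq_sym; apply: contra c0 => /eqP h; rewrite rE h.
have rV0 : 0 <= r^-1 by rewrite invr_ge0 ltW.
(* the law of the pair under P conditioned on D *)
pose m' : {measure set (E * E) -> \bar R} := mscale (NngNum rV0)
  (measure_function_pushforward__canonical__measure_function_Measure
    (mrestr P mD) (@mpair n)).
have m'E (H : set (E * E)) : m' H = ((r^-1)%:E * P (pairSX n @^-1` H `&` D))%E by [].
have -> : (distribution P (psum n) \x distribution P (Xs n))%E G = m' G.
  apply: product_measure_unique => // B1 B2 mB1 mB2; rewrite m'E.
  have nJ : n \notin J by apply/negP => /hJ[]; rewrite ltnn.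
  pose A' k := if k == n then B2 else A k.
  have -> : pairSX n @^-1` (B1 `*` B2) `&` D =
      psum n @^-1` B1 `&` \bigcap_(k in [set` (n |` J)%fset]) (Xs k @^-1` A' k).
    apply/seteqP; split => w /=.
      move=> [[/= w1 w2] Dw]; split=> // k /=; rewrite in_fset1U /A'.
      by case: eqP => [->//|_ /= kJ]; exact: Dw.
    move=> [w1 Cw]; split; first split => //=.
      have := Cw n; rewrite /= in_fset1U eqxx /A' eqxx; exact.
    move=> k /= kJ; have := Cw k; rewrite /= in_fset1U kJ orbT /A'.
    by case: eqP => [kn|_]; [rewrite kn in kJ; rewrite kJ in nJ|exact].
  rewrite IH//; last first.
    move=> k; rewrite in_fset1U /A'; case: eqP => [->//|_ /= /hJ[nk mk]].
    by split=> //; exact: ltnW.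
  rewrite big_fsetU1//= {1}/A' eqxx.
  rewrite (_ : (\prod_(_ <- J) _)%E = P D); last first.
    rewrite PD /c big_seq [RHS]big_seq; apply: eq_bigr => k kJ; rewrite /A'.
    by case: eqP => // kn; rewrite kn in kJ; rewrite kJ in nJ.
  rewrite rE (muleA (P _)) (muleC _ r%:E) (muleA (r^-1)%:E).
  by rewrite -EFinM mulVf ?gt_eqF// mul1e.
rewrite m'E -PD rE muleAC -EFinM mulVf ?gt_eqF// mul1e.
by [].
Qed.

Let rect_indep_all n : rect_indep n.
Proof.
elim: n => [|n IH] B J A mB hJ.
  have [B0|B0] := pselect (B vzero).
    have -> : psum 0 @^-1` B = setT by apply/seteqP; split => w //= _; rewrite psum0.
    by rewrite setTI probability_setT mul1e copies.1// => k /hJ[].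
  have -> : psum 0 @^-1` B = set0 by apply/seteqP; split => w //=; rewrite psum0.
  by rewrite set0I measure0 mul0e.
pose G := [set z : E * E | B (vadd z.1 z.2)].
have mG : measurable G.
  rewrite -[G]setTI; apply: (measurable_vadd (f := fst) (g := snd)) => //.
have SG : psum n.+1 @^-1` B = pairSX n @^-1` G.
  by apply/seteqP; split => w; rewrite /G /= psumS.
rewrite SG rect_joint//.
have := @rect_joint n fset0 A G IH mG; rewrite big_seq_fset0 mule1.
rewrite (_ : \bigcap_(k in _) _ = setT) ?setIT; last first.
  by apply/seteqP; split => w //= _ k.
by move=> ->.
Qed.

Lemma joint_law n (G : set (E * E)) : measurable G ->
  P (pairSX n @^-1` G) = (distribution P (psum n) \x distribution P X)%E G.
Proof.
move=> mG; have := @rect_joint n fset0 (fun=> setT) G (@rect_indep_all n) mG.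
rewrite big_seq_fset0 mule1 (_ : \bigcap_(k in _) _ = setT) ?setIT; last first.
  by apply/seteqP; split => w //= _ k.
move=> -> //; apply: product_measure_unique => // A B mA mB.
rewrite /= product_measure1E//; congr (_ * _)%E.
exact/esym/copies.2.
Qed.

Lemma integral_psumS n (f : E -> \bar R) :
  measurable_fun setT f -> (forall x, (0 <= f x)%E) ->
  (\int[P]_w f (psum n.+1 w) =
   \int[distribution P (psum n)]_s \int[distribution P X]_x f (vadd s x))%E.
Proof.
move=> mf f0.
have mF : measurable_fun setT (fun z : E * E => f (vadd z.1 z.2)).
  by apply: (measurableT_comp mf); exact: measurable_vadd.
rewrite -(@fubini_tonelli1 _ _ _ _ _ _ _ (fun z : E * E => f (vadd z.1 z.2)))//.
transitivity (\int[pushforward P (pairSX n)]_z f (vadd z.1 z.2))%E.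
  rewrite ge0_integral_pushforward//.
  by apply: eq_integral => w _; rewrite /= psumS.
by apply: eq_measure_integral => G mG _; exact: joint_law.
Qed.

End partial_sums.

Definition tilt {R : realType} {d : nat} (y x : euclidean R d) : R := expR (dotp y x).

Section tilted_sums.
Context d0 {T : measurableType d0} {R : realType} (P : probability T R) {d : nat}.
Notation E := (euclidean R d).
Variables (X : {RV P >-> E}) (Xs : nat -> {RV P >-> E}).
Hypothesis copies : independent_copies P X Xs.

Let mu : {sigma_finite_measure set E -> \bar R} := distribution P X.
Let nu n : {sigma_finite_measure set E -> \bar R} := distribution P (psum Xs n).

Lemma tilt_ge0 (y x : E) : 0 <= tilt y x. Proof. exact: expR_ge0. Qed.

Lemma measurable_tilt (y : E) : measurable_fun setT (tilt y).
Proof.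
apply: (@measurableT_comp _ _ _ _ _ _ (@expR R)) => //; exact: measurable_dotp.
Qed.

Lemma tiltD (y s x : E) : tilt y (vadd s x) = tilt y s * tilt y x.
Proof. by rewrite /tilt dotpDr expRD. Qed.

Lemma Rintegral_psumS n (f g k : E -> R) : measurable_fun setT f ->
  (nu n).-integrable setT (EFin \o g) -> mu.-integrable setT (EFin \o k) ->
  (forall s x, `|f (vadd s x)| <= g s * k x) ->
  \int[nu n.+1]_x f x = \int[nu n]_s \int[mu]_x f (vadd s x).
Proof.
move=> mf ig ik fgk.
pose F (z : E * E) := f (vadd z.1 z.2).
have mF : measurable_fun setT F.
  by apply: (measurableT_comp mf); exact: measurable_vadd.
have iF := dom_integrable mF ig ik fgk.
have mp : measurable_fun setT (fun w => (psum Xs n w, Xs n w) : E * E).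
  apply: measurable_fun_pair; first exact: measurable_psum.
  exact: (@measurable_funPT _ _ _ _ (Xs n)).
pose pf := measure_function_pushforward__canonical__measure_function_Measure P mp.
have pfE (A : set (E * E)) : measurable A -> (nu n \x mu)%E A = pf A.
  by move=> mA; exact/esym/(joint_law copies).
have iF' : pf.-integrable setT (EFin \o F).
  apply/integrableP; split; first exact/measurable_EFinP.
  rewrite (eq_measure_integral (nu n \x mu)%E); last by move=> A mA _; exact/esym/pfE.
  by case/integrableP : iF.
have iPF : P.-integrable setT (EFin \o (fun w => f (psum Xs n.+1 w))).
  apply/integrableP; split.
    apply/measurable_EFinP; apply: (measurableT_comp mf); exact: measurable_psum.
  move/integrableP : iF' => [_]; rewrite ge0_integral_pushforward//.
    by under eq_integral do rewrite /F /= -psumS.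
  by apply: measurableT_comp => //; exact/measurable_EFinP.
rewrite -(Rintegral_prod1 mF ig ik fgk) /Rintegral; congr fine.
rewrite integral_distribution//; last exact/measurable_EFinP.
rewrite [RHS](eq_measure_integral pf); last by move=> A mA _; exact: pfE.
have iPF' : P.-integrable setT ((EFin \o F) \o (fun w => (psum Xs n w, Xs n w))).
  by apply: eq_integrable iPF => // w _; rewrite /F /= psumS.
rewrite integral_pushforward//; [|exact/measurable_EFinP].
by apply: eq_integral => w _; rewrite /F /= psumS.
Qed.

Variable y : E.
Hypothesis iy : mu.-integrable setT (EFin \o tilt y).

Let mgf : R := \int[mu]_x tilt y x.

Lemma integral_tilt_psum n :
  (\int[nu n]_x (tilt y x)%:E = (mgf ^+ n)%:E)%E.
Proof.
have mt : measurable_fun setT (fun x => (tilt y x)%:E).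
  by apply/measurable_EFinP; exact: measurable_tilt.
have mgfE : (mgf%:E = \int[mu]_x (tilt y x)%:E)%E.
  by rewrite /mgf /Rintegral fineK// integrable_fin_num.
elim: n => [|n IH].
  rewrite ge0_integral_distribution//; last by move=> x; rewrite lee_fin tilt_ge0.
  rewrite (eq_integral (cst 1%E)) ?integral_cst//.
    have PT : P setT = 1%E by exact: probability_setT.
    by rewrite mul1e expr0; exact: PT.
  by move=> w _ /=; rewrite psum0 /tilt dotp0r expR0.
rewrite ge0_integral_distribution//; last by move=> x; rewrite lee_fin tilt_ge0.
etransitivity.
  by apply: (integral_psumS copies n mt) => x; rewrite lee_fin tilt_ge0.
rewrite exprSr EFinM -IH mgfE -ge0_integralZr//; last 2 first.
- by move=> x _; rewrite lee_fin tilt_ge0.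
- by apply: integral_ge0 => x _; rewrite lee_fin tilt_ge0.
apply: eq_integral => s _; rewrite -ge0_integralZl//; last 2 first.
- by move=> x _; rewrite lee_fin tilt_ge0.
- by rewrite lee_fin tilt_ge0.
by apply: eq_integral => x _; rewrite tiltD EFinM.
Qed.

Lemma integrable_tilt_psum n : (nu n).-integrable setT (EFin \o tilt y).
Proof.
apply/integrableP; split; first by apply/measurable_EFinP; exact: measurable_tilt.
under eq_integral do rewrite /= ger0_norm ?tilt_ge0//.
by rewrite integral_tilt_psum ltry.
Qed.

(** The addition formulas for cosine and sine stand for the multiplicativity
    of the complex exponential. *)
Lemma fcossin_psumS n s :
  fcos (nu n.+1) (tilt y) s = fcos (nu n) (tilt y) s * fcos mu (tilt y) s -
                              fsin (nu n) (tilt y) s * fsin mu (tilt y) s /\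
  fsin (nu n.+1) (tilt y) s = fsin (nu n) (tilt y) s * fcos mu (tilt y) s +
                              fcos (nu n) (tilt y) s * fsin mu (tilt y) s.
Proof.
have t0 := @tilt_ge0 y.
have ic := integrable_fcos t0 iy s; have isn := integrable_fsin t0 iy s.
have inc := integrable_fcos t0 (integrable_tilt_psum n) s.
have ins := integrable_fsin t0 (integrable_tilt_psum n) s.
have mt := measurable_tilt y.
have md : measurable_fun setT (fun x => dotp s x) by exact: measurable_dotp.
pose c := fcos mu (tilt y) s; pose b := fsin mu (tilt y) s.
split.
- rewrite /fcos (@Rintegral_psumS n _ (tilt y) (tilt y)); last 4 first.
  + by apply: measurable_funM => //; exact: measurable_cos_comp.
  + exact: integrable_tilt_psum.
  + exact: iy.
  + by move=> u x; rewrite tiltD norm_mul_cos// mulr_ge0.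
  transitivity (\int[nu n]_u (tilt y u * cos (dotp s u) * c - tilt y u * sin (dotp s u) * b)).
    apply: eq_Rintegral => u _.
    transitivity (\int[mu]_x ((tilt y u * cos (dotp s u)) * (tilt y x * cos (dotp s x)) -
       (tilt y u * sin (dotp s u)) * (tilt y x * sin (dotp s x)))).
      by apply: eq_Rintegral => x _; rewrite tiltD dotpDr cosD; ring.
    rewrite (RintegralB measurableT (integrableZl measurableT _ ic) (integrableZl measurableT _ isn)).
    by rewrite (RintegralZl _ measurableT ic) (RintegralZl _ measurableT isn).
  rewrite (RintegralB measurableT (integrableZr measurableT c inc) (integrableZr measurableT b ins)).
  by rewrite (RintegralZr _ measurableT inc) (RintegralZr _ measurableT ins).
- rewrite {1}/fsin (@Rintegral_psumS n _ (tilt y) (tilt y)); last 4 first.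
  + by apply: measurable_funM => //; exact: measurable_sin_comp.
  + exact: integrable_tilt_psum.
  + exact: iy.
  + by move=> u x; rewrite tiltD norm_mul_sin// mulr_ge0.
  transitivity (\int[nu n]_u (tilt y u * sin (dotp s u) * c + tilt y u * cos (dotp s u) * b)).
    apply: eq_Rintegral => u _.
    transitivity (\int[mu]_x ((tilt y u * sin (dotp s u)) * (tilt y x * cos (dotp s x)) +
       (tilt y u * cos (dotp s u)) * (tilt y x * sin (dotp s x)))).
      by apply: eq_Rintegral => x _; rewrite tiltD dotpDr sinD; ring.
    rewrite (RintegralD measurableT (integrableZl measurableT _ ic) (integrableZl measurableT _ isn)).
    by rewrite (RintegralZl _ measurableT ic) (RintegralZl _ measurableT isn).
  rewrite (RintegralD measurableT (integrableZr measurableT c ins) (integrableZr measurableT b inc)).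
  by rewrite (RintegralZr _ measurableT ins) (RintegralZr _ measurableT inc).
Qed.

Lemma fcossin_psum0 s :
  fcos (nu 0) (tilt y) s = 1 /\ fsin (nu 0) (tilt y) s = 0.
Proof.
have t0 := @tilt_ge0 y.
have PT : P setT = 1%E by exact: probability_setT.
have Pc (c : \bar R) : (\int[P]_w (cst c w) = c)%E.
  by rewrite integral_cst// -[RHS]mule1; congr (_ * _)%E; exact: PT.
have H (f : E -> R) : measurable_fun setT f ->
    (nu 0).-integrable setT (EFin \o f) -> \int[nu 0]_x f x = f vzero.
  move=> mf jf; rewrite /Rintegral integral_distribution//; last 2 first.
  - exact/measurable_EFinP.
  - apply/integrableP; split.
      by apply/measurable_EFinP; apply: (measurableT_comp mf); exact: measurable_psum.
    rewrite (eq_integral (cst `|f vzero|%:E)) ?Pc ?ltry//.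
    by move=> w _ /=; rewrite psum0.
  rewrite (eq_integral (cst (f vzero)%:E)) ?Pc//.
  by move=> w _ /=; rewrite psum0.
have md : measurable_fun setT (fun x => dotp s x) by exact: measurable_dotp.
have mt := measurable_tilt y.
rewrite /fcos /fsin !H.
- by rewrite /tilt !dotp0r cos0 sin0 expR0 mulr1 mulr0.
- by apply: measurable_funM => //; exact: measurable_sin_comp.
- exact: (integrable_fsin t0 (integrable_tilt_psum 0) s).
- by apply: measurable_funM => //; exact: measurable_cos_comp.
- exact: (integrable_fcos t0 (integrable_tilt_psum 0) s).
Qed.

(** The Fourier transform of a convolution is a product, and moduli multiply
    because (a c - b e)^2 + (b c + a e)^2 = (a^2 + b^2) (c^2 + e^2). *)
Lemma famp_psum n s : famp (nu n) (tilt y) s = famp mu (tilt y) s ^+ n.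
Proof.
apply/eqP; rewrite -(@eqrXn2 _ 2) ?famp_ge0 ?exprn_ge0 ?famp_ge0//.
apply/eqP; rewrite -exprM mulnC exprM !famp_sqr.
elim: n => [|n IH].
  by have [-> ->] := fcossin_psum0 s; rewrite expr0 expr1n expr0n addr0.
have [-> ->] := fcossin_psumS n s.
by rewrite [in RHS]exprSr -IH; ring.
Qed.

End tilted_sums.

(** * Tails of integrals and bounds on the cosine *)

Section tail.
Context d0 {T : measurableType d0} {R : realType}.
Variables (m : {measure set T -> \bar R}) (D : (set T)^nat) (f : T -> R).
Hypotheses (mD : forall k, measurable (D k)) (ndD : nondecreasing_seq D)
  (UD : \bigcup_k D k = setT) (f0 : forall x, 0 <= f x)
  (jf : m.-integrable setT (EFin \o f)).

Lemma Rintegral_tail_small (e : R) : 0 < e ->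
  exists k, \int[m]_(x in ~` D k) f x < e.
Proof.
move=> e0.
have H : \int[m]_(x in D k) f x @[k --> \oo] --> \int[m]_x f x.
  apply: fine_cvg; rewrite /Rintegral fineK ?integrable_fin_num//.
  rewrite -UD; apply: ge0_nondecreasing_set_cvg_integral => //.
  - by move=> k; apply: measurable_funTS; exact: measurable_int jf.
  - by move=> k x _; rewrite lee_fin.
have /cvgrPdist_lt/(_ _ e0)[k _ /(_ k (leqnn k)) /=] := H.
have -> : \int[m]_x f x = \int[m]_(x in D k) f x + \int[m]_(x in ~` D k) f x.
  rewrite -(setUv (D k)) Rintegral_setU//.
  - exact: measurableC.
  - by rewrite setUv.
  - by apply/disj_setPS => x [].
rewrite addrAC subrr add0r => h; exists k.
by apply: le_lt_trans h; rewrite ler_norm.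
Qed.

End tail.

Section trig_bounds.
Context {R : realType}.
Implicit Types a b : R.

Lemma one_sub_cos a : 1 - cos a = 2 * sin (a / 2) ^+ 2.
Proof.
rewrite [in LHS](splitr a) cosD -!expr2; have := cos2Dsin2 (a / 2); lra.
Qed.

Lemma one_sub_cos_ge0 a : 0 <= 1 - cos a.
Proof. by rewrite subr_ge0 cos_le1. Qed.

Lemma one_sub_cos_double a : 1 - cos (2 * a) <= 4 * (1 - cos a).
Proof.
have -> : 2 * a = a + a by lra.
rewrite cosD -!expr2; have := cos2Dsin2 a; have := sqr_ge0 (1 - cos a).
by rewrite sqrrB expr1n; lra.
Qed.

Lemma cos_lipschitz a b : `|cos a - cos b| <= `|a - b|.
Proof.
wlog ab : a b / a <= b.
  move=> H; have [ab|/ltW ba] := leP a b; first exact: H.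
  by rewrite distrC (distrC a); exact: H.
have [->|nab] := eqVneq a b; first by rewrite !subrr.
have ab' : a < b by rewrite lt_neqAle nab ab.
have [c _ cE] : exists2 c, c \in `]a, b[ & cos b - cos a = - sin c * (b - a).
  apply: (@MVT _ cos (fun x => - sin x)) => //.
  by apply: continuous_subspaceT; exact: continuous_cos.
rewrite distrC cE normrM normrN (distrC a) ler_piMl// ler_norml.
by rewrite sin_geN1 sin_le1.
Qed.

Lemma sin_mvt (t : R) : 0 < t -> exists2 c, 0 < c < t & sin t = cos c * t.
Proof.
move=> t0.
have [c ct cE] : exists2 c, c \in `]0, t[ & sin t - sin 0 = cos c * (t - 0).
  apply: (@MVT _ sin cos) => //.
  by apply: continuous_subspaceT; exact: continuous_sin.
by exists c; [move: ct; rewrite in_itv|rewrite sin0 !subr0 in cE].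
Qed.

Lemma cos_ge (t : R) : 1 - t ^+ 2 / 2 <= cos t.
Proof.
wlog t0 : t / 0 <= t.
  move=> H; have [/H//|t0] := leP 0 t.
  by rewrite -cosN -sqrrN; apply: H; rewrite oppr_ge0 ltW.
rewrite lerBlDr -lerBlDl one_sub_cos.
have [->|tN0] := eqVneq t 0; first by rewrite mul0r sin0 expr0n/= mulr0 mul0r.
have t2 : 0 < t / 2 by rewrite divr_gt0// lt_neqAle eq_sym tN0.
have [c _ ->] := sin_mvt t2.
rewrite exprMn; have : cos c ^+ 2 <= 1.
  by rewrite -(cos2Dsin2 c) lerDl sqr_ge0.
by have := sqr_ge0 (t / 2); rewrite expr_div_n; nra.
Qed.

(** By the mean value theorem sin (t / 2) = cos c * t / 2 for some c in (0, t
    / 2), and cos c ^+ 2 >= 1 - e. The constant 1/2 cannot be sacrificed: it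
    determines the Gaussian in local_bound. *)
Lemma one_sub_cos_ge (e t : R) : 0 < e < 1 -> `|t| <= e ->
  (1 - e) * t ^+ 2 / 2 <= 1 - cos t.
Proof.
move=> /andP[e0 e1]; wlog t0 : t / 0 <= t.
  move=> H; have [/H//|t0] := leP 0 t; rewrite -normrN => te.
  by rewrite -cosN -sqrrN; apply: H => //; rewrite oppr_ge0 ltW.
rewrite ger0_norm// => te; rewrite one_sub_cos.
have [->|tN0] := eqVneq t 0.
  by rewrite mul0r sin0 expr0n/= !mulr0 mul0r.
have t2 : 0 < t / 2 by rewrite divr_gt0// lt_neqAle eq_sym tN0.
have [c /andP[c0 ct] ->] := sin_mvt t2.
have cc : 1 - e ^+ 2 / 2 <= cos c.
  apply: le_trans (cos_ge c); rewrite lerB// ler_wpM2r ?invr_ge0//.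
  by rewrite ler_pXn2r ?nnegrE ?ltW// (le_lt_trans (ltW ct))//; lra.
have c1 : 1 - e <= cos c ^+ 2.
  have : (1 - e ^+ 2 / 2) ^+ 2 <= cos c ^+ 2.
    by rewrite ler_pXn2r ?nnegrE//; nra.
  by nra.
by rewrite exprMn expr_div_n; have := sqr_ge0 t; nra.
Qed.

End trig_bounds.

(** The arithmetic of gap_near0, where a = |s|^2 and I1, I2 are the integrals
    of dotp s (pdiff z) ^+ 2 inside and outside trunc K. *)
Lemma near0_arith (R : realType) (eta a I1 I2 : R) : 0 < eta -> eta < 1 -> 0 <= a ->
  I1 + I2 = 2 * a -> I2 <= a * (eta / 2) ->
  (1 - eta) * a <= (1 - eta / 2) / 2 * I1.
Proof.
move=> e0 e1 a0 h1 h2; have h : (2 - eta / 2) * a <= I1 by lra.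
apply: (@le_trans _ _ ((1 - eta / 2) / 2 * ((2 - eta / 2) * a))).
  have := mulr_ge0 (mulr_ge0 (ltW e0) (ltW e0)) a0; nra.
by rewrite ler_wpM2l//; lra.
Qed.

(** * The cosine gap of two independent copies *)

Section moments.
Context {R : realType} {d : nat}.
Notation E := (euclidean R d).
Variable mu : {sigma_finite_measure set E -> \bar R}.
Hypothesis muT : mu setT = 1%E.
Hypothesis i2 : forall i, mu.-integrable setT (EFin \o (fun x : E => tnth x i ^+ 2)).
Hypothesis mean : forall i, \int[mu]_x (tnth x i : R) = 0.
Hypothesis cov : forall i j, \int[mu]_x (tnth x i * tnth x j : R) = (i == j)%:R.

Let muTm : (mu : {measure set E -> \bar R}) setT = 1%E.
Proof. exact: muT. Qed.

Lemma integrable_cst1 (c : R) : mu.-integrable setT (EFin \o cst c).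
Proof.
apply: measurable_bounded_integrable => //; first by rewrite muTm ltry.
by exists `|c|; split => // M cM x _; rewrite /= ltW.
Qed.

Lemma measurable_tnthR i : measurable_fun setT (fun x : E => tnth x i : R).
Proof. exact: measurable_tnth. Qed.

Lemma Rintegral_sum_seq d1 (U : measurableType d1) (m : {measure set U -> \bar R})
    I (r : seq I) (f : I -> U -> R) :
  (forall i, m.-integrable setT (EFin \o f i)) ->
  m.-integrable setT (EFin \o (fun x => \sum_(i <- r) f i x)) /\
  \int[m]_x (\sum_(i <- r) f i x) = \sum_(i <- r) \int[m]_x f i x.
Proof.
move=> jf; elim: r => [|i r [IH1 IH2]].
  split.
    rewrite (_ : _ \o _ = cst 0%E); first exact: integrable0.
    by apply/funext => x; rewrite /= big_nil.
  under eq_Rintegral do rewrite big_nil.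
  by rewrite big_nil /Rintegral integral0.
have E1 : (fun x => \sum_(j <- i :: r) f j x) = (fun x => f i x + \sum_(j <- r) f j x).
  by apply/funext => x; rewrite big_cons.
split; first by rewrite E1; exact: (integrableD measurableT (jf i) IH1).
by rewrite E1 big_cons (RintegralD measurableT (jf i) IH1) IH2.
Qed.

Lemma integrable_coord2 i j : mu.-integrable setT (EFin \o (fun x : E => tnth x i * tnth x j)).
Proof.
have := integrableD measurableT (i2 i) (i2 j).
apply: (le_integrable measurableT).
  by apply/measurable_EFinP; apply: measurable_funM; exact: measurable_tnthR.
move=> x _; rewrite /= lee_fin [leRHS]ger0_norm ?addr_ge0 ?sqr_ge0//.
rewrite ler_norml; apply/andP; have := sqr_ge0 (tnth x i - tnth x j).
have := sqr_ge0 (tnth x i + tnth x j); have := sqr_ge0 (tnth x i); have := sqr_ge0 (tnth x j).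
by rewrite sqrrD sqrrB; split; lra.
Qed.

Lemma integrable_coord i : mu.-integrable setT (EFin \o (fun x : E => tnth x i)).
Proof.
have := integrableD measurableT (i2 i) (integrable_cst1 1).
apply: (le_integrable measurableT).
  by apply/measurable_EFinP; exact: measurable_tnthR.
move=> x _; rewrite /= lee_fin [leRHS]ger0_norm ?addr_ge0 ?sqr_ge0//.
rewrite ler_norml; apply/andP; have := sqr_ge0 (tnth x i - 1).
have := sqr_ge0 (tnth x i + 1); have := sqr_ge0 (tnth x i).
by rewrite sqrrD sqrrB; split; lra.
Qed.

Lemma integrable_dotp s : mu.-integrable setT (EFin \o dotp s) /\
  \int[mu]_x dotp s x = 0.
Proof.
have jf i : mu.-integrable setT (EFin \o (fun x : E => tnth s i * tnth x i)).
  exact: (integrableZl measurableT (tnth s i) (integrable_coord i)).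
have [h1 h2] := Rintegral_sum_seq (index_enum 'I_d) jf.
split; first exact: h1.
rewrite /dotp h2 big1// => i _.
by rewrite (RintegralZl _ measurableT (integrable_coord i)) mean mulr0.
Qed.

Lemma integrable_dotp2 s : mu.-integrable setT (EFin \o (fun x => dotp s x ^+ 2)) /\
  \int[mu]_x (dotp s x ^+ 2) = dotp s s.
Proof.
pose f (ij : 'I_d * 'I_d) (x : E) := (tnth s ij.1 * tnth s ij.2) * (tnth x ij.1 * tnth x ij.2).
have jf ij : mu.-integrable setT (EFin \o f ij).
  exact: (integrableZl measurableT _ (integrable_coord2 ij.1 ij.2)).
have [h1 h2] := Rintegral_sum_seq (index_enum ('I_d * 'I_d)%type) jf.
have E1 : (fun x => dotp s x ^+ 2) = (fun x => \sum_(ij <- index_enum ('I_d * 'I_d)%type) f ij x).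
  apply/funext => x; rewrite expr2 /dotp big_distrl/=.
  rewrite [RHS](_ : _ = \sum_(ij : 'I_d * 'I_d) f (ij.1, ij.2) x); last first.
    by apply: eq_bigr => -[].
  rewrite -(pair_bigA _ (fun i j => f (i, j) x)); apply: eq_bigr => i _ /=.
  by rewrite big_distrr/=; apply: eq_bigr => j _; rewrite /f /=; ring.
rewrite E1; split; first exact: h1.
rewrite h2 [LHS](_ : _ = \sum_(ij : 'I_d * 'I_d) (tnth s ij.1 * tnth s ij.2 * (ij.1 == ij.2)%:R)); last first.
  apply: eq_bigr => ij _.
  by rewrite (RintegralZl _ measurableT (integrable_coord2 ij.1 ij.2)) cov.
rewrite -(pair_bigA _ (fun i j => tnth s i * tnth s j * (i == j)%:R)) /=.
apply: eq_bigr => i _; rewrite (bigD1 i)//= eqxx mulr1 big1 ?addr0// => j ji.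
by rewrite eq_sym (negbTE ji) mulr0.
Qed.

Lemma integrable_enorm2 : mu.-integrable setT (EFin \o (fun x : E => enorm x ^+ 2)).
Proof.
have [h1 _] := Rintegral_sum_seq (index_enum 'I_d) i2.
apply: eq_integrable h1 => // x _ /=; rewrite enorm_sqr /dotp.
by congr EFin; apply: eq_bigr => i _; rewrite expr2.
Qed.

Notation M := (mu \x mu)%E.
Definition pdiff (z : E * E) : E := vsub z.1 z.2.

Lemma measurable_diff : measurable_fun setT pdiff.
Proof. exact: measurable_vsub. Qed.

Lemma prodT : M setT = 1%E.
Proof.
by rewrite -setXTT product_measure1E// muTm mul1e; exact: muT.
Qed.

Let prod_lty : (M setT < +oo)%E.
Proof. by rewrite prodT ltry. Qed.

Let sq_dom (a b : R) : `|(a - b) ^+ 2| <= (2 * (1 + a ^+ 2)) * (1 + b ^+ 2).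
Proof.
rewrite ger0_norm ?sqr_ge0//; have := sqr_ge0 (a + b); rewrite sqrrB sqrrD.
have := sqr_ge0 a; have := sqr_ge0 b; nra.
Qed.

(** The difference of two independent centred copies has twice their
    covariance. *)
Lemma integral_diff2 s : M.-integrable setT (EFin \o (fun z => dotp s (pdiff z) ^+ 2)) /\
  \int[M]_z (dotp s (pdiff z) ^+ 2) = 2 * dotp s s.
Proof.
have [j1 I1] := integrable_dotp s; have [j2 I2] := integrable_dotp2 s.
have jb : mu.-integrable setT (EFin \o (fun x => 1 + dotp s x ^+ 2)).
  exact: (integrableD measurableT (integrable_cst1 1) j2).
have ja : mu.-integrable setT (EFin \o (fun x => 2 * (1 + dotp s x ^+ 2))).
  exact: (integrableZl measurableT 2 jb).
have mf : measurable_fun setT (fun z => dotp s (pdiff z) ^+ 2).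
  by apply: measurable_funX; apply: measurable_dotp => //; exact: measurable_diff.
have dom x y : `|dotp s (pdiff (x, y)) ^+ 2| <= 2 * (1 + dotp s x ^+ 2) * (1 + dotp s y ^+ 2).
  by rewrite /pdiff /= dotpBr; exact: sq_dom.
split; first exact: (dom_integrable mf ja jb dom).
rewrite (Rintegral_prod1 mf ja jb dom).
transitivity (\int[mu]_x (dotp s x ^+ 2 + dotp s s)).
  apply: eq_Rintegral => x _.
  transitivity (\int[mu]_y ((dotp s x ^+ 2 - 2 * dotp s x * dotp s y) + dotp s y ^+ 2)).
    by apply: eq_Rintegral => y _; rewrite /pdiff /= dotpBr; ring.
  have jc := integrable_cst1 (dotp s x ^+ 2).
  have jd := integrableZl measurableT (2 * dotp s x) j1.
  rewrite (RintegralD measurableT (integrableB measurableT jc jd) j2) I2.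
  rewrite (RintegralB measurableT jc jd) (RintegralZl _ measurableT j1) I1 mulr0 subr0.
  by rewrite Rintegral_cst// muTm mulr1.
rewrite (RintegralD measurableT j2 (integrable_cst1 _)) I2 Rintegral_cst// muTm mulr1.
by rewrite -/(dotp s s) -mulr2n mulr_natl.
Qed.

Lemma integrable_diff_norm2 :
  M.-integrable setT (EFin \o (fun z => enorm (pdiff z) ^+ 2)).
Proof.
have jb : mu.-integrable setT (EFin \o (fun x : E => 1 + enorm x ^+ 2)).
  exact: (integrableD measurableT (integrable_cst1 1) integrable_enorm2).
have ja : mu.-integrable setT (EFin \o (fun x : E => 2 * (1 + enorm x ^+ 2))).
  exact: (integrableZl measurableT 2 jb).
apply: (dom_integrable _ ja jb).
  by apply: measurable_funX; apply: measurable_enorm; exact: measurable_diff.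
move=> x y; rewrite /pdiff /= ger0_norm ?sqr_ge0//.
have h : enorm (vsub x y) ^+ 2 <= (enorm x + enorm y) ^+ 2.
  by rewrite ler_pXn2r ?nnegrE ?addr_ge0 ?enorm_ge0// enormB_le.
apply: le_trans h _; rewrite sqrrD.
have := sqr_ge0 (enorm x - enorm y); rewrite sqrrB.
have := sqr_ge0 (enorm x); have := sqr_ge0 (enorm y); nra.
Qed.

Lemma Mcst (c : R) : M.-integrable setT (EFin \o cst c).
Proof.
apply: measurable_bounded_integrable => //.
by exists `|c|; split => // N cN x _; rewrite /= ltW.
Qed.

Lemma integrable_diff_norm :
  M.-integrable setT (EFin \o (fun z => enorm (pdiff z))).
Proof.
have := integrableD measurableT integrable_diff_norm2 (Mcst 1).
apply: (le_integrable measurableT).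
  by apply/measurable_EFinP; apply: measurable_enorm; exact: measurable_diff.
move=> z _; rewrite /= lee_fin [leRHS]ger0_norm ?addr_ge0 ?sqr_ge0// ger0_norm ?enorm_ge0//.
by have := sqr_ge0 (enorm (pdiff z) - 1); rewrite sqrrB; have := sqr_ge0 (enorm (pdiff z)); lra.
Qed.

Lemma measurable_cos_diff s : measurable_fun setT (fun z => cos (dotp s (pdiff z))).
Proof. by apply: measurable_cos_comp; apply: measurable_dotp => //; exact: measurable_diff. Qed.

Lemma integrable_gap s :
  M.-integrable setT (EFin \o (fun z => 1 - cos (dotp s (pdiff z)))).
Proof.
apply: measurable_bounded_integrable => //.
  by apply: measurable_funB => //; exact: measurable_cos_diff.
exists 2; split => // N N2 z _; rewrite /= ger0_norm ?one_sub_cos_ge0//.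
by apply: le_trans (ltW N2); rewrite lerBlDr -lerBlDl; have := cos_geN1 (dotp s (pdiff z)); lra.
Qed.

(** Both copies are confined to the same ball, so that the tilting factor is
    bounded below on trunc K, see famp_gap. *)
Definition trunc (K : nat) : set (E * E) :=
  [set z | enorm z.1 <= K%:R /\ enorm z.2 <= K%:R].

Lemma measurable_trunc K : measurable (trunc K).
Proof.
have m1 (f : E * E -> E) : measurable_fun setT f -> measurable [set z | enorm (f z) <= K%:R].
  move=> mf; rewrite (_ : [set _ | _] = (fun z => enorm (f z)) @^-1` `]-oo, K%:R]).
    by rewrite -[X in measurable X]setTI; apply: measurable_enorm.
  by apply/seteqP; split => z /=; rewrite in_itv.
by apply: measurableI; exact: m1.
Qed.

Lemma nd_trunc : nondecreasing_seq trunc.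
Proof.
move=> m n mn; apply/subsetPset => z [h1 h2]; have : m%:R <= n%:R :> R by rewrite ler_nat.
by split; [apply: le_trans h1 _|apply: le_trans h2 _].
Qed.

Lemma trunc_cover : \bigcup_K trunc K = setT.
Proof.
apply/seteqP; split => // z _.
exists (maxn (Num.truncn (enorm z.1)).+1 (Num.truncn (enorm z.2)).+1) => //.
by split; [apply: (@le_trans _ _ (Num.truncn (enorm z.1)).+1%:R)|
  apply: (@le_trans _ _ (Num.truncn (enorm z.2)).+1%:R)];
  rewrite ?(ltW (truncnS_gt _))// ler_nat ?leq_maxl ?leq_maxr.
Qed.

(** Without tilting, 1 - famp ^+ 2 is the integral of 1 - cos over all pairs,
    see famp_pair; gap K is the share of the pairs in trunc K. *)
Definition gap (K : nat) (s : E) : R := \int[M]_(z in trunc K) (1 - cos (dotp s (pdiff z))).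

(** Choose K so that pairs outside trunc K contribute little to the second
    moment of the difference. Inside trunc K the argument of the cosine is
    small once s is, and one_sub_cos_ge applies. *)
Lemma gap_near0 (eta : R) : 0 < eta < 1 ->
  exists K : nat, exists2 del : R, 0 < del &
    forall s, enorm s <= del -> (1 - eta) * enorm s ^+ 2 <= gap K s.
Proof.
move=> /andP[eta0 eta1].
have eh : 0 < eta / 2 < 1 by apply/andP; split; lra.
have eta2 : 0 < eta / 2 by case/andP: eh.
have [K HK] := Rintegral_tail_small measurable_trunc nd_trunc trunc_cover
  (fun z => sqr_ge0 (enorm (pdiff z))) integrable_diff_norm2 eta2.
exists K; pose del := (eta / 2) / (2 * K%:R + 1).
have K1 : 0 < 2 * K%:R + 1 :> R by rewrite ltr_wpDl// mulr_ge0.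
have del0 : 0 < del by rewrite /del divr_gt0.
exists del => // s sdel.
have mtr := measurable_trunc K.
have [jd Id] := integral_diff2 s.
have jdK : M.-integrable (trunc K) (EFin \o (fun z => dotp s (pdiff z) ^+ 2)).
  exact: integrableS jd.
have jdC : M.-integrable (~` trunc K) (EFin \o (fun z => dotp s (pdiff z) ^+ 2)).
  by apply: integrableS jd => //; exact: measurableC.
have jnC : M.-integrable (~` trunc K) (EFin \o (fun z => enorm (pdiff z) ^+ 2)).
  by apply: integrableS integrable_diff_norm2 => //; exact: measurableC.
have split1 : \int[M]_(z in trunc K) (dotp s (pdiff z) ^+ 2) +
   \int[M]_(z in ~` trunc K) (dotp s (pdiff z) ^+ 2) = 2 * enorm s ^+ 2.
  rewrite enorm_sqr -Id -(setUv (trunc K)) Rintegral_setU//.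
  - exact: measurableC.
  - by rewrite setUv.
  - by apply/disj_setPS => x [].
have tailb : \int[M]_(z in ~` trunc K) (dotp s (pdiff z) ^+ 2) <= enorm s ^+ 2 * (eta / 2).
  apply: (@le_trans _ _ (\int[M]_(z in ~` trunc K) (enorm s ^+ 2 * enorm (pdiff z) ^+ 2))).
    apply: le_Rintegral => //; first exact: measurableC.
      exact: (integrableZl (measurableC mtr) _ jnC).
    move=> z _; rewrite -exprMn -[leLHS]real_normK ?num_real//.
    by rewrite ler_pXn2r ?nnegrE ?mulr_ge0 ?enorm_ge0// cauchy_schwarz.
  rewrite (RintegralZl _ (measurableC mtr) jnC) ler_wpM2l ?sqr_ge0//.
  exact: ltW.
have gapb : (1 - eta / 2) / 2 * \int[M]_(z in trunc K) (dotp s (pdiff z) ^+ 2) <= gap K s.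
  rewrite -(RintegralZl _ mtr jdK); apply: le_Rintegral => //.
  - exact: (integrableZl mtr _ jdK).
  - by apply: integrableS (integrable_gap s).
  move=> z [z1 z2]; rewrite mulrAC; apply: one_sub_cos_ge => //.
  apply: le_trans (cauchy_schwarz _ _) _.
  have dz : enorm (pdiff z) <= 2 * K%:R + 1.
    apply: le_trans (enormB_le _ _) _; apply: le_trans (lerD z1 z2) _.
    by rewrite mulr_natl mulr2n lerDl.
  apply: (@le_trans _ _ (del * (2 * K%:R + 1))).
    by rewrite ler_pM ?enorm_ge0.
  by rewrite /del divfK// gt_eqF.
apply: le_trans gapb; apply: near0_arith split1 tailb => //; exact: sqr_ge0.
Qed.

End moments.

Section pair_formula.
Context {R : realType} {d : nat}.
Notation E := (euclidean R d).
Variable mu : {sigma_finite_measure set E -> \bar R}.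
Notation M := (mu \x mu)%E.

Section tilted.
Variable y : E.
Hypothesis iy : mu.-integrable setT (EFin \o tilt y).
Notation Ly := (\int[mu]_x tilt y x).

Definition tgap (s : E) (z : E * E) : R :=
  tilt y z.1 * tilt y z.2 * (1 - cos (dotp s (pdiff z))).

Let mtgap s : measurable_fun setT (tgap s).
Proof.
apply: measurable_funM.
  by apply: measurable_funM; apply: (measurableT_comp (measurable_tilt y)).
by apply: measurable_funB => //; exact: measurable_cos_diff.
Qed.

Let i2y : mu.-integrable setT (EFin \o (fun x => 2 * tilt y x)).
Proof. exact: (integrableZl measurableT 2 iy). Qed.

Let domt s x x' : `|tgap s (x, x')| <= (2 * tilt y x) * tilt y x'.
Proof.
rewrite /tgap /= ger0_norm ?mulr_ge0 ?tilt_ge0 ?one_sub_cos_ge0//.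
rewrite mulrC -[leRHS]mulrA ler_wpM2r ?mulr_ge0 ?tilt_ge0//.
by rewrite lerBlDr -lerBlDl; have := cos_geN1 (dotp s (pdiff (x, x'))); lra.
Qed.

Lemma integrable_tgap s : M.-integrable setT (EFin \o tgap s).
Proof. exact: (dom_integrable (mtgap s) i2y iy (domt s)). Qed.

(** Both squares are double integrals over two independent copies. *)
Lemma famp_pair s : Ly ^+ 2 - famp mu (tilt y) s ^+ 2 = \int[M]_z tgap s z.
Proof.
rewrite (Rintegral_prod1 (mtgap s) i2y iy (domt s)).
have t0 := @tilt_ge0 R d y.
have ic := integrable_fcos t0 iy s; have isn := integrable_fsin t0 iy s.
set C := fcos mu (tilt y) s; set S := fsin mu (tilt y) s.
transitivity (\int[mu]_x (tilt y x * Ly - (tilt y x * cos (dotp s x) * C + tilt y x * sin (dotp s x) * S))).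
  have j1 := integrableZr measurableT C ic; have j2 := integrableZr measurableT S isn.
  have j12 := integrableD measurableT j1 j2.
  rewrite (RintegralB measurableT (integrableZr measurableT Ly iy) j12).
  rewrite (RintegralD measurableT j1 j2) (RintegralZr _ measurableT iy).
  rewrite (RintegralZr _ measurableT ic) (RintegralZr _ measurableT isn).
  by rewrite famp_sqr !expr2.
apply: eq_Rintegral => x _.
have jx : mu.-integrable setT (EFin \o (fun x' => tilt y x' * cos (dotp s x - dotp s x'))).
  apply: (integrable_dom iy) => [|x']; last exact: norm_mul_cos.
  apply: measurable_funM; first exact: measurable_tilt.
  by apply: measurable_cos_comp; apply: measurable_funB => //; exact: measurable_dotp.
transitivity (\int[mu]_x' (tilt y x * (tilt y x' - tilt y x' * cos (dotp s x - dotp s x')))); last first.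
  by apply: eq_Rintegral => x' _; rewrite /tgap /pdiff /= dotpBr; ring.
rewrite (RintegralZl _ measurableT (integrableB measurableT iy jx)).
rewrite (RintegralB measurableT iy jx) (Rintegral_cosB t0 iy).
by rewrite -/C -/S; ring.
Qed.

(** In famp_pair drop the pairs outside trunc K, whose contribution is
    nonnegative, and bound the tilting factor inside from below by
    Cauchy--Schwarz. *)
Lemma famp_gap K s :
  famp mu (tilt y) s ^+ 2 <= Ly ^+ 2 - expR (- (2 * K%:R * enorm y)) * gap mu K s.
Proof.
rewrite lerBrDr addrC -lerBrDr famp_pair.
have mtr := @measurable_trunc R d K.
have jtr : M.-integrable (trunc K) (EFin \o tgap s).
  exact: integrableS (integrable_tgap s).
have tg0 z : 0 <= tgap s z.
  by rewrite /tgap !mulr_ge0 ?tilt_ge0 ?one_sub_cos_ge0.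
have low z : trunc K z ->
    expR (- (2 * K%:R * enorm y)) * (1 - cos (dotp s (pdiff z))) <= tgap s z.
  move=> [z1 z2]; rewrite /tgap ler_wpM2r ?one_sub_cos_ge0//.
  rewrite /tilt -expRD ler_expR.
  have h (x : E) : enorm x <= K%:R -> - (K%:R * enorm y) <= dotp y x.
    move=> xK; rewrite lerNl (le_trans (ler_norm _))// normrN.
    by rewrite (le_trans (cauchy_schwarz _ _))// mulrC ler_wpM2r ?enorm_ge0.
  have -> : - (2 * K%:R * enorm y) = - (K%:R * enorm y) + - (K%:R * enorm y).
    by ring.
  by apply: lerD; exact: h.
have jg : M.-integrable (trunc K) (EFin \o (fun z => 1 - cos (dotp s (pdiff z)))).
  have jg' : M.-integrable (trunc K) (EFin \o (fun z => expR (2 * K%:R * enorm y) * tgap s z)).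
    exact: (integrableZl mtr _ jtr).
  apply: (le_integrable mtr _ _ jg').
    apply/measurable_EFinP; apply: measurable_funTS; apply: measurable_funB => //.
    exact: measurable_cos_diff.
  move=> z Kz; rewrite /= lee_fin !ger0_norm ?one_sub_cos_ge0 ?mulr_ge0 ?expR_ge0//.
  have l := low z Kz; rewrite -(ler_pM2l (expR_gt0 (2 * K%:R * enorm y))) in l.
  by rewrite mulrA -expRD subrr expR0 mul1r in l.
apply: (@le_trans _ _ (\int[M]_(z in trunc K) tgap s z)).
  rewrite /gap -(RintegralZl _ mtr jg); apply: le_Rintegral => //.
  exact: (integrableZl mtr _ jg).
rewrite -(setUv (trunc K)) Rintegral_setU//.
- by rewrite lerDl Rintegral_ge0.
- exact: measurableC.
- by rewrite setUv; exact: integrable_tgap.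
- by apply/disj_setPS => x [].
Qed.

End tilted.
End pair_formula.

Section gap_far.
Context {R : realType} {d : nat}.
Notation E := (euclidean R d).
Variable mu : {sigma_finite_measure set E -> \bar R}.
Hypothesis muT : mu setT = 1%E.
Hypothesis i2 : forall i, mu.-integrable setT (EFin \o (fun x : E => tnth x i ^+ 2)).
Notation M := (mu \x mu)%E.

Definition fullgap (s : E) : R := \int[M]_z (1 - cos (dotp s (pdiff z))).

Let jgap s := integrable_gap muT s.

Lemma fullgap_double s : fullgap (vscale 2 s) <= 4 * fullgap s.
Proof.
rewrite /fullgap -(RintegralZl _ measurableT (jgap s)).
apply: (le_Rintegral measurableT (jgap _) (integrableZl measurableT 4 (jgap s))) => z _.
by rewrite dotpZl; exact: one_sub_cos_double.
Qed.

Let Lam : R := \int[M]_z enorm (pdiff z).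

Lemma fullgap_lipschitz s t : `|fullgap s - fullgap t| <= Lam * enorm (vsub s t).
Proof.
have jn := integrable_diff_norm muT i2.
rewrite /fullgap -(RintegralB measurableT (jgap s) (jgap t)).
have jB := integrableB measurableT (jgap s) (jgap t).
apply: le_trans (le_normr_Rintegral measurableT jB) _.
rewrite -(RintegralZr _ measurableT jn); apply: le_Rintegral => //.
- exact: integrable_norm.
- exact: (integrableZr measurableT _ jn).
- move=> z _.
  have -> : 1 - cos (dotp s (pdiff z)) - (1 - cos (dotp t (pdiff z))) =
    cos (dotp t (pdiff z)) - cos (dotp s (pdiff z)) by ring.
  rewrite distrC; apply: le_trans (cos_lipschitz _ _) _.
  by rewrite -dotpBl mulrC cauchy_schwarz.
Qed.

Lemma fullgap_tilt0 s : famp mu (tilt vzero) s ^+ 2 = 1 - fullgap s.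
Proof.
have i0 : mu.-integrable setT (EFin \o tilt (@vzero R d)).
  apply: eq_integrable (integrable_cst1 muT 1) => // x _.
  by rewrite /= /tilt dotp0l expR0.
have := famp_pair i0 s.
have -> : \int[mu]_x tilt vzero x = 1.
  rewrite (@eq_Rintegral _ _ _ mu setT (cst 1)); last first.
    by move=> x _; rewrite /tilt dotp0l expR0.
  have m1 : (mu : {measure set E -> \bar R}) setT = 1%E by exact: muT.
  by rewrite Rintegral_cst// m1 mulr1.
rewrite expr1n => h; have -> : fullgap s = \int[M]_z tgap vzero s z.
  by apply: eq_Rintegral => z _; rewrite /tgap /tilt !dotp0l expR0 !mul1r.
by rewrite -h opprB addrC subrK.
Qed.

Variable N : nat.
Hypothesis intN : (\int[leb R d]_s ((1 - fullgap s) ^+ N)%:E < +oo)%E.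

Let W s := 1 - fullgap s.
Let W0 s : 0 <= W s.
Proof. by rewrite /W -fullgap_tilt0 sqr_ge0. Qed.

Let mW : measurable_fun setT W.
Proof.
rewrite (_ : W = fun s => famp mu (tilt vzero) s ^+ 2).
  apply: measurable_funX; apply: measurable_famp => [x|]; first exact: tilt_ge0.
  apply: eq_integrable (integrable_cst1 muT 1) => // x _.
  by rewrite /= /tilt dotp0l expR0.
by apply/funext => s; rewrite fullgap_tilt0.
Qed.

Let jW : (leb R d).-integrable setT (EFin \o (fun s => W s ^+ N)).
Proof.
apply/integrableP; split; first by apply/measurable_EFinP; exact: measurable_funX.
by under eq_integral do rewrite /= ger0_norm ?exprn_ge0//.
Qed.

Let Lam0 : 0 <= Lam.
Proof. by apply: Rintegral_ge0 => z _; exact: enorm_ge0. Qed.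

(** Since fullgap is Lipschitz, each point s with fullgap s < 1/2 is the
    centre of a cube of fixed size on which 1 - fullgap is at least 1/4; far
    out, this exceeds the tail of a convergent integral. *)
Lemma fullgap_infinity : exists A : R, forall s, A <= enorm s -> 1 / 2 <= fullgap s.
Proof.
pose r : R := (4 * (Lam + 1) * (d%:R + 1))^-1.
have den0 : 0 < 4 * (Lam + 1) * (d%:R + 1).
  by rewrite !mulr_gt0// ltr_wpDl// Lam0.
have r0 : 0 < r by rewrite invr_gt0.
pose c : R := (4^-1) ^+ N * (2 * r) ^+ d.
have c0 : 0 < c by rewrite mulr_gt0// exprn_gt0// mulr_gt0.
pose D k : set E := [set s | enorm s <= k%:R].
have mD k : measurable (D k).
  rewrite (_ : D k = (@enorm R d) @^-1` `]-oo, k%:R]).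
    by rewrite -[X in measurable X]setTI; apply: measurable_enorm.
  by apply/seteqP; split => z /=; rewrite in_itv.
have ndD : nondecreasing_seq D.
  move=> m n mn; apply/subsetPset => s; rewrite /D /= => h.
  by apply: le_trans h _; rewrite ler_nat.
have UD : \bigcup_k D k = setT.
  apply/seteqP; split => // s _; exists (Num.truncn (enorm s)).+1 => //.
  by rewrite /D /= ltW// truncnS_gt.
have [k Hk] := Rintegral_tail_small mD ndD UD (fun s => exprn_ge0 N (W0 s)) jW c0.
exists (k%:R + d%:R * r + 1) => s sA; rewrite leNgt; apply/negP => gs.
have near_s t : cube s r t -> enorm (vsub t s) <= d%:R * r.
  move=> ct; apply: enorm_le_coord; first exact: ltW.
  move=> i; rewrite tnth_vsub; have := ct i; rewrite in_itv/= ler_distl.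
  by move=> /andP[-> ->].
(* the cube is so small that fullgap varies by at most 1/4 over it *)
have dr4 : (Lam + 1) * (d%:R * r) <= 1 / 4.
  apply: (@le_trans _ _ ((Lam + 1) * ((d%:R + 1) * r))).
    by rewrite ler_wpM2l ?addr_ge0// ler_wpM2r ?(ltW r0)// lerDl.
  rewrite /r; apply: eq_imp_le; field.
  by rewrite !gt_eqF// ltr_wpDl.
have Wt t : cube s r t -> 4^-1 <= W t.
  move=> ct; have := fullgap_lipschitz t s; have := near_s t ct.
  move=> h1 h2.
  have h3 : `|fullgap t - fullgap s| <= 1 / 4.
    apply: le_trans h2 _; apply: le_trans dr4.
    by rewrite ler_pM ?enorm_ge0// lerDl.
  by move: h3; rewrite ler_norml => /andP[_ h3]; rewrite /W; lra.
have sub : cube s r `<=` ~` D k.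
  move=> t ct; rewrite /D /= => tk.
  have := enormB_le t (vsub t s).
  have -> : vsub t (vsub t s) = s by apply: vecP => i; rewrite !tnth_vsub; ring.
  have := near_s t ct => h1 h2.
  have := le_trans sA (le_trans h2 (lerD tk h1)).
  by rewrite gerDl ler10.
have mc := @measurable_cube R d s r.
have jc : (leb R d).-integrable (cube s r) (EFin \o (fun s => W s ^+ N)).
  exact: integrableS jW.
have : c <= \int[leb R d]_(x in ~` D k) W x ^+ N.
  apply: (@le_trans _ _ (\int[leb R d]_(x in cube s r) W x ^+ N)).
    have -> : c = \int[leb R d]_(x in cube s r) (4^-1 ^+ N).
      rewrite Rintegral_cst// /c; congr (_ * _).
      exact: (congr1 fine (esym (leb_cube s (ltW r0)))).
    apply: le_Rintegral => //.
      apply: (@measurable_bounded_integrable _ _ _ _ (cst (4^-1 ^+ N))) => //.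
        exact: (leb_cube_fin s (ltW r0)).
      by exists `|4^-1 ^+ N|; split => // B cB x _; rewrite /= ltW.
    by move=> t ct; rewrite lerXn2r ?nnegrE// Wt.
  rewrite -(setDUK sub) Rintegral_setU//.
  - by rewrite lerDl Rintegral_ge0// => x _; rewrite exprn_ge0.
  - by apply: measurableD => //; exact: measurableC.
  - by rewrite (setDUK sub); apply: integrableS jW => //; exact: measurableC.
  - by apply/disj_setPS => x [? []].
by rewrite leNgt Hk.
Qed.

(** The gap at most quadruples when s is doubled. After the number of
    doublings that takes s to the region of fullgap_infinity it is at least
    1/2, so it cannot be too small at s. *)
Lemma fullgap_far (del : R) : 0 < del ->
  exists2 kap : R, 0 < kap & forall s, del <= enorm s -> kap <= fullgap s.
Proof.
move=> del0; have [A HA] := fullgap_infinity.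
pose j := (Num.truncn (A / del)).+1.
exists (4^-1 ^+ j / 2); first by rewrite divr_gt0// exprn_gt0// invr_gt0.
move=> s ds.
have Aj : A <= 2 ^+ j * del.
  rewrite -ler_pdivrMr//; apply: le_trans (_ : j%:R <= _).
    by rewrite ltW// truncnS_gt.
  by rewrite -natrX ler_nat ltnW// ltn_expl.
have dbl k : fullgap (vscale (2 ^+ k) s) <= 4 ^+ k * fullgap s.
  elim: k => [|k IH].
    rewrite !expr0 mul1r (_ : vscale 1 s = s)//.
    by apply: vecP => i; rewrite tnth_vscale mul1r.
  rewrite (_ : vscale _ s = vscale 2 (vscale (2 ^+ k) s)); last first.
    by apply: vecP => i; rewrite !tnth_vscale exprS mulrA.
  apply: le_trans (fullgap_double _) _.
  by rewrite exprS -mulrA ler_wpM2l.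
have h1 : 1 / 2 <= fullgap (vscale (2 ^+ j) s).
  apply: HA; rewrite enormZ ger0_norm ?exprn_ge0//.
  by apply: le_trans Aj _; rewrite ler_wpM2l// exprn_ge0.
have := le_trans h1 (dbl j).
rewrite exprVn mul1r -(ler_pM2l (_ : 0 < 4 ^- j)); last by rewrite invr_gt0 exprn_gt0.
by rewrite mulKf// expf_neq0.
Qed.

(** As 1 - cos is at most 2, truncating at a large K costs little, uniformly
    in s. *)
Lemma gap_far (del : R) : 0 < del ->
  exists K : nat, exists2 kap : R, 0 < kap &
    forall s, del <= enorm s -> kap <= gap mu K s.
Proof.
move=> del0; have [kap kap0 Hk] := fullgap_far del0.
have k4 : 0 < kap / 4 by rewrite divr_gt0.
have [K HK] := Rintegral_tail_small (@measurable_trunc R d) (@nd_trunc R d)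
  (@trunc_cover R d) (fun _ => ler01) (Mcst muT 1) k4.
exists K, (kap / 2) => [|s ds]; first by rewrite divr_gt0.
have mtr := @measurable_trunc R d K.
have jC : M.-integrable (~` trunc K) (EFin \o (fun z => 1 - cos (dotp s (pdiff z)))).
  by apply: integrableS (jgap s) => //; exact: measurableC.
have j1C : M.-integrable (~` trunc K) (EFin \o cst (1 : R)).
  by apply: integrableS (Mcst muT 1) => //; exact: measurableC.
have E1 : fullgap s = gap mu K s + \int[M]_(z in ~` trunc K) (1 - cos (dotp s (pdiff z))).
  rewrite /fullgap -(setUv (trunc K)) Rintegral_setU//.
  - exact: measurableC.
  - by rewrite setUv; exact: jgap.
  - by apply/disj_setPS => x [].
have tl : \int[M]_(z in ~` trunc K) (1 - cos (dotp s (pdiff z))) <= kap / 2.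
  apply: (@le_trans _ _ (2 * \int[M]_(z in ~` trunc K) 1)).
    rewrite -(RintegralZl _ (measurableC mtr) j1C).
    apply: (le_Rintegral (measurableC mtr) jC (integrableZl (measurableC mtr) 2 j1C)) => z _.
    rewrite mulr1 lerBlDr -lerBlDl (_ : 1 - 2 = -1 :> R); last by ring.
    exact: cos_geN1.
  move: HK => /ltW; rewrite -(ler_pM2l (_ : 0 < 2 :> R))// => /le_trans; apply.
  by rewrite (_ : 2 * (kap / 4) = kap / 2)//; field.
have := Hk s ds; rewrite E1 => h.
rewrite -(lerD2r (\int[M]_(z in ~` trunc K) (1 - cos (dotp s (pdiff z))))).
by apply: le_trans h; rewrite [leRHS]splitr lerD2l.
Qed.

End gap_far.

(** * Densities of the sums *)

Section density_change.
Context d0 {T : measurableType d0} {R : realType}.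
Variables (nu L : {measure set T -> \bar R}) (g : T -> R).
Hypotheses (mg : measurable_fun setT g) (g0 : forall x, 0 <= g x)
  (nuE : forall A, measurable A -> nu A = (\int[L]_(x in A) (g x)%:E)%E).

Import HBNNSimple.

Let nuE1 A : measurable A -> nu A = (\int[L]_x (\1_A x * g x)%:E)%E.
Proof.
move=> mA; rewrite nuE// integral_mkcond; apply: eq_integral => x _.
by rewrite patchE indicE; case: ifPn => _; rewrite ?mul1r ?mul0r.
Qed.

(** From indicators to simple functions to monotone limits. *)
Lemma ge0_integral_density (f : T -> \bar R) : measurable_fun setT f ->
  (forall x, (0 <= f x)%E) ->
  (\int[nu]_x f x = \int[L]_x (f x * (g x)%:E))%E.
Proof.
move=> mf f0.
have mgE : measurable_fun setT (EFin \o g) by exact/measurable_EFinP.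
have indic A (c : R) : measurable A -> 0 <= c ->
    (\int[nu]_x (c * \1_A x)%:E = \int[L]_x ((c * \1_A x)%:E * (g x)%:E))%E.
  move=> mA c0.
  have m1 : measurable_fun setT (fun x => (\1_A x * g x)%:E : \bar R).
    by apply/measurable_EFinP; exact: measurable_funM.
  under eq_integral do rewrite EFinM.
  rewrite ge0_integralZl; [|by []|by apply/measurable_EFinP|by move=> x _; rewrite lee_fin|by rewrite lee_fin].
  rewrite integral_indic// setIT nuE1//.
  rewrite -ge0_integralZl; [|by []|exact: m1|by move=> x _; rewrite lee_fin mulr_ge0|by rewrite lee_fin].
  by apply: eq_integral => x _; rewrite !EFinM muleA.
have sfun (h : {nnsfun T >-> R}) :
    (\int[nu]_x (h x)%:E = \int[L]_x ((h x)%:E * (g x)%:E))%E.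
  have hE x : (h x)%:E = (\sum_(r \in range h) (r * \1_(h @^-1` [set r]) x)%:E)%E.
    by rewrite fsumEFin// -fimfunE.
  under eq_integral do rewrite hE.
  rewrite ge0_integral_fsum//; last 2 first.
  - by move=> r; exact/measurable_EFinP/measurableT_comp.
  - by move=> r x _; rewrite EFinM nnfun_muleindic_ge0.
  transitivity (\sum_(r \in range h) \int[L]_x ((r * \1_(h @^-1` [set r]) x)%:E * (g x)%:E))%E.
    apply: eq_fsbigr => r; rewrite inE => -[t _ <-].
    exact: indic.
  rewrite -ge0_integral_fsum//; last 2 first.
  - move=> r; apply: emeasurable_funM => //.
    exact/measurable_EFinP/measurableT_comp.
  - by move=> r x _; rewrite mule_ge0 ?EFinM ?nnfun_muleindic_ge0 ?lee_fin.
  apply: eq_integral => x _.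
  rewrite -ge0_mule_fsuml; last by move=> r; rewrite EFinM nnfun_muleindic_ge0.
  by rewrite -hE.
pose h := nnsfun_approx measurableT mf.
have hcvg x : (h n x)%:E @[n --> \oo] --> f x by exact: cvg_nnsfun_approx.
have ndh x : {homo (fun n => (h n x)%:E) : m n / (m <= n)%N >-> (m <= n)%E}.
  by move=> m n mn; rewrite lee_fin; exact/lefP/nd_nnsfun_approx.
transitivity (limn (fun n => \int[nu]_x (h n x)%:E))%E.
  rewrite -monotone_convergence//.
  - by apply: eq_integral => x _; apply/esym/cvg_lim => //; exact: hcvg.
  - by move=> n; exact/measurable_EFinP.
  - by move=> n x _; rewrite lee_fin.
transitivity (limn (fun n => \int[L]_x ((h n x)%:E * (g x)%:E)))%E.
  by congr (limn _); apply/funext => n; exact: sfun.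
rewrite -monotone_convergence//.
- apply: eq_integral => x _; apply/cvg_lim => //.
  by apply: cvgeZr => //; exact: hcvg.
- by move=> n; apply: emeasurable_funM => //; exact/measurable_EFinP.
- by move=> n x _; rewrite mule_ge0 ?lee_fin.
- by move=> x _ m n mn; rewrite lee_wpmul2r ?lee_fin//; exact: ndh.
Qed.

Lemma integrable_density (f : T -> R) : measurable_fun setT f ->
  nu.-integrable setT (EFin \o f) ->
  L.-integrable setT (EFin \o (fun x => f x * g x)).
Proof.
move=> mf /integrableP[_ foo]; apply/integrableP; split.
  by apply/measurable_EFinP; exact: measurable_funM.
move: foo; rewrite ge0_integral_density//; last by apply: measurableT_comp => //; exact/measurable_EFinP.
apply: le_lt_trans; apply: ge0_le_integral => //.
- by apply: measurableT_comp => //; apply/measurable_EFinP; exact: measurable_funM.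
- by apply: emeasurable_funM; [apply: measurableT_comp => //|]; exact/measurable_EFinP.
- by move=> x _; rewrite /= -EFinM lee_fin normrM (ger0_norm (g0 x)).
Qed.

Lemma Rintegral_density (f : T -> R) : measurable_fun setT f ->
  nu.-integrable setT (EFin \o f) ->
  \int[nu]_x f x = \int[L]_x (f x * g x).
Proof.
move=> mf jf; rewrite /Rintegral; congr fine.
have mE : measurable_fun setT (EFin \o f) by exact/measurable_EFinP.
have mp := measurable_funepos mE; have mn := measurable_funeneg mE.
rewrite integralE [in RHS]integralE.
rewrite (ge0_integral_density mp)// (ge0_integral_density mn)//.
congr (_ - _)%E; apply: eq_integral => x _.
  by rewrite !funeposE /= EFinM maxe_pMl ?mul0e ?lee_fin.
by rewrite !funenegE /= maxe_pMl ?mul0e ?lee_fin// -EFinM mulNr.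
Qed.

End density_change.

Section convolution_density.
Context d0 {T : measurableType d0} {R : realType} (P : probability T R) {d : nat}.
Notation E := (euclidean R d).
Notation L := (leb R d).
Variables (X : {RV P >-> E}) (Xs : nat -> {RV P >-> E}).
Hypothesis copies : independent_copies P X Xs.

Let mu : {sigma_finite_measure set E -> \bar R} := distribution P X.
Let nu n : {sigma_finite_measure set E -> \bar R} := distribution P (psum Xs n).

Hypothesis iy : forall y, mu.-integrable setT (EFin \o tilt y).

Variables (n0 : nat) (f0 : E -> R) (C : R).
Hypotheses (n0_gt0 : (0 < n0)%N) (mf0 : measurable_fun setT f0)
  (f0_ge0 : forall s, 0 <= f0 s)
  (f0_le : forall s, f0 s <= C * expR (- (enorm s ^+ 2) / (2 * n0%:R)))
  (f0E : forall A, measurable A -> nu n0 A = (\int[L]_(x in A) (f0 x)%:E)%E).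

(** The k-fold convolution of f0 with the law of X, defined at every point:
    the bound tilt_cdens_le would make no sense for densities up to null sets,
    as it is integrated against the law of X, which may have no density
    itself. *)
Fixpoint cdens (k : nat) : E -> R :=
  if k is k'.+1 then fun s => \int[mu]_x cdens k' (vsub s x) else f0.

(** The maximum over s of expR (dotp y s) * (C * expR (- |s|^2 / (2 * n0))),
    attained at s = n0 * y. *)
Definition tilt_bound (y : E) : R := C * expR (n0%:R * enorm y ^+ 2 / 2).

Let C0 : 0 <= C.
Proof.
have := le_trans (f0_ge0 vzero) (f0_le vzero).
by rewrite pmulr_lge0// expR_gt0.
Qed.

Let Ly (y : E) : R := \int[mu]_x tilt y x.

Let L1 : Ly vzero = 1.
Proof.
rewrite /Ly (@eq_Rintegral _ _ _ mu setT (cst 1)); last first.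
  by move=> x _; rewrite /tilt dotp0l expR0.
have m1 : (mu : {measure set E -> \bar R}) setT = 1%E by exact: probability_setT.
by rewrite Rintegral_cst// m1 mulr1.
Qed.

(** Tilting is multiplicative over convolution, so each step multiplies the
    bound by Ly y. The three properties are proved together because the bound
    at y = 0 and measurability make the next integral meaningful. *)
Lemma cdens_props k : [/\ measurable_fun setT (cdens k),
  forall s, 0 <= cdens k s &
  forall y s, tilt y s * cdens k s <= tilt_bound y * Ly y ^+ k].
Proof.
elim: k => [|k [mk k0 kle]].
  split => // y s; rewrite expr0 mulr1 /=.
  apply: le_trans (ler_wpM2l (tilt_ge0 y s) (f0_le s)) _.
  rewrite mulrCA ler_wpM2l// /tilt -expRD ler_expR.
  have := dotp_ge0 (vsub s (vscale n0%:R y)).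
  rewrite dotpBl !dotpBr !dotpZl !dotpZr (dotpC s y) !enorm_sqr.
  set a := dotp s s; set b := dotp y s; set c := dotp y y.
  move=> h; have n1 : 0 < n0%:R :> R by rewrite ltr0n.
  rewrite -subr_ge0 (_ : _ - _ = (a - n0%:R * b - (n0%:R * b - n0%:R * (n0%:R * c))) / (2 * n0%:R)).
    by rewrite divr_ge0// mulr_ge0// ltW.
  by field; rewrite gt_eqF.
have bC s : cdens k s <= C.
  have := kle vzero s; rewrite /tilt_bound /tilt dotp0l expR0 mul1r L1 expr1n mulr1.
  by rewrite enorm0 expr0n mulr0 mul0r expR0 mulr1.
have mpair : measurable_fun setT (fun sx : E * E => cdens k (vsub sx.1 sx.2)).
  by apply: (measurableT_comp mk); exact: measurable_vsub.
have mslice s : measurable_fun setT (fun x => cdens k (vsub s x)).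
  by apply: (measurableT_comp mk); exact: measurable_vsub.
have muT : (mu setT < +oo)%E.
  apply: (@le_lt_trans _ _ 1%E); last exact: ltry.
  by apply: eq_imp_le; exact: probability_setT.
have js s : mu.-integrable setT (EFin \o (fun x => cdens k (vsub s x))).
  apply: measurable_bounded_integrable => //.
  by exists C; split; [rewrite num_real|move=> M CM x _; rewrite /= ger0_norm// ltW// (le_lt_trans (bC _))].
have E1 s : (cdens k.+1 s)%:E = (\int[mu]_x (cdens k (vsub s x))%:E)%E.
  rewrite /= /Rintegral fineK//.
  exact: (integrable_fin_num measurableT (js s)).
split.
- apply/measurable_EFinP.
  have := @measurable_fun_fubini_tonelli_F _ _ _ _ _ mu (fun sx : E * E => (cdens k (vsub sx.1 sx.2))%:E).
  rewrite (_ : fubini_F _ _ = EFin \o cdens k.+1).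
    by apply; [exact/measurable_EFinP|move=> x; rewrite lee_fin].
  by apply/funext => s; rewrite /comp E1.
- by move=> s; apply: Rintegral_ge0.
- move=> y s; rewrite [cdens k.+1 s]/= -(RintegralZl _ measurableT (js s)).
  rewrite exprSr mulrA -(RintegralZl _ measurableT (iy y)).
  apply: le_Rintegral => //.
  + exact: (integrableZl measurableT _ (js s)).
  + exact: (integrableZl measurableT _ (iy y)).
  move=> x _; have -> : tilt y s = tilt y (vsub s x) * tilt y x.
    rewrite -tiltD; congr tilt; apply: vecP => i.
    by rewrite tnth_vadd tnth_vsub subrK.
  by rewrite mulrAC ler_wpM2r ?tilt_ge0.
Qed.

Lemma measurable_cdens k : measurable_fun setT (cdens k).
Proof. by case: (cdens_props k). Qed.

Lemma cdens_ge0 k s : 0 <= cdens k s.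
Proof. by case: (cdens_props k). Qed.

Lemma tilt_cdens_le k y s : tilt y s * cdens k s <= tilt_bound y * Ly y ^+ k.
Proof. by case: (cdens_props k). Qed.

Lemma EFin_cdensS k s :
  (cdens k.+1 s)%:E = (\int[mu]_x (cdens k (vsub s x))%:E)%E.
Proof.
have [mk k0 kle] := cdens_props k.
have bC u : cdens k u <= C.
  have := kle vzero u; rewrite /tilt_bound /tilt dotp0l expR0 mul1r L1 expr1n mulr1.
  by rewrite enorm0 expr0n mulr0 mul0r expR0 mulr1.
have muT : (mu setT < +oo)%E.
  apply: (@le_lt_trans _ _ 1%E); last exact: ltry.
  by apply: eq_imp_le; exact: probability_setT.
rewrite /= /Rintegral fineK// integrable_fin_num//.
apply: measurable_bounded_integrable => //.
  by apply: (measurableT_comp mk); exact: measurable_vsub.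
by exists C; split; [rewrite num_real|move=> M CM x _; rewrite /= ger0_norm// ltW// (le_lt_trans (bC _))].
Qed.

Lemma cdens_density k A : measurable A ->
  nu (n0 + k) A = (\int[L]_(x in A) (cdens k x)%:E)%E.
Proof.
elim: k A => [|k IH] A mA; first by rewrite addn0 f0E.
have mk := measurable_cdens k; have k0 := cdens_ge0 k.
have m1A : measurable_fun setT (fun x => (\1_A x)%:E : \bar R).
  exact/measurable_EFinP.
rewrite addnS.
transitivity (\int[P]_w (\1_A (psum Xs (n0 + k).+1 w))%:E)%E.
  rewrite -(@ge0_integral_distribution _ _ _ _ _ P (psum Xs (n0 + k).+1) (fun x => (\1_A x)%:E))//.
  by rewrite integral_indic// setIT.
etransitivity.
  by apply: (integral_psumS copies (n0 + k) m1A) => x; rewrite lee_fin.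
have mpair : measurable_fun setT (fun sx : E * E => (\1_A (vadd sx.1 sx.2))%:E : \bar R).
  by apply: (measurableT_comp m1A); exact: measurable_vadd.
rewrite (@fubini_tonelli _ _ _ _ _ (nu (n0 + k)) mu (fun sx : E * E => (\1_A (vadd sx.1 sx.2))%:E))//.
transitivity (\int[mu]_x \int[L]_s ((\1_A s)%:E * (cdens k (vsub s x))%:E))%E.
  apply: eq_integral => x _ /=.
  rewrite (ge0_integral_density mk k0 (IH)); last 2 first.
  - apply: (measurableT_comp m1A); exact: measurable_vadd.
  - by move=> s; rewrite lee_fin.
  rewrite [RHS](@leb_translate R d x); last 2 first.
  - apply: emeasurable_funM => //; apply/measurable_EFinP.
    by apply: (measurableT_comp mk); exact: measurable_vsub.
  - by move=> s; rewrite mule_ge0 ?lee_fin.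
  apply: eq_integral => s _; congr (_ * (cdens k _)%:E)%E.
  by apply: vecP => i; rewrite tnth_vsub tnth_vadd addrK.
rewrite -(@fubini_tonelli _ _ _ _ _ L mu (fun sx : E * E => ((\1_A sx.1)%:E * (cdens k (vsub sx.1 sx.2))%:E)%E)); last 2 first.
- apply: emeasurable_funM; first exact: (measurableT_comp m1A).
  by apply/measurable_EFinP; apply: (measurableT_comp mk); exact: measurable_vsub.
- by move=> x; rewrite mule_ge0 ?lee_fin.
rewrite [RHS]integral_mkcond; apply: eq_integral => s _ /=.
rewrite ge0_integralZl//; last 2 first.
- by apply/measurable_EFinP; apply: (measurableT_comp mk); exact: measurable_vsub.
- by move=> x _; rewrite lee_fin.
rewrite -EFin_cdensS patchE indicE; case: ifPn => _; first by rewrite mul1e.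
by rewrite mul0e.
Qed.

End convolution_density.

(** * Gaussian integrals and exponential decay *)

Section elementary.
Context {R : realType}.

Lemma bernoulli_ineq (e : R) n : 0 <= e <= 1 -> 1 - n%:R * e <= (1 - e) ^+ n.
Proof.
move=> /andP[e0 e1]; elim: n => [|n IH]; first by rewrite mul0r subr0 expr0.
rewrite exprS; apply: (@le_trans _ _ ((1 - e) * (1 - n%:R * e))); last first.
  by rewrite ler_wpM2l// subr_ge0.
rewrite -subr_ge0 (_ : _ - _ = n%:R * (e * e)); first by rewrite !mulr_ge0.
by rewrite -natr1; ring.
Qed.

(** The exponential dominates the term of degree d.+1 of its series. *)
Lemma exp_decay (A c e : R) d : 0 <= A -> 0 < c -> 0 < e ->
  exists N : nat, forall n, (N <= n)%N ->
    A * n%:R ^+ d * expR (- (c * n%:R)) <= e.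
Proof.
move=> A0 c0 e0.
pose B := A * (d.+1)`!%:R / (c ^+ d.+1 * e).
exists (Num.truncn B).+1 => n Nn.
have n0 : 0 < n%:R :> R by rewrite ltr0n; apply: leq_trans Nn.
have Bn : B <= n%:R.
  by apply: ltW; apply: lt_le_trans (truncnS_gt B) _; rewrite ler_nat.
have cn0 : 0 <= c * n%:R by rewrite mulr_ge0// ltW.
have h : (c * n%:R) ^+ d.+1 / (d.+1)`!%:R <= expR (c * n%:R).
  by apply: le_trans (expR_ge1Dxn d cn0); rewrite lerDr.
have f0 : 0 < (d.+1)`!%:R :> R by rewrite ltr0n fact_gt0.
have cd : 0 < c ^+ d.+1 by rewrite exprn_gt0.
rewrite expRN ler_pdivrMr ?expR_gt0//.
apply: le_trans (ler_wpM2l (ltW e0) h).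
have := Bn; rewrite /B ler_pdivrMr ?mulr_gt0// => h2.
rewrite mulrA ler_pdivlMr// exprMn.
apply: (@le_trans _ _ (n%:R ^+ d * (n%:R * (c ^+ d.+1 * e)))).
  by rewrite mulrAC mulrC ler_wpM2l// exprn_ge0// ltW.
by apply: eq_imp_le; rewrite !exprSr; ring.
Qed.

End elementary.

Section gauss.
Context {R : realType}.
Notation mu := (@lebesgue_measure R).

Lemma integral_gauss1 (a : R) : 0 < a ->
  (\int[mu]_z (expR (- (a * z ^+ 2 / 2)))%:E = (Num.sqrt (2 * pi / a))%:E)%E.
Proof.
move=> a0; pose c := Num.sqrt (2 / a).
have ca : 0 < 2 / a by rewrite divr_gt0.
have c0 : 0 < c by rewrite sqrtr_gt0.
have mf : measurable_fun setT (fun z : measurableTypeR R => (expR (- (a * z ^+ 2 / 2)))%:E).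
  apply/measurable_EFinP; apply: measurableT_comp => //.
  apply: measurableT_comp => //; apply: measurable_funM => //.
  by apply: measurable_funM => //; exact: measurable_funX.
rewrite (@lebesgue_affine _ c 0)//.
rewrite (_ : (\int[mu]_x _)%E = (\int[mu]_x (gauss_fun x)%:E)%E).
  rewrite integralT_gauss -EFinM /c -sqrtrM ?(ltW ca)//; congr (Num.sqrt _)%:E.
  by rewrite mulrAC.
apply: eq_integral => x _; rewrite /gauss_fun add0r exprMn sqr_sqrtr ?(ltW ca)//.
by congr (expR (- _))%:E; field; rewrite gt_eqF.
Qed.

Lemma integral_gauss d (a : R) : 0 < a ->
  (\int[leb R d]_s (expR (- (a * enorm s ^+ 2 / 2)))%:E =
   (Num.sqrt (2 * pi / a) ^+ d)%:E)%E.
Proof.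
move=> a0.
transitivity (\int[leb R d]_s (\prod_(i < d) expR (- (a * tnth s i ^+ 2 / 2)))%:E)%E.
  apply: eq_integral => s _; congr EFin.
  rewrite -expR_sum enorm_sqr /dotp mulr_sumr mulr_suml sumrN.
  by congr (expR (- _)); apply: eq_bigr => i _; rewrite expr2.
rewrite (@leb_prod R d (fun _ z => expR (- (a * z ^+ 2 / 2)))).
- rewrite (eq_bigr (fun=> (Num.sqrt (2 * pi / a))%:E)); last first.
    by move=> i _; exact: integral_gauss1.
  by rewrite prodEFin prodr_const card_ord.
- move=> i; apply: measurableT_comp => //.
  apply: measurableT_comp => //; apply: measurable_funM => //.
  by apply: measurable_funM => //; exact: measurable_funX.
- by move=> i x; exact: expR_ge0.
Qed.

End gauss.

(** * Fourier bounds on the densities of the sums *)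

Section density_fourier.
Context d0 {T : measurableType d0} {R : realType} (P : probability T R) {d : nat}.
Notation E := (euclidean R d).
Notation L := (leb R d).
Variables (X : {RV P >-> E}) (Xs : nat -> {RV P >-> E}).
Hypothesis copies : independent_copies P X Xs.

Let mu : {sigma_finite_measure set E -> \bar R} := distribution P X.
Let nu n : {sigma_finite_measure set E -> \bar R} := distribution P (psum Xs n).

Hypothesis iy : forall y, mu.-integrable setT (EFin \o tilt y).

Variables (n0 : nat) (f0 : E -> R) (C : R).
Hypotheses (n0_gt0 : (0 < n0)%N) (mf0 : measurable_fun setT f0)
  (f0_ge0 : forall s, 0 <= f0 s)
  (f0_le : forall s, f0 s <= C * expR (- (enorm s ^+ 2) / (2 * n0%:R)))
  (f0E : forall A, measurable A -> nu n0 A = (\int[L]_(x in A) (f0 x)%:E)%E).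

Let g := cdens X f0.
Let mg k : measurable_fun setT (g k).
Proof. exact: (measurable_cdens iy n0_gt0 mf0 f0_ge0 f0_le). Qed.
Let g0 k s : 0 <= g k s.
Proof. exact: (cdens_ge0 iy n0_gt0 mf0 f0_ge0 f0_le). Qed.
Let gE k A : measurable A -> nu (n0 + k) A = (\int[L]_(x in A) (g k x)%:E)%E.
Proof. exact: (cdens_density copies iy n0_gt0 mf0 f0_ge0 f0_le f0E). Qed.

Let Ly (y : E) : R := \int[mu]_x tilt y x.

Definition tdens (y : E) (k : nat) (x : E) : R := tilt y x * g k x.

Let td0 y k x : 0 <= tdens y k x.
Proof. by rewrite mulr_ge0 ?tilt_ge0. Qed.

Let jtd y k : L.-integrable setT (EFin \o tdens y k).
Proof.
apply: (integrable_density (mg k) (g0 k) (@gE k) (measurable_tilt y)).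
exact: (integrable_tilt_psum copies (iy y)).
Qed.

Lemma Rintegral_tdens y k : \int[L]_x tdens y k x = Ly y ^+ (n0 + k).
Proof.
have jt := integrable_tilt_psum copies (iy y) (n0 + k).
rewrite -(Rintegral_density (mg k) (g0 k) (@gE k) (measurable_tilt y) jt).
by rewrite /Rintegral (integral_tilt_psum copies (iy y)).
Qed.

(** The measure with density tdens y k is the tilted law of the sum of n0 + k
    copies. *)
Lemma famp_tdens y k s :
  famp L (tdens y k) s = famp mu (tilt y) s ^+ (n0 + k).
Proof.
rewrite -(famp_psum copies (iy y)) /famp.
have t0 := @tilt_ge0 R d y.
have jt := integrable_tilt_psum copies (iy y) (n0 + k).
have md : measurable_fun setT (fun x => dotp s x) by exact: measurable_dotp.
have mt := measurable_tilt y.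
have -> : fcos L (tdens y k) s = fcos (nu (n0 + k)) (tilt y) s.
  rewrite /fcos (Rintegral_density (mg k) (g0 k) (@gE k) _ (integrable_fcos t0 jt s)).
    by apply: eq_Rintegral => x _; rewrite /tdens mulrAC.
  by apply: measurable_funM => //; exact: measurable_cos_comp.
have -> : fsin L (tdens y k) s = fsin (nu (n0 + k)) (tilt y) s.
  rewrite /fsin (Rintegral_density (mg k) (g0 k) (@gE k) _ (integrable_fsin t0 jt s)).
    by apply: eq_Rintegral => x _; rewrite /tdens mulrAC.
  by apply: measurable_funM => //; exact: measurable_sin_comp.
by [].
Qed.

Let td_le y k x : tdens y k x <= tilt_bound n0 C y * Ly y ^+ k.
Proof. exact: (tilt_cdens_le iy n0_gt0 mf0 f0_ge0 f0_le). Qed.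

(** Plancherel's inequality for the tilted density at k = 0, which is at most
    tilt_bound. *)
Lemma plancherel_mu y :
  (\int[L]_s (famp mu (tilt y) s ^+ (2 * n0))%:E <=
   ((2 * pi) ^+ d * (tilt_bound n0 C y * Ly y ^+ n0))%:E)%E.
Proof.
have hM x : tdens y 0 x <= tilt_bound n0 C y.
  by have := td_le y 0 x; rewrite expr0 mulr1.
have := plancherel_le (td0 y 0) hM (jtd y 0).
rewrite Rintegral_tdens addn0; apply: le_trans.
apply: eq_imp_le; apply: eq_integral => s _.
by rewrite famp_tdens addn0 -exprM mulnC.
Qed.

(** Fourier inversion: smoothing_le bounds the smoothed tilted density at
    every scale, hence the tilted density almost everywhere. *)
Lemma cdens_le_famp y k (a : R) :
  (\int[L]_s (famp mu (tilt y) s ^+ (n0 + k))%:E <= a%:E)%E ->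
  {ae L, forall x, (2 * pi) ^+ d * (tilt y x * g k x) <= a}.
Proof.
move=> ha; have pd : 0 < (2 * pi) ^+ d :> R by rewrite exprn_gt0// mulr_gt0// pi_gt0.
have sm e u : 0 < e -> smoothed (tdens y k) e u <= a / (2 * pi) ^+ d.
  move=> e0; rewrite ler_pdivlMr// mulrC -lee_fin.
  apply: le_trans ha; apply: le_trans (smoothing_le (td0 y k) (jtd y k) u e0) _.
  apply: eq_imp_le; apply: eq_integral => s _.
  by rewrite famp_tdens.
have := density_le_of_smoothed (td0 y k) (td_le y k) (jtd y k) sm.
apply: ae_mono => x; rewrite ler_pdivlMr// mulrC.
exact.
Qed.

End density_fourier.

(** * The local bound, uniform in small tilts *)

Lemma exists_near1 {R : realType} (q : R) d : q < 1 ->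
  exists2 eta : R, 0 < eta < 1 & q <= (1 - eta) ^+ d.
Proof.
move=> q1; have [q0|q0] := leP q 0.
  exists (1 / 2); first by apply/andP; split; lra.
  by apply: le_trans q0 _; rewrite exprn_ge0//; lra.
have dp : 1 <= d%:R + 1 :> R by rewrite lerDr.
have dp0 : 0 < d%:R + 1 :> R by apply: lt_le_trans dp.
have eta1 : (1 - q) / (d%:R + 1) < 1 by rewrite ltr_pdivrMr// mul1r; lra.
have eta0 : 0 < (1 - q) / (d%:R + 1) by rewrite divr_gt0// subr_gt0.
exists ((1 - q) / (d%:R + 1)); first by rewrite eta0.
apply: le_trans (bernoulli_ineq d (_ : 0 <= _ <= 1)); last by rewrite !ltW.
rewrite lerBrDr addrC -lerBrDr mulrA ler_pdivrMr// mulrC ler_wpM2l//; lra.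
Qed.

(** The first summand comes from the low frequencies, where the variance 1 / n
    is enlarged by the factor (1 - eta) ^- 2; the second one from the high
    frequencies, exponentially small compared with n^(-d/2). *)
Lemma local_const {R : realType} d (C eps eta kap : R) (n0 : nat) :
  0 <= C -> 0 < eps -> 0 < eta < 1 -> (1 + eps / 2)^-1 <= (1 - eta) ^+ d ->
  0 < kap -> exists N, forall n, (N <= n)%N -> (0 < n)%N ->
  Num.sqrt (2 * pi / (n%:R * (1 - eta) ^+ 2)) ^+ d +
  (2 * pi) ^+ d * C * expR (- (kap * (n%:R - (2 * n0)%:R) / 2)) <=
  (1 + eps) * Num.sqrt (2 * pi / n%:R) ^+ d.
Proof.
move=> C0 eps0 /andP[eta0 eta1] etad kap0.
have := @pi_gt0 R; move: (@pi R) => p p0.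
have tp : 0 < 2 * p by rewrite mulr_gt0.
pose D : R := (2 * p) ^+ d * C * expR (kap * n0%:R).
have D0 : 0 <= D by rewrite /D; apply: mulr_ge0; [apply: mulr_ge0=> //; apply: exprn_ge0; exact: ltW|exact: expR_ge0].
have sp : 0 < Num.sqrt (2 * p) ^+ d by rewrite exprn_gt0// sqrtr_gt0.
have Ds0 : 0 <= D / Num.sqrt (2 * p) ^+ d by rewrite divr_ge0// ltW.
have kap2 : 0 < kap / 2 by rewrite divr_gt0.
have eps2 : 0 < eps / 2 by rewrite divr_gt0.
have [N HN] := @exp_decay R _ _ _ d Ds0 kap2 eps2.
exists N => n Nn n0'.
have n1 : 1 <= n%:R :> R by rewrite ler1n.
have npos : 0 < n%:R :> R by rewrite ltr0n.
have e1 : 0 < 1 - eta by rewrite subr_gt0.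
rewrite [leRHS](_ : _ = (1 + eps / 2) * Num.sqrt (2 * p / n%:R) ^+ d +
  eps / 2 * Num.sqrt (2 * p / n%:R) ^+ d); last by lra.
have sn : 0 < Num.sqrt n%:R :> R by rewrite sqrtr_gt0.
apply: lerD.
  rewrite invfM mulrA sqrtrM; last by apply: divr_ge0; exact: ltW.
  rewrite sqrtrV ?exprn_ge0 ?(ltW e1)// sqrtr_sqr gtr0_norm// exprMn.
  rewrite [leLHS]mulrC ler_wpM2r ?exprn_ge0 ?sqrtr_ge0//.
  rewrite exprVn -[leRHS]invrK lef_pV2// posrE ?exprn_gt0// invr_gt0; lra.
rewrite sqrtrM ?(ltW tp)// sqrtrV ?ler0n// [in leRHS]exprMn exprVn mulrA ler_pdivlMr ?exprn_gt0//.
apply: le_trans (ler_wpM2r (ltW sp) (HN n Nn)).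
rewrite [leRHS](_ : _ = D * expR (- (kap / 2 * n%:R)) * n%:R ^+ d); last first.
  by field; rewrite gt_eqF.
rewrite [in leLHS](_ : - _ = kap * n0%:R + - (kap / 2 * n%:R)); last first.
  by rewrite natrM; field.
rewrite expRD [X in X * _ <= _]mulrA -/D.
apply: ler_wpM2l; first by rewrite mulr_ge0// expR_ge0.
apply: lerXn2r; rewrite ?nnegrE ?sqrtr_ge0 ?ler0n//.
rewrite -[leRHS]ger0_norm ?ler0n// -sqrtr_sqr ler_sqrt ?exprn_ge0//.
by rewrite expr2 ler_peMr.
Qed.

Section local_bound.
Context {R : realType} {d : nat}.
Notation E := (euclidean R d).
Notation L := (leb R d).
Variable mu : {sigma_finite_measure set E -> \bar R}.
Hypothesis muT : mu setT = 1%E.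
Hypothesis i2 : forall i, mu.-integrable setT (EFin \o (fun x : E => tnth x i ^+ 2)).
Hypothesis mean : forall i, \int[mu]_x (tnth x i : R) = 0.
Hypothesis cov : forall i j, \int[mu]_x (tnth x i * tnth x j : R) = (i == j)%:R.
Hypothesis iy : forall y, mu.-integrable setT (EFin \o tilt y).
Let Ly (y : E) : R := \int[mu]_x tilt y x.
Hypothesis Ly_le : forall y, Ly y <= expR (enorm y ^+ 2 / 2).
Variables (n0 : nat) (C : R).
Hypothesis C0 : 0 <= C.
Hypothesis planch : forall y,
  (\int[L]_s (famp mu (tilt y) s ^+ (2 * n0))%:E <=
   ((2 * pi) ^+ d * (tilt_bound n0 C y * Ly y ^+ n0))%:E)%E.

Let Ly0 y : 0 <= Ly y.
Proof. by apply: Rintegral_ge0 => x _; exact: tilt_ge0. Qed.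

Let intN : (\int[L]_s ((1 - fullgap mu s) ^+ n0)%:E < +oo)%E.
Proof.
apply: (@le_lt_trans _ _ (\int[L]_s (famp mu (tilt vzero) s ^+ (2 * n0))%:E)%E).
  apply: eq_imp_le; apply: eq_integral => s _.
  by rewrite exprM fullgap_tilt0.
exact: le_lt_trans (planch _) (ltry _).
Qed.

Let Ly2 y : Ly y ^+ 2 <= expR (enorm y ^+ 2).
Proof.
have -> : enorm y ^+ 2 = enorm y ^+ 2 / 2 + enorm y ^+ 2 / 2 by lra.
by rewrite expRD -expr2 ler_pXn2r ?nnegrE ?expR_ge0.
Qed.

(** A form common to low and high frequencies: as Ly y <= expR (|y|^2 / 2), a
    lower bound v on the weighted gap improves the trivial bound on famp by
    expR (- v / 2). *)
Let famp_le_gap K y s (v : R) :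
  v <= gap mu K s * expR (- (enorm y ^+ 2 + 2 * K%:R * enorm y)) ->
  famp mu (tilt y) s <= expR ((enorm y ^+ 2 - v) / 2).
Proof.
move=> hv; rewrite -(@ler_pXn2r _ 2)// ?nnegrE ?expR_ge0 ?famp_ge0//.
apply: le_trans (famp_gap (iy y) K s) _.
have -> : expR ((enorm y ^+ 2 - v) / 2) ^+ 2 = expR (enorm y ^+ 2) * expR (- v).
  by rewrite expr2 -!expRD; congr expR; field.
apply: (@le_trans _ _ (expR (enorm y ^+ 2) * (1 - v))); last first.
  by rewrite ler_wpM2l ?expR_ge0// expR_ge1Dx.
rewrite mulrBr mulr1; apply: lerB; first exact: Ly2.
apply: le_trans (ler_wpM2l (expR_ge0 _) hv) _.
rewrite mulrCA -expRD mulrC opprD addrA subrr add0r.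
by [].
Qed.

(** Half of a local limit theorem. At frequencies |s| <= del the gap is at
    least almost |s|^2 and famp ^+ n is below a Gaussian of variance almost 1
    / n. At frequencies |s| >= del the gap exceeds a constant: n - 2 * n0 of
    the factors decay exponentially, and the remaining 2 * n0 ones have an
    integral bounded by planch. *)
Lemma local_bound (eps : R) : 0 < eps ->
  exists2 t0 : R, 0 < t0 & exists N : nat, forall n, (N <= n)%N ->
    forall y : E, enorm y <= t0 ->
    (\int[L]_s (famp mu (tilt y) s ^+ n)%:E <=
     ((1 + eps) * Num.sqrt (2 * pi / n%:R) ^+ d * expR (n%:R * enorm y ^+ 2 / 2))%:E)%E.
Proof.
move=> eps0.
pose q : R := (1 + eps / 2)^-1.
have q0 : 0 < q by rewrite invr_gt0; lra.
have q1 : q < 1 by rewrite invf_lt1; lra.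
have [eta eh etad] := exists_near1 d q1.
have /andP[eta0 eta1] := eh.
have [K1 [del del0 H1]] := gap_near0 muT i2 mean cov eh.
have [K2 [kap kap0 H2]] := gap_far muT i2 intN del0.
(* for |y| <= t0 the tilting costs at most the factor 1 - eta at low
   frequencies *)
pose t0 : R := eta / (2 * K1%:R + 1).
have k1p : 1 <= 2 * K1%:R + 1 :> R by rewrite lerDr mulr_ge0.
have k1p0 : 0 < 2 * K1%:R + 1 :> R by apply: lt_le_trans k1p.
have t00 : 0 < t0 by rewrite /t0 divr_gt0.
have t01 : t0 <= 1.
  by rewrite /t0 ler_pdivrMr// mul1r (le_trans (ltW eta1)).
pose kap' : R := kap * expR (- (1 + 2 * K2%:R)).
have kap'0 : 0 < kap' by rewrite mulr_gt0 ?expR_gt0.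
exists t0 => //.
have [N HN] := local_const n0 C0 eps0 eh etad kap'0.
exists (maxn N (2 * n0).+1) => n; rewrite geq_max => /andP[Nn n0n] y yt.
have n2 : (2 * n0 <= n)%N by exact: ltnW.
have npos : 0 < n%:R :> R by rewrite ltr0n; apply: leq_ltn_trans n0n.
set a := enorm y ^+ 2.
have a0 : 0 <= a by exact: sqr_ge0.
have y0 := enorm_ge0 y.
have ay : a <= enorm y.
  by rewrite /a expr2 ler_piMr// (le_trans yt).
have near s : enorm s <= del ->
    famp mu (tilt y) s <= expR ((a - (1 - eta) ^+ 2 * enorm s ^+ 2) / 2).
  move=> sd; apply: (famp_le_gap (K := K1)).
  have u1 : 1 - eta <= expR (- (enorm y ^+ 2 + 2 * K1%:R * enorm y)).
    apply: le_trans (expR_ge1Dx _); rewrite lerD2l lerN2.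
    apply: (@le_trans _ _ (enorm y * (2 * K1%:R + 1))).
      by rewrite mulrDr mulr1 addrC mulrC lerD2l.
    apply: (@le_trans _ _ (t0 * (2 * K1%:R + 1))); first by rewrite ler_wpM2r// ltW.
    by rewrite /t0 divfK// gt_eqF.
  rewrite [in leLHS]expr2 mulrAC; apply: ler_pM => //.
  - by rewrite mulr_ge0 ?sqr_ge0// subr_ge0 ltW.
  - by rewrite subr_ge0 ltW.
  - exact: H1.
have far s : del <= enorm s -> famp mu (tilt y) s <= expR ((a - kap') / 2).
  move=> sd; apply: (famp_le_gap (K := K2)); rewrite /kap'.
  apply: ler_pM; [exact: ltW|exact: expR_ge0|exact: H2|].
  rewrite ler_expR lerN2 lerD//; first by rewrite (le_trans ay)// (le_trans yt).
  by rewrite ler_piMr ?mulr_ge0// (le_trans yt).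
pose F1 (s : E) := expR (n%:R * a / 2) * expR (- (n%:R * (1 - eta) ^+ 2 * enorm s ^+ 2 / 2)).
pose F2 (s : E) := expR ((n%:R - (2 * n0)%:R) * (a - kap') / 2) * famp mu (tilt y) s ^+ (2 * n0).
have F10 s : 0 <= F1 s by rewrite mulr_ge0 ?expR_ge0.
have F20 s : 0 <= F2 s by rewrite mulr_ge0 ?expR_ge0 ?exprn_ge0 ?famp_ge0.
have bound (s : E) : famp mu (tilt y) s ^+ n <= F1 s + F2 s.
  have [sd|/ltW sd] := leP (enorm s) del.
    apply: ler_wpDr => //; apply: (@le_trans _ _ (expR ((a - (1 - eta) ^+ 2 * enorm s ^+ 2) / 2) ^+ n)).
      by rewrite lerXn2r ?nnegrE ?famp_ge0 ?expR_ge0// near.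
    rewrite /F1 -expRD -expRM_natl ler_expR; apply: eq_imp_le.
    by field.
  apply: ler_wpDl => //; rewrite -{1}(subnK n2) exprD /F2 ler_wpM2r ?exprn_ge0 ?famp_ge0//.
  apply: (@le_trans _ _ (expR ((a - kap') / 2) ^+ (n - 2 * n0))).
    by rewrite lerXn2r ?nnegrE ?famp_ge0 ?expR_ge0// far.
  by rewrite -expRM_natl ler_expR natrB// mulrA.
have mfa : measurable_fun setT (famp mu (tilt y)).
  by apply: measurable_famp => //; exact: tilt_ge0.
have mF1 : measurable_fun setT F1.
  apply: measurable_funM => //; apply: measurableT_comp => //.
  apply: measurableT_comp => //; apply: measurable_funM => //.
  by apply: measurable_funM => //; apply: measurable_funX; exact: measurable_enorm.
have mF2 : measurable_fun setT F2 by apply: measurable_funM => //; exact: measurable_funX.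
apply: (@le_trans _ _ (\int[L]_s ((F1 s)%:E + (F2 s)%:E))%E).
  apply: ge0_le_integral => //.
  - by move=> s _; rewrite lee_fin exprn_ge0 ?famp_ge0.
  - by apply/measurable_EFinP; exact: measurable_funX.
  - by apply: emeasurable_funD; exact/measurable_EFinP.
  - by move=> s _; rewrite -EFinD lee_fin.
rewrite ge0_integralD; [|by []|by move=> s _; rewrite lee_fin|exact/measurable_EFinP|by move=> s _; rewrite lee_fin|exact/measurable_EFinP].
have aa : 0 < n%:R * (1 - eta) ^+ 2 by rewrite mulr_gt0// exprn_gt0// subr_gt0.
have I1 : (\int[L]_s (F1 s)%:E =
    (expR (n%:R * a / 2) * Num.sqrt (2 * pi / (n%:R * (1 - eta) ^+ 2)) ^+ d)%:E)%E.
  under eq_integral do rewrite EFinM.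
  rewrite ge0_integralZl; [|by []| |by move=> s _; rewrite lee_fin expR_ge0|by rewrite lee_fin expR_ge0].
    by rewrite integral_gauss.
  apply/measurable_EFinP; apply: measurableT_comp => //.
  apply: measurableT_comp => //; apply: measurable_funM => //.
  by apply: measurable_funM => //; apply: measurable_funX; exact: measurable_enorm.
have I2 : (\int[L]_s (F2 s)%:E <=
    (expR (n%:R * a / 2) * ((2 * pi) ^+ d * C * expR (- (kap' * (n%:R - (2 * n0)%:R) / 2))))%:E)%E.
  under eq_integral do rewrite EFinM.
  rewrite ge0_integralZl; [|by []| |by move=> s _; rewrite lee_fin exprn_ge0 ?famp_ge0|by rewrite lee_fin expR_ge0]; last first.
    by apply/measurable_EFinP; exact: measurable_funX.
  apply: le_trans (lee_wpmul2l _ (planch y)) _; first by rewrite lee_fin expR_ge0.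
  rewrite -EFinM lee_fin.
  have Lyn : Ly y ^+ n0 <= expR (n0%:R * a / 2).
    rewrite -mulrA expRM_natl lerXn2r ?nnegrE ?expR_ge0//; exact: Ly_le.
  apply: (@le_trans _ _ (expR ((n%:R - (2 * n0)%:R) * (a - kap') / 2) *
     ((2 * pi) ^+ d * (tilt_bound n0 C y * expR (n0%:R * a / 2))))).
    by rewrite !ler_wpM2l ?expR_ge0 ?exprn_ge0 ?mulr_ge0 ?pi_ge0.
  rewrite /tilt_bound -/a.
  apply: eq_imp_le.
  transitivity ((2 * pi) ^+ d * C * (expR ((n%:R - (2 * n0)%:R) * (a - kap') / 2) * expR (n0%:R * a / 2) * expR (n0%:R * a / 2))).
    by ring.
  transitivity ((2 * pi) ^+ d * C * (expR (n%:R * a / 2) * expR (- (kap' * (n%:R - (2 * n0)%:R) / 2)))).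
    by rewrite -!expRD; congr (_ * expR _); rewrite natrM; field.
  by ring.
apply: le_trans (leeD (_ : (_ <= _)%E) I2) _; first by rewrite I1.
rewrite -EFinD lee_fin -mulrDr [leRHS]mulrC ler_wpM2l ?expR_ge0//.
apply: HN => //; exact: leq_ltn_trans n0n.
Qed.

End local_bound.

(** * Gaussian bound on the densities of the sums *)

Section rational_vectors.
Context {R : realType} {d : nat}.
Notation E := (euclidean R d).

Definition ratvec (q : d.-tuple rat) : E := [tuple ratr (tnth q i) | i < d].

Lemma exists_ratvec (x : E) (r : R) : 0 < r ->
  exists q, enorm (vsub (ratvec q) x) <= r.
Proof.
move=> r0; pose e := r / (d%:R + 1).
have dp : 0 < d%:R + 1 :> R by rewrite ltr_wpDl.
have e0 : 0 < e by rewrite divr_gt0.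
have h i : exists q : rat, ratr q \in `]tnth x i - e, tnth x i + e[.
  by apply: rat_in_itvoo; rewrite ltrBlDr -addrA ltrDl addr_gt0.
exists [tuple projT1 (cid (h i)) | i < d].
apply: le_trans (enorm_le_coord (ltW e0) _) _.
  move=> i; rewrite tnth_vsub !tnth_mktuple.
  case: (cid (h i)) => q /=; rewrite in_itv/= => /andP[h1 h2].
  by rewrite ler_norml; apply/andP; split; lra.
rewrite /e mulrA ler_pdivrMr// mulrC ler_wpM2l ?(ltW r0)//; lra.
Qed.

(** The exceptional set depends on y, so that only countably many tilts can be
    compared at the same point. *)
Lemma ae_ratvec (mu : {measure set E -> \bar R}) (Q : E -> E -> Prop) :
  (forall y, {ae mu, forall x, Q y x}) ->
  {ae mu, forall x, forall q, Q (ratvec q) x}.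
Proof.
move=> h; pose yq (n : nat) : E := ratvec (odflt [tuple 0 | i < d] (@choice.unpickle (d.-tuple rat) n)).
have := ae_foralln (fun n => h (yq n)).
by apply: ae_mono => x hx q; have := hx (choice.pickle q); rewrite /yq choice.pickleK.
Qed.

(** Completing the square: y = x / n is the optimal tilt at x, and the first
    term on the right is the cost of another choice. *)
Lemma gauss_shift (n : R) (y x : E) : 0 < n ->
  n * enorm y ^+ 2 / 2 - dotp y x =
  n * enorm (vsub y (vscale n^-1 x)) ^+ 2 / 2 - enorm x ^+ 2 / (2 * n).
Proof.
move=> n0; rewrite !enorm_sqr !dotpBl !dotpBr !dotpZl !dotpZr (dotpC x y).
by field; rewrite gt_eqF.
Qed.

End rational_vectors.

Lemma sqrt_2piV {R : realType} (n : R) d : 0 < n ->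
  Num.sqrt (2 * pi / n) ^+ d = (2 * pi) ^+ d * (Num.sqrt (2 * pi * n) ^+ d)^-1.
Proof.
have := @pi_gt0 R; move: (@pi R) => p p0 n0.
have tp : 0 < 2 * p by rewrite mulr_gt0.
have s0 : 0 < Num.sqrt (2 * p * n) by rewrite sqrtr_gt0 mulr_gt0.
rewrite -exprVn -exprMn; congr (_ ^+ d).
apply: (@mulIf _ (Num.sqrt (2 * p * n))); first by rewrite gt_eqF.
rewrite divfK ?gt_eqF// -sqrtrM ?divr_ge0 ?(ltW tp) ?(ltW n0)//.
rewrite (_ : 2 * p / n * (2 * p * n) = (2 * p) ^+ 2); last by field; rewrite gt_eqF.
by rewrite sqrtr_sqr gtr0_norm.
Qed.

Section density_bound.
Context d0 {T : measurableType d0} {R : realType} (P : probability T R) {d : nat}.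
Notation E := (euclidean R d).
Notation L := (leb R d).
Variables (X : {RV P >-> E}) (Xs : nat -> {RV P >-> E}).
Hypothesis copies : independent_copies P X Xs.

Let mu : {sigma_finite_measure set E -> \bar R} := distribution P X.
Let nu n : {sigma_finite_measure set E -> \bar R} := distribution P (psum Xs n).

Hypothesis i2 : forall i, mu.-integrable setT (EFin \o (fun x : E => tnth x i ^+ 2)).
Hypothesis mean : forall i, \int[mu]_x (tnth x i : R) = 0.
Hypothesis cov : forall i j, \int[mu]_x (tnth x i * tnth x j : R) = (i == j)%:R.
Hypothesis iy : forall y, mu.-integrable setT (EFin \o tilt y).
Let Ly (y : E) : R := \int[mu]_x tilt y x.
Hypothesis Ly_le : forall y, Ly y <= expR (enorm y ^+ 2 / 2).
Hypothesis Ly_strict : forall t, 0 < t -> exists2 del : R, 0 < del < 1 &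
  forall y, t <= enorm y -> Ly y <= del * expR (enorm y ^+ 2 / 2).

Variables (n0 : nat) (f0 : E -> R) (C : R).
Hypotheses (n0_gt0 : (0 < n0)%N) (mf0 : measurable_fun setT f0)
  (f0_ge0 : forall s, 0 <= f0 s)
  (f0_le : forall s, f0 s <= C * expR (- (enorm s ^+ 2) / (2 * n0%:R)))
  (f0E : forall A, measurable A -> nu n0 A = (\int[L]_(x in A) (f0 x)%:E)%E).

Let g := cdens X f0.

Let C0 : 0 <= C.
Proof.
have := le_trans (f0_ge0 vzero) (f0_le vzero).
by rewrite pmulr_lge0// expR_gt0.
Qed.

(** The optimal tilt x / n is small enough for local_bound; a rational tilt is
    chosen so close to it that its cost in gauss_shift is at most ln (1 +
    eps). *)
Let near_bound (eps : R) : 0 < eps -> exists2 t : R, 0 < t & exists N, forall k,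
  (N <= n0 + k)%N -> {ae L, forall x, enorm x <= t * (n0 + k)%:R ->
  g k x <= (1 + eps) ^+ 2 * (Num.sqrt (2 * pi * (n0 + k)%:R) ^+ d)^-1 *
           expR (- (enorm x ^+ 2 / (2 * (n0 + k)%:R)))}.
Proof.
move=> eps0.
have muT : mu setT = 1%E by exact: probability_setT.
have [t t0 [N HN]] := local_bound muT i2 mean cov iy Ly_le C0
  (plancherel_mu copies iy n0_gt0 mf0 f0_ge0 f0_le f0E) eps0.
have t20 : 0 < t / 2 by rewrite divr_gt0.
exists (t / 2) => //; exists N => k Nk.
have npos : 0 < (n0 + k)%:R :> R by rewrite ltr0n addn_gt0 n0_gt0.
have H y : {ae L, forall x, enorm y <= t -> (2 * pi) ^+ d * (tilt y x * g k x) <=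
   (1 + eps) * Num.sqrt (2 * pi / (n0 + k)%:R) ^+ d * expR ((n0 + k)%:R * enorm y ^+ 2 / 2)}.
  have [yt|yt] := boolP (enorm y <= t); last by apply: aeW.
  have := cdens_le_famp copies iy n0_gt0 mf0 f0_ge0 f0_le f0E (HN _ Nk _ yt).
  by apply: ae_mono => x hx _.
have := ae_ratvec H.
apply: ae_mono => x hx xt.
move: npos Nk xt hx; set n := (n0 + k)%:R => npos _ xt hx.
have l0 : 0 < ln (1 + eps) by rewrite ln_gt0// ltrDl.
(* the second bound makes the cost n r^2 / 2 at most ln (1 + eps) *)
pose r := Num.min (t / 2) (Num.sqrt (2 * ln (1 + eps) / n)).
have r0 : 0 < r by rewrite lt_min t20 sqrtr_gt0 divr_gt0// mulr_gt0.
have [q hq] := exists_ratvec (vscale n^-1 x) r0.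
have hn : enorm (vscale n^-1 x) <= t / 2.
  by rewrite enormZ gtr0_norm ?invr_gt0// mulrC ler_pdivrMr.
have qt : enorm (ratvec q) <= t.
  rewrite (_ : ratvec q = vadd (vsub (ratvec q) (vscale n^-1 x)) (vscale n^-1 x)).
    apply: le_trans (enormD_le _ _) _; rewrite [leRHS]splitr lerD//.
    by apply: le_trans hq _; rewrite ge_min lexx.
  by apply: vecP => i; rewrite tnth_vadd tnth_vsub subrK.
have := hx _ qt; set y := ratvec q in hq * => hxy.
have p0 := @pi_gt0 R.
have dp : 0 < (2 * pi) ^+ d :> R by rewrite exprn_gt0// mulr_gt0.
have step : g k x <= (1 + eps) * (Num.sqrt (2 * pi * n) ^+ d)^-1 *
   expR (n * enorm y ^+ 2 / 2 - dotp y x).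
  rewrite expRD expRN -/(tilt y x) mulrA ler_pdivlMr ?expR_gt0// mulrC.
  rewrite -(ler_pM2l dp); apply: le_trans hxy _.
  apply: eq_imp_le.
  by rewrite sqrt_2piV// [in LHS]mulrCA !mulrA.
apply: le_trans step _; rewrite gauss_shift// expRD mulrA ler_wpM2r ?expR_ge0//.
rewrite [(1 + eps) ^+ 2]expr2 [leRHS]mulrAC ler_wpM2l//.
  by rewrite mulr_ge0 ?invr_ge0 ?exprn_ge0 ?sqrtr_ge0//; lra.
rewrite -[leRHS]lnK ?posrE ?addr_gt0// ler_expR.
rewrite ler_pdivrMr// mulrC -ler_pdivlMr// [X in _ <= X / _]mulrC.
rewrite -[leRHS]sqr_sqrtr; last by rewrite divr_ge0 ?mulr_ge0 ?(ltW l0) ?(ltW npos).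
rewrite ler_pXn2r ?nnegrE ?enorm_ge0 ?sqrtr_ge0//; apply: le_trans hq _.
by rewrite ge_min lexx orbT.
Qed.

(** At the optimal tilt x / n, which is not small, the pointwise bound
    tilt_cdens_le suffices: the factor del ^+ k beats the power n^(d/2). *)
Let far_bound (eps t : R) : 0 < eps -> 0 < t -> exists N, forall k,
  (N <= n0 + k)%N -> forall x, t * (n0 + k)%:R <= enorm x ->
  g k x <= eps * (Num.sqrt (2 * pi * (n0 + k)%:R) ^+ d)^-1 *
           expR (- (enorm x ^+ 2 / (2 * (n0 + k)%:R))).
Proof.
move=> eps0 t0; have [del /andP[del0 del1] Hdel] := Ly_strict t0.
have p0 : 0 < 2 * pi :> R by rewrite mulr_gt0// pi_gt0.
have lc : 0 < - ln del by rewrite oppr_gt0 ln_lt0// del0.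
have A0 : 0 <= C * Num.sqrt (2 * pi) ^+ d * del ^- n0.
  by rewrite !mulr_ge0 ?invr_ge0 ?exprn_ge0 ?sqrtr_ge0// ltW.
have [N HN] := @exp_decay R _ _ _ d A0 lc eps0.
exists N => k Nk x xt; have := HN _ Nk.
have npos : 0 < (n0 + k)%:R :> R by rewrite ltr0n addn_gt0 n0_gt0.
have n1 : 1 <= (n0 + k)%:R :> R by rewrite ler1n addn_gt0 n0_gt0.
have ek : expR (- (- ln del * (n0 + k)%:R)) = del ^+ (n0 + k).
  by rewrite mulNr opprK mulrC expRM_natl lnK.
rewrite ek exprD => h.
pose y := vscale (n0 + k)%:R^-1 x.
have ny : enorm y = enorm x / (n0 + k)%:R.
  by rewrite enormZ gtr0_norm ?invr_gt0// mulrC.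
have yt : t <= enorm y by rewrite ny ler_pdivlMr.
have h1 := tilt_cdens_le iy n0_gt0 mf0 f0_ge0 f0_le k y x.
have Lk : Ly y ^+ k <= del ^+ k * expR (k%:R * (enorm y ^+ 2 / 2)).
  rewrite expRM_natl -exprMn lerXn2r ?nnegrE ?mulr_ge0 ?expR_ge0 ?(ltW del0)//.
    by apply: Rintegral_ge0 => z _; exact: tilt_ge0.
  exact: Hdel.
have h2 : tilt y x * g k x <= C * del ^+ k * expR ((n0 + k)%:R * (enorm y ^+ 2 / 2)).
  apply: le_trans h1 _; apply: le_trans (ler_wpM2l _ Lk) _.
    by rewrite mulr_ge0// expR_ge0.
  rewrite /tilt_bound natrD mulrDl expRD -!mulrA; apply: eq_imp_le.
  by congr (_ * _); rewrite mulrCA.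
have h3 : g k x <= C * del ^+ k * expR (- (enorm x ^+ 2 / (2 * (n0 + k)%:R))).
  rewrite -(ler_pM2l (expR_gt0 (dotp y x))); apply: le_trans h2 _.
  rewrite [leRHS]mulrCA -expRD; apply: eq_imp_le; congr (_ * expR _).
  rewrite ny dotpZl -enorm_sqr; move: npos; move: ((n0 + k)%:R : R) => n n_0.
  by field; rewrite gt_eqF.
apply: le_trans h3 _; rewrite ler_wpM2r ?expR_ge0//.
have pn : 0 < 2 * pi * (n0 + k)%:R :> R by exact: mulr_gt0.
rewrite ler_pdivlMr ?exprn_gt0 ?sqrtr_gt0//; apply: le_trans h.
rewrite sqrtrM ?(ltW p0)// exprMn.
have sn : Num.sqrt (n0 + k)%:R ^+ d <= (n0 + k)%:R ^+ d :> R.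
  apply: lerXn2r; rewrite ?nnegrE ?sqrtr_ge0 ?ler0n//.
  by rewrite -[leRHS]ger0_norm ?ler0n// -sqrtr_sqr ler_sqrt ?exprn_ge0// expr2 ler_peMr.
rewrite (_ : C * _ * _ * _ * _ = C * del ^+ k * (Num.sqrt (2 * pi) ^+ d * (n0 + k)%:R ^+ d)).
  rewrite ler_wpM2l// ?mulr_ge0 ?exprn_ge0 ?(ltW del0)//.
  by rewrite ler_wpM2l ?exprn_ge0 ?sqrtr_ge0.
move: (Num.sqrt (2 * pi)) (n0 + k)%:R (del ^+ k) => a b e.
by field; rewrite expf_neq0// gt_eqF.
Qed.

Lemma cdens_le_gauss (eps : R) : 0 < eps -> exists N, forall k, (N <= n0 + k)%N ->
  {ae L, forall x, g k x <= (1 + eps) * (Num.sqrt (2 * pi * (n0 + k)%:R) ^+ d)^-1 *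
           expR (- (enorm x ^+ 2 / (2 * (n0 + k)%:R)))}.
Proof.
(* as e <= 1, (1 + e)^2 <= 1 + 3 e <= 1 + eps *)
move=> eps0; pose e := Num.min eps 1 / 3.
have e0 : 0 < e by rewrite divr_gt0// lt_min eps0 ltr01.
have e2 : (1 + e) ^+ 2 <= 1 + eps.
  have e1 : Num.min eps 1 <= 1 by rewrite ge_min lexx orbT.
  have e1' : Num.min eps 1 <= eps by rewrite ge_min lexx.
  have eE : Num.min eps 1 = 3 * e by rewrite /e mulrC divfK.
  have ee : e * e <= e by rewrite ler_piMr ?(ltW e0)//; lra.
  by rewrite expr2; lra.
have [t t0 [N1 H1]] := near_bound e0.
have eps1 : 0 < 1 + eps by rewrite addr_gt0.
have [N2 H2] := far_bound eps1 t0.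
exists (maxn N1 N2) => k; rewrite geq_max => /andP[k1 k2].
apply: (ae_mono _ (H1 k k1)) => x hx.
have [xt|/ltW xt] := leP (enorm x) (t * (n0 + k)%:R); last exact: H2.
by apply: le_trans (hx xt) _; rewrite ler_wpM2r ?expR_ge0// ler_wpM2r.
Qed.

End density_bound.

(** * Moments of a strictly subgaussian law *)

Lemma sqr_le_expR {R : realType} (z : R) :
  z ^+ 2 <= 2 * (expR z + expR (- z)).
Proof.
have key (u : R) : 0 <= u -> u ^+ 2 <= 2 * expR u.
  move=> u0; have := expR_ge1Dxn 1 u0; rewrite (_ : 2`! = 2)%N// => h; lra.
have ez := expR_ge0 z; have enz := expR_ge0 (- z).
have [z0|/ltW z0] := leP 0 z; first by have := key z z0; lra.
have := key (- z); rewrite oppr_ge0 sqrrN => /(_ z0); lra.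
Qed.

Section law_moments.
Context d0 {T : measurableType d0} {R : realType} (P : probability T R) {d : nat}.
Notation E := (euclidean R d).
Variable X : {RV P >-> E}.

Let mu : {sigma_finite_measure set E -> \bar R} := distribution P X.
Let muT : mu setT = 1%E. Proof. exact: probability_setT. Qed.

(** Positive and negative parts are transferred separately, so that this
    applies to the coordinates before their integrability is known. *)
Lemma integral_law (f : E -> R) : measurable_fun setT f ->
  (\int[mu]_x (f x)%:E = \int[P]_w (f (X w))%:E)%E.
Proof.
move=> mf; have mE : measurable_fun setT (EFin \o f) by exact/measurable_EFinP.
have mp := measurable_funepos mE; have mn := measurable_funeneg mE.
rewrite integralE [in RHS]integralE.
rewrite (ge0_integral_distribution X mp)// (ge0_integral_distribution X mn)//.
by congr (_ - _)%E; apply: eq_integral => w _; rewrite /= ?funeposE ?funenegE.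
Qed.

Let laplace (y : E) : R := \int[mu]_x tilt y x.

Hypothesis strict_subgaussian : forall t0 : R, 0 < t0 ->
     (ereal_sup [set (expR (- (enorm t ^+ 2) / 2))%:E *
                     'E_P[fun w => expR (dotp t (X w))]
                | t in [set t : E | (t0 <= enorm t)%R]] < 1)%E.

Let Ee (y : E) : \bar R := (\int[mu]_x (tilt y x)%:E)%E.

Let EeE y : 'E_P[fun w => expR (dotp y (X w))]%E = Ee y.
Proof. by rewrite unlock /Ee integral_law//; exact: measurable_tilt. Qed.

Let strict t : 0 < t -> exists2 del : R, 0 < del < 1 &
  forall y, t <= enorm y -> (Ee y <= (del * expR (enorm y ^+ 2 / 2))%:E)%E.
Proof.
move=> t0; have := strict_subgaussian t0; set S := ereal_sup _ => S1.
have SE y : t <= enorm y -> ((expR (- (enorm y ^+ 2) / 2))%:E * Ee y <= S)%E.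
  by move=> ty; apply: ereal_sup_ubound; exists y => //; rewrite EeE.
(* the maximum with 1/2 makes del positive, whatever the supremum is *)
exists (Num.max (fine S) (1 / 2)).
  rewrite lt_max gt_max; apply/andP; split; first by apply/orP; right; lra.
  apply/andP; split; last by lra.
  by move: S1; case: S {SE} => [r| |]//=; rewrite ?lte_fin ?ltr01.
move=> y ty; have h := SE y ty.
have -> : (Ee y = (expR (enorm y ^+ 2 / 2))%:E * ((expR (- (enorm y ^+ 2) / 2))%:E * Ee y))%E.
  by rewrite muleA -EFinM -expRD mulNr subrr expR0 mul1e.
rewrite [X in (_ <= X%:E)%E]mulrC EFinM; apply: lee_wpmul2l; first by rewrite lee_fin expR_ge0.
apply: le_trans h _.
move: S1; case: S {SE} => [r| |]//= r1.
  by rewrite lee_fin le_max lexx.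
by rewrite leNye.
Qed.

Let Ee_vzero : Ee vzero = 1%E.
Proof.
rewrite /Ee -muT (_ : (fun x => _) = cst 1%E); last first.
  by apply/funext => x; rewrite /tilt dotp0l expR0.
by rewrite integral_cst// mul1e.
Qed.

(** For y <> 0 this is the strict bound at t0 = |y|, and at y = 0 both sides
    are 1. *)
Let Ee_le y : (Ee y <= (expR (enorm y ^+ 2 / 2))%:E)%E.
Proof.
have [y0|y0] := eqVneq (enorm y) 0.
  rewrite y0 expr0n mul0r expR0 (_ : y = vzero) ?Ee_vzero//.
  apply: vecP => i; apply/eqP; rewrite tnth_vzero -normr_le0 -y0.
  exact: tnth_le_enorm.
have yp : 0 < enorm y by rewrite lt_def y0 enorm_ge0.
have [del /andP[del0 del1] h] := strict yp.
apply: le_trans (h y (lexx _)) _.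
by rewrite lee_fin ler_piMl ?expR_ge0// ltW.
Qed.

Lemma integrable_tilt_law y : mu.-integrable setT (EFin \o tilt y).
Proof.
apply/integrableP; split; first by apply/measurable_EFinP; exact: measurable_tilt.
rewrite (_ : (\int[mu]_x _)%E = Ee y); first exact: le_lt_trans (Ee_le y) (ltry _).
by apply: eq_integral => x _; rewrite /= ger0_norm ?tilt_ge0.
Qed.

Let EeR y : Ee y = (laplace y)%:E.
Proof. by rewrite /laplace /Rintegral fineK// integrable_fin_num//; exact: integrable_tilt_law. Qed.

Lemma laplace_le y : laplace y <= expR (enorm y ^+ 2 / 2).
Proof. by rewrite -lee_fin -EeR. Qed.

Lemma laplace_strict t : 0 < t -> exists2 del : R, 0 < del < 1 &
  forall y, t <= enorm y -> laplace y <= del * expR (enorm y ^+ 2 / 2).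
Proof.
by move=> /strict[del d01 h]; exists del => // y ty; rewrite -lee_fin -EeR; exact: h.
Qed.

Let unit_vec (i : 'I_d) (c : R) : E := [tuple if j == i then c else 0 | j < d].

Let dotp_unit i c x : dotp (unit_vec i c) x = c * tnth x i.
Proof.
rewrite /dotp (bigD1 i)//= tnth_mktuple eqxx big1 ?addr0// => j ji.
by rewrite tnth_mktuple (negbTE ji) mul0r.
Qed.

(** Squares of coordinates are dominated by tilts along the coordinate axes.
    *)
Lemma integrable_sqr_law i : mu.-integrable setT (EFin \o (fun x : E => tnth x i ^+ 2)).
Proof.
have j1 := integrable_tilt_law (unit_vec i 1).
have j2 := integrable_tilt_law (unit_vec i (-1)).
have j := integrableZl measurableT 2 (integrableD measurableT j1 j2).
apply: (le_integrable _ _ _ j) => //.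
  by apply/measurable_EFinP; apply: measurable_funX; exact: measurable_coord.
move=> x _; rewrite /= lee_fin /tilt !dotp_unit mul1r mulN1r.
rewrite ger0_norm ?sqr_ge0// ger0_norm ?mulr_ge0 ?addr_ge0 ?expR_ge0//.
exact: sqr_le_expR.
Qed.

Hypotheses (mean0 : mean_zero P X) (cov1 : identity_covariance P X).

Lemma mean_law i : \int[mu]_x (tnth x i : R) = 0.
Proof.
rewrite /Rintegral integral_law; last exact: measurable_coord.
by have := mean0 i; rewrite unlock /coord => ->.
Qed.

Lemma cov_law i j : \int[mu]_x (tnth x i * tnth x j : R) = (i == j)%:R.
Proof.
rewrite /Rintegral (integral_law (f := fun x => tnth x i * tnth x j)); last first.
  by apply: measurable_funM; exact: measurable_coord.
have := cov1 i j; rewrite covariance.unlock !mean0 expectation.unlock => h.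
rewrite (_ : (\int[P]_w _)%E = ((i == j)%:R)%:E)// -h.
apply: eq_integral => w _; congr EFin.
by apply: (congr2 (@GRing.mul R)); exact: (esym (@subr0 R _)).
Qed.

End law_moments.

(** * Rescaling, and comparison with the normal density *)

Section rescaling.
Context {R : realType} {d : nat}.
Notation E := (euclidean R d).
Notation L := (leb R d).

Let mscale (a : R) : measurable_fun setT (vscale a : E -> E).
Proof. exact: (measurable_vscale a (f := id)). Qed.

Lemma vscaleK (a : R) (x : E) : 0 < a -> vscale a^-1 (vscale a x) = x.
Proof.
by move=> a0; apply: vecP => i; rewrite !tnth_vscale mulrA mulVf ?mul1r// gt_eqF.
Qed.

Lemma leb_scale (a : R) (f : E -> \bar R) : 0 < a ->
  measurable_fun setT f -> (forall x, 0 <= f x)%E ->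
  (\int[L]_x f x = (a ^+ d)%:E * \int[L]_x f (vscale a x))%E.
Proof.
move=> a0 mf f0; rewrite (leb_affine vzero a0 mf f0).
congr (_ * _)%E; apply: eq_integral => x _; congr f.
by apply: vecP => i; rewrite tnth_vadd tnth_vzero add0r.
Qed.

Lemma integral_preimage_scale (a : R) (p : E -> R) (A : set E) : 0 < a ->
  measurable_fun setT p -> (forall x, 0 <= p x) -> measurable A ->
  (\int[L]_(x in vscale a @^-1` A) (p x)%:E =
   \int[L]_(x in A) (a^-1 ^+ d * p (vscale a^-1 x))%:E)%E.
Proof.
move=> a0 mp p0 mA.
have mB : measurable (vscale a @^-1` A).
  by rewrite -[X in measurable X]setTI; exact: mscale.
have mq : measurable_fun setT (fun x => (a^-1 ^+ d * p (vscale a^-1 x))%:E).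
  apply/measurable_EFinP; apply: measurable_funM => //.
  exact: (measurableT_comp mp (mscale a^-1)).
rewrite integral_mkcond [in RHS]integral_mkcond.
rewrite [RHS](leb_scale a0); last 2 first.
- by apply/(measurable_restrictT _ mA); exact: measurable_funTS.
- move=> x; apply: erestrict_ge0 => y _.
  by rewrite lee_fin mulr_ge0// exprn_ge0// invr_ge0 ltW.
rewrite -ge0_integralZl; last 4 first.
- by [].
- apply: measurableT_comp (mscale a).
  by apply/(measurable_restrictT _ mA); exact: measurable_funTS.
- move=> x _; apply: erestrict_ge0 => y _.
  by rewrite lee_fin mulr_ge0// exprn_ge0// invr_ge0 ltW.
- by rewrite lee_fin exprn_ge0// ltW.
apply: eq_integral => x _; rewrite !patchE.
rewrite (_ : (x \in vscale a @^-1` A) = (vscale a x \in A)); last first.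
  by apply/idP/idP => /set_mem h; apply/mem_set.
case: ifP => _; last by rewrite mule0.
by rewrite vscaleK// -EFinM mulrA -exprMn mulfV ?gt_eqF// expr1n mul1r.
Qed.

Lemma ae_scale (a : R) (Q : E -> Prop) : 0 < a ->
  {ae L, forall x, Q (vscale a x)} -> {ae L, forall x, Q x}.
Proof.
move=> a0 [N [mN N0 QN]].
have ia0 : 0 < a^-1 by rewrite invr_gt0.
have mB : measurable (vscale a^-1 @^-1` N).
  by rewrite -[X in measurable X]setTI; exact: mscale.
exists (vscale a^-1 @^-1` N); split => //.
  have e1 : (\int[L]_x (\1_N x)%:E = 0)%E.
    by rewrite integral_indic// setIT; exact: N0.
  have e2 : (\int[L]_x (\1_N (vscale a^-1 x))%:E = L (vscale a^-1 @^-1` N))%E.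
    have := integral_indic L measurableT mB; rewrite setIT => <-.
    by apply: eq_integral => x _; rewrite !indicE.
  have mI : measurable_fun setT (fun x : E => (\1_N x)%:E : \bar R).
    exact/measurable_EFinP.
  have I0 (x : E) : (0 <= (\1_N x)%:E :> \bar R)%E by rewrite lee_fin.
  have := leb_scale ia0 mI I0; rewrite e1 e2 => /esym/eqP.
  rewrite mule_eq0 => /orP[|/eqP//].
  by rewrite eqe expf_eq0 invr_eq0 (gt_eqF a0) andbF.
move=> x nQ; apply: QN => /= h; apply: nQ.
  by have := h; rewrite -{1}(invrK a) vscaleK.
Qed.

End rescaling.

Section gaussian_density.
Context {R : realType} {d : nat}.
Notation E := (euclidean R d).
Notation L := (leb R d).
Notation phi := (@std_normal_density R d).

Lemma std_normal_densityE x :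
  phi x = (Num.sqrt (2 * pi) ^+ d)^-1 * expR (- (enorm x ^+ 2 / 2)).
Proof.
rewrite /std_normal_density mulNr powRN; congr (_^-1 * _).
rewrite [d%:R / 2]mulrC powRrM powR12_sqrt ?powR_mulrn ?sqrtr_ge0//.
by rewrite mulr_ge0// pi_ge0.
Qed.

Lemma std_normal_density_gt0 x : 0 < phi x.
Proof. by rewrite mulr_gt0 ?expR_gt0// powR_gt0// mulr_gt0// pi_gt0. Qed.

Lemma measurable_std_normal_density : measurable_fun setT phi.
Proof.
apply: measurable_funM => //; apply: measurableT_comp => //.
apply: measurable_funM => //; apply: measurableT_comp => //.
by apply: measurable_funX; exact: measurable_enorm.
Qed.

Lemma integral_std_normal_density : (\int[L]_x (phi x)%:E = 1)%E.
Proof.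
have s0 : 0 < Num.sqrt (2 * pi) ^+ d :> R.
  by rewrite exprn_gt0// sqrtr_gt0 mulr_gt0// pi_gt0.
under eq_integral do rewrite std_normal_densityE EFinM.
rewrite ge0_integralZl; [|by []| |by move=> s _; rewrite lee_fin expR_ge0|by rewrite lee_fin invr_ge0 ltW].
  rewrite (eq_integral (fun s => (expR (- (1 * enorm s ^+ 2 / 2)))%:E)); last first.
    by move=> s _; rewrite mul1r.
  by rewrite integral_gauss// divr1 -EFinM mulVf ?gt_eqF.
apply/measurable_EFinP; apply: measurableT_comp => //.
apply: measurableT_comp => //; apply: measurable_funM => //.
by apply: measurable_funX; exact: measurable_enorm.
Qed.

Lemma TinftyP (p : E -> R) (eps : R) :
  {ae L, forall x, p x <= (1 + eps) * phi x} <-> (Tinfty p <= eps%:E)%E.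
Proof.
have eqv x : (p x <= (1 + eps) * phi x) = ((p x - phi x) / phi x <= eps).
  by rewrite ler_pdivrMr ?std_normal_density_gt0// lerBlDr mulrDl mul1r addrC.
split=> [h|/ess_supP h].
  by apply/ess_supP; apply: (ae_mono _ h) => x; rewrite eqv lee_fin.
by apply: (ae_mono _ h) => x; rewrite eqv lee_fin.
Qed.

(** A density is not almost everywhere below (1 - e) times the normal density,
    as both integrate to 1. *)
Lemma Tinfty_ge0 (p : E -> R) : measurable_fun setT p -> (forall x, 0 <= p x) ->
  (\int[L]_x (p x)%:E = 1)%E -> (0 <= Tinfty p)%E.
Proof.
move=> mp p0 p1; rewrite leNgt; apply/negP => T0.
have [e /andP[e0 e1] Te] : exists2 e : R, 0 < e < 1 & (Tinfty p <= (- e)%:E)%E.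
  have h0 : 0 < 2^-1 :> R by rewrite invr_gt0.
  have h1 : 2^-1 < 1 :> R by rewrite invf_lt1// ltr1n.
  move: T0; case: (Tinfty p) => [r| |]//=.
    rewrite lte_fin => r0; exists (Num.min (- r) 2^-1).
      by rewrite lt_min gt_min h0 h1 oppr_gt0 r0 orbT.
    by rewrite lee_fin lerNr ge_min lexx.
  by move=> _; exists 2^-1; rewrite ?leNye ?h0.
have := ae_ge0_le_integral measurableT (mu := L) (f1 := EFin \o p)
  (f2 := fun x => (1 - e)%:E * (phi x)%:E)%E.
have e3 : 0 <= 1 - e by rewrite subr_ge0 ltW.
rewrite ge0_integralZl; [|by []|by apply/measurable_EFinP; exact: measurable_std_normal_density|by move=> s _; rewrite lee_fin ltW// std_normal_density_gt0|by []].
rewrite integral_std_normal_density p1 mule1 => h.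
have : (1 <= (1 - e)%:E :> \bar R)%E.
  apply: h.
  - by move=> x _; rewrite lee_fin.
  - exact/measurable_EFinP.
  - by move=> x _; rewrite -EFinM lee_fin mulr_ge0// ltW// std_normal_density_gt0.
  - apply: emeasurable_funM => //; by apply/measurable_EFinP; exact: measurable_std_normal_density.
  - move/TinftyP : Te; apply: ae_mono => x hx _.
    by rewrite -EFinM lee_fin.
by rewrite lee_fin lerBrDr gerDl leNgt e0.
Qed.

End gaussian_density.

(** * Normalized sums *)

Section normalization.
Context d0 {T : measurableType d0} {R : realType} (P : probability T R) {d : nat}.
Notation E := (euclidean R d).
Notation L := (leb R d).
Variable Xs : nat -> {RV P >-> E}.

Lemma normalized_sumE n :
  normalized_sum Xs n = vscale (Num.sqrt n%:R)^-1 \o psum Xs n :> (T -> E).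
Proof.
by apply/funext => w; apply: vecP => i; rewrite /= tnth_vscale !tnth_mktuple mulrC.
Qed.

Lemma psum_normalized n : (0 < n)%N ->
  psum Xs n = vscale (Num.sqrt n%:R) \o normalized_sum Xs n :> (T -> E).
Proof.
move=> n0; apply/funext => w; rewrite normalized_sumE /=.
rewrite -{1}[Num.sqrt n%:R]invrK vscaleK// invr_gt0 sqrtr_gt0 ltr0n//.
Qed.

Let mscale (a : R) (A : set E) : measurable A -> measurable (vscale a @^-1` A).
Proof.
move=> mA; rewrite -[X in measurable X]setTI.
exact: (measurable_vscale a (f := id)).
Qed.

Lemma density_psum n p : (0 < n)%N -> is_density P (normalized_sum Xs n) p ->
  forall A, measurable A -> distribution P (psum Xs n) A =
  (\int[L]_(x in A) ((Num.sqrt n%:R)^-1 ^+ d * p (vscale (Num.sqrt n%:R)^-1 x))%:E)%E.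
Proof.
move=> n0 [mp p0 pE] A mA.
have s0 : 0 < Num.sqrt n%:R :> R by rewrite sqrtr_gt0 ltr0n.
rewrite -(integral_preimage_scale s0 mp p0 mA) -(pE _ (mscale _ mA)).
by rewrite -[LHS]/(P (psum Xs n @^-1` A)) psum_normalized.
Qed.

Lemma density_normalized n (f : E -> R) : (0 < n)%N ->
  measurable_fun setT f -> (forall x, 0 <= f x) ->
  (forall A, measurable A ->
    distribution P (psum Xs n) A = (\int[L]_(x in A) (f x)%:E)%E) ->
  is_density P (normalized_sum Xs n)
    (fun x => Num.sqrt n%:R ^+ d * f (vscale (Num.sqrt n%:R) x)).
Proof.
move=> n0 mf f0 fE.
have s0 : 0 < Num.sqrt n%:R :> R by rewrite sqrtr_gt0 ltr0n.
have is0 : 0 < (Num.sqrt n%:R)^-1 :> R by rewrite invr_gt0.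
split.
- apply: measurable_funM => //; apply: (measurableT_comp mf).
  exact: (measurable_vscale _ (f := id)).
- by move=> x; rewrite mulr_ge0// exprn_ge0// ltW.
move=> A mA; have := integral_preimage_scale is0 mf f0 mA; rewrite invrK => <-.
rewrite -(fE _ (mscale _ mA)).
by rewrite -[LHS]/(P (normalized_sum Xs n @^-1` A)) normalized_sumE.
Qed.

Lemma density_unique (Z : {RV P >-> E}) (p q : E -> R) :
  is_density P Z p -> is_density P Z q -> {ae L, forall x, p x = q x}.
Proof.
move=> [mp p0 pE] [mq q0 qE].
have ip : L.-integrable setT (EFin \o p).
  apply/integrableP; split; first exact/measurable_EFinP.
  rewrite (eq_integral (EFin \o p)); last by move=> x _; rewrite /= ger0_norm.
  by rewrite -pE// probability_setT ltry.
have := integral_ae_eq measurableT ip (g := EFin \o q) _ _.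
move=> /(_ _ _)h; apply: (ae_mono _ (h _ _)).
- by move=> x /(_ I)[].
- exact/measurable_EFinP.
- by move=> A _ mA; rewrite -pE// -qE.
Qed.

(** Modifying p on a null set turns the almost everywhere bound expressed by
    Tinfty into a bound at every point, which cdens has to start from. *)
Lemma gaussian_dominated_density (Z : {RV P >-> E}) (p : E -> R) :
  is_density P Z p -> (Tinfty p < +oo)%E ->
  exists2 B : R, 0 <= B & exists2 q : E -> R, is_density P Z q &
    forall x, q x <= B * expR (- (enorm x ^+ 2 / 2)).
Proof.
move=> [mp p0 pE] Tp.
have [M /(TinftyP p)] : exists M : R, (Tinfty p <= M%:E)%E.
  move: Tp; case: (Tinfty p) => [r| |]// _; first by exists r.
  by exists 0; rewrite leNye.
move=> pM; pose q x := Num.min (p x) ((1 + `|M|) * std_normal_density x).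
have M0 : 0 <= 1 + `|M| by rewrite addr_ge0.
have mq : measurable_fun setT q.
  apply: measurable_minr => //; apply: measurable_funM => //.
  exact: measurable_std_normal_density.
exists ((1 + `|M|) * (Num.sqrt (2 * pi) ^+ d)^-1).
  by rewrite mulr_ge0// invr_ge0 exprn_ge0// sqrtr_ge0.
exists q; last first.
  by move=> x; rewrite -mulrA -std_normal_densityE ge_min lexx orbT.
split => //.
  by move=> x; rewrite le_min p0 mulr_ge0// ltW// std_normal_density_gt0.
move=> A mA; rewrite pE//; apply: ae_eq_integral => //.
- by apply/measurable_EFinP; exact: measurable_funTS.
- by apply/measurable_EFinP; exact: measurable_funTS.
apply: (ae_mono _ pM) => x hx _; congr EFin.
rewrite /q min_l//; apply: le_trans hx _.
by rewrite ler_wpM2r ?(ltW (std_normal_density_gt0 x))// lerD2l ler_norm.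
Qed.

End normalization.

Theorem corollary1p3 (R : realType) (d : nat)
  (d0 : measure_display) (T : measurableType d0) (P : probability T R)
  (X : {RV P >-> euclidean R d}) (Xs : nat -> {RV P >-> euclidean R d})
  (mean0 : mean_zero P X) (cov1 : identity_covariance P X)
  (copies : independent_copies P X Xs)
  (n0 : nat) (n0_gt0 : (0 < n0)%N)
  (dens_n0 : exists p : euclidean R d -> R,
     is_density P (normalized_sum Xs n0) p /\ (Tinfty p < +oo)%E)
  (strict_subgaussian : forall t0 : R, 0 < t0 ->
     (ereal_sup [set (expR (- (enorm t ^+ 2) / 2))%:E *
                     'E_P[fun w => expR (dotp t (X w))]
                | t in [set t : euclidean R d | (t0 <= enorm t)%R]] < 1)%E) :
  (forall n, (n0 <= n)%N ->
     exists p : euclidean R d -> R, is_density P (normalized_sum Xs n) p) /\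
  (forall p : nat -> euclidean R d -> R,
     (forall n, (n0 <= n)%N -> is_density P (normalized_sum Xs n) (p n)) ->
     Tinfty (p n) @[n --> \oo] --> 0%E).

Proof.
have iy := integrable_tilt_law strict_subgaussian.
have i2 := integrable_sqr_law strict_subgaussian.
have mean := mean_law mean0; have cov := cov_law mean0 cov1.
have Lle := laplace_le strict_subgaussian.
have Lstrict := laplace_strict strict_subgaussian.
have [p [dp Tp]] := dens_n0.
have [B B0 [q dq qB]] := gaussian_dominated_density dp Tp.
have [mq q0 qE] := dq.
have s0 : 0 < Num.sqrt n0%:R :> R by rewrite sqrtr_gt0 ltr0n.
pose c : R := (Num.sqrt n0%:R)^-1.
have c0 : 0 < c by rewrite invr_gt0.
(* a density of the sum of the first n0 copies, below a Gaussian everywhere *)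
pose f0 s := c ^+ d * q (vscale c s).
have mf0 : measurable_fun setT f0.
  apply: measurable_funM => //; apply: (measurableT_comp mq).
  exact: (measurable_vscale c (f := id)).
have f00 s : 0 <= f0 s by rewrite mulr_ge0// exprn_ge0// ltW.
have f0E := density_psum n0_gt0 dq.
have f0_le s : f0 s <= c ^+ d * B * expR (- (enorm s ^+ 2) / (2 * n0%:R)).
  rewrite -mulrA ler_wpM2l ?exprn_ge0 ?(ltW c0)//; apply: le_trans (qB _) _.
  rewrite enormZ exprMn gtr0_norm// /c exprVn sqr_sqrtr ?ler0n//.
  apply: eq_imp_le; congr (_ * expR _).
  by field; rewrite pnatr_eq0 -lt0n.
have dens k := cdens_density copies iy n0_gt0 mf0 f00 f0_le f0E k.
have gm k := measurable_cdens iy n0_gt0 mf0 f00 f0_le k.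
have g0 k s := cdens_ge0 iy n0_gt0 mf0 f00 f0_le k s.
have key := cdens_le_gauss copies i2 mean cov iy Lle Lstrict n0_gt0 mf0 f00 f0_le f0E.
have dn n : (n0 <= n)%N -> is_density P (normalized_sum Xs n)
    (fun x => Num.sqrt n%:R ^+ d * cdens X f0 (n - n0) (vscale (Num.sqrt n%:R) x)).
  move=> n0n; apply: density_normalized => //.
    exact: leq_trans n0_gt0 n0n.
  by move=> A mA; rewrite -dens// subnKC.
split=> [n n0n|pn dpn]; first by eexists; exact: dn.
have T0 n : (n0 <= n)%N -> (0 <= Tinfty (pn n))%E.
  move=> n0n; have [m0 pos E] := dpn n n0n; apply: Tinfty_ge0 => //.
  by rewrite -E// probability_setT.
have Teps (eps : R) : 0 < eps -> exists N, forall n, (N <= n)%N -> (Tinfty (pn n) <= eps%:E)%E.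
  move=> eps0; have [N HN] := key _ eps0.
  exists (maxn N n0) => n; rewrite geq_max => /andP[Nn n0n].
  apply/TinftyP.
  have npos : 0 < n%:R :> R by rewrite ltr0n; exact: leq_trans n0_gt0 n0n.
  have sn : 0 < Num.sqrt n%:R :> R by rewrite sqrtr_gt0.
  have := HN (n - n0)%N; rewrite subnKC// => /(_ Nn) Hn.
  have sn' : 0 < (Num.sqrt n%:R)^-1 :> R by rewrite invr_gt0.
  have Hs : {ae leb R d, forall x, Num.sqrt n%:R ^+ d *
      cdens X f0 (n - n0) (vscale (Num.sqrt n%:R) x) <= (1 + eps) * std_normal_density x}.
    apply: (ae_scale sn'); apply: (ae_mono _ Hn) => x hx.
    rewrite -{2}[Num.sqrt n%:R]invrK vscaleK//.
    apply: le_trans (ler_wpM2l (exprn_ge0 _ (ltW sn)) hx) _.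
    rewrite std_normal_densityE enormZ exprMn gtr0_norm// exprVn (@sqr_sqrtr _ n%:R) ?ler0n//.
    have tp : 0 <= 2 * pi :> R by rewrite mulr_ge0// pi_ge0.
    rewrite (_ : enorm x ^+ 2 / (2 * n%:R) = n%:R^-1 * enorm x ^+ 2 / 2); last first.
      by field; rewrite gt_eqF.
    rewrite (sqrtrM _ tp) exprMn invfM; apply: eq_imp_le.
    move: (Num.sqrt (2 * pi) ^+ d)^-1 (expR _) => a b.
    by field; rewrite expf_neq0// gt_eqF.
  apply: (ae_mono2 _ Hs (density_unique (dpn n n0n) (dn n n0n))).
  by move=> x hx ->.
apply/fine_cvgP; split.
  have [N HN] := Teps 1 ltr01.
  exists (maxn N n0) => // n /=; rewrite geq_max => /andP[Nn n0n].
  have := T0 n n0n; have := HN n Nn.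
  by case: (Tinfty (pn n)).
apply/cvgrPdist_le => eps eps0.
have [N HN] := Teps _ eps0.
exists (maxn N n0) => // n /=; rewrite geq_max => /andP[Nn n0n].
have := T0 n n0n; have := HN n Nn.
case: (Tinfty (pn n)) => [r| |]//=; rewrite !lee_fin sub0r normrN => r1 r2.
by rewrite ger0_norm.
Qed.
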